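(* Let $n\ge1$ and $T>0$. Assume that $(\mu,\lambda,\kappa)$ satisfies $$\mu(0,0)>0,\qquad n\lambda(0,0)+2\mu(0,0)=\lambda_0>0,\qquad \kappa(s_1,s_2)\ge0\ \text{ for all } s_1,s_2\ge0.$$ Suppose that $(\rho,S,u)\in C^1([0,T];H^k(\mathbb{R}^n))$, $k>[\frac n2]+2$, is a solution to the Cauchy problem for the compressible Navier–Stokes system of a polytropic gas (described in the context) with initial data $(\rho_0,S_0,u_0)$, where the initial density $\rho_0$ is compactly supported in the ball $B_{r_0}$. Then $$m_0r_0\ \ge\ m_{1i}+m_{2i}T\ \ge\ -m_0r_0,\qquad i=1,\dots,n.$$
   Context: **System.** In $\mathbb{R}^n\times\mathbb{R}_+$, with unknown density $\rho\ge 0$, entropy $S$ and velocity $u$ (with values in $\mathbb{R}^n$): $$\rho_t+\mathrm{div}(\rho u)=0,$$ $$(\rho u)_t+\mathrm{div}(\rho u\otimes u)+\nabla p=\mathrm{div}(\mu(\nabla u+\nabla u^\top))+\nabla(\lambda\,\mathrm{div}u),$$ $$(\rho e)_t+\mathrm{div}(\rho e u)+p\,\mathrm{div}u=\tfrac{\mu}{2}|\nabla u+\nabla u^\top|^2+\lambda(\mathrm{div}u)^2+\mathrm{div}(\kappa\nabla e),$$ where $(\kappa,\mu,\lambda)=(\kappa,\mu,\lambda)(\rho,\theta)$ are given functions of the density and the temperature $\theta$, and the equations of state are those of a polytropic gas: $$p=R\rho\theta,\qquad e=c_v\theta,\qquad p=A\exp(S/c_v)\rho^\gamma,$$ with constants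 $R>0$ (gas constant), $A>0$, $\gamma>1$, and $c_v=\frac{R}{\gamma-1}$. In particular the temperature vanishes where $\rho=0$. **Initial data.** $(\rho,S,u)|_{t=0}=(\rho_0,S_0,u_0)\in H^k(\mathbb{R}^n)$, $k>[\frac n2]+2$. **Notation.** $B_r$ is the ball of radius $r$ in $\mathbb{R}^n$ centered at the origin, and $$m_0=\int_{\mathbb{R}^n}\rho_0\,dx,\qquad m_1=\int_{\mathbb{R}^n}\rho_0(x)x\,dx\in\mathbb{R}^n,\qquad m_2=\int_{\mathbb{R}^n}\rho_0(x)u_0(x)\,dx\in\mathbb{R}^n,$$ with components $m_{1i}$, $m_{2i}$, $i=1,\dots,n$. It is always assumed that $m_0>0$. *)

(* Defs.v *)
From HB Require Import structures.
From mathcomp Require Import all_boot all_order all_algebra.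
From mathcomp Require Import all_classical all_reals all_analysis.

Set Implicit Arguments.
Unset Strict Implicit.
Unset Printing Implicit Defensive.

Import Order.TTheory GRing.Theory Num.Theory.
Import numFieldNormedType.Exports.

Local Open Scope classical_set_scope.
Local Open Scope ring_scope.

(* the coordinates generate the Borel sigma-algebra of R^n *)

Section borel_rV.
Context {R : realType} (n : nat).

Let coord : 'I_n -> 'rV[R]_n -> R := fun i x => x 0 i.

Let rV_set0 : g_sigma_preimage coord set0.
Proof. exact: sigma_algebra0. Qed.

Let rV_setC A : g_sigma_preimage coord A -> g_sigma_preimage coord (~` A).
Proof. exact: sigma_algebraC. Qed.

Let rV_bigcup (F : (set 'rV[R]_n)^nat) :
  (forall i, g_sigma_preimage coord (F i)) ->
  g_sigma_preimage coord (\bigcup_i (F i)).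
Proof. exact: sigma_algebra_bigcup. Qed.

HB.instance Definition _ := @isMeasurable.Build
  (measure_tuple_display default_measure_display)
  'rV[R]_n (g_sigma_preimage coord) rV_set0 rV_setC rV_bigcup.

End borel_rV.

Lemma measurable_coord (R : realType) (n : nat) (i : 'I_n) :
  measurable_fun [set: 'rV[R]_n] (fun x => x 0 i).
Proof.
move=> _ Y mY; rewrite setTI; apply: sub_sigma_algebra => /=.
rewrite -bigcup_seq/=; exists i => /=; first by rewrite mem_index_enum.
by exists Y => //; rewrite setTI.
Qed.

Lemma measurable_fun_coordP d (T : measurableType d) (R : realType) (n : nat)
    (f : T -> 'rV[R]_n) :
  (forall i, measurable_fun [set: T] (fun x => f x 0 i)) ->
  measurable_fun [set: T] f.
Proof.
move=> mf; apply: (@measurability _ _ _ _ _ _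
  (\big[setU/set0]_(i < n)
     preimage_set_system setT (fun x : 'rV[R]_n => x 0 i) measurable)) => //.
move=> _ [B + <-]; rewrite -bigcup_seq => -[i _ [C mC <-]].
by rewrite [X in _ `&` X]setTI; exact: mf.
Qed.

Section rV_cons.
Context {R : realType} (n : nat).

Definition rV_cons (p : R * 'rV[R]_n) : 'rV[R]_n.+1 :=
  \row_i (if unlift ord0 i is Some j then p.2 0 j else p.1).

Definition rV_uncons (x : 'rV[R]_n.+1) : R * 'rV[R]_n :=
  (x 0 ord0, \row_j x 0 (lift ord0 j)).

Lemma rV_consK : cancel rV_cons rV_uncons.
Proof.
move=> [a v]; rewrite /rV_uncons mxE unlift_none; congr pair.
by apply/rowP => j; rewrite !mxE liftK.
Qed.

Lemma rV_unconsK : cancel rV_uncons rV_cons.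
Proof.
by move=> x; apply/rowP => i; rewrite mxE; case: unliftP => [j|] ->//; rewrite mxE.
Qed.

Lemma measurable_rV_cons : measurable_fun [set: R * 'rV[R]_n] rV_cons.
Proof.
apply: measurable_fun_coordP => i; under eq_fun do rewrite mxE.
case: (unlift ord0 i) => [j|]; last exact: measurable_fst.
exact: measurableT_comp (@measurable_coord R n j) measurable_snd.
Qed.

Lemma measurable_rV_uncons : measurable_fun [set: 'rV[R]_n.+1] rV_uncons.
Proof.
apply/measurable_fun_pairP; split; first exact: measurable_coord.
apply: measurable_fun_coordP => i.
under eq_fun do rewrite /= mxE.
exact: measurable_coord.
Qed.

Variable m : {sigma_finite_measure set 'rV[R]_n -> \bar R}.

Definition lebesgue_succ : set 'rV[R]_n.+1 -> \bar R :=
  pushforward (@lebesgue_measure R \x m)%E rV_cons.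

Let lebesgue_succ0 : lebesgue_succ set0 = 0%E.
Proof. by rewrite /lebesgue_succ /pushforward preimage_set0 measure0. Qed.

Let lebesgue_succ_ge0 A : (0 <= lebesgue_succ A)%E.
Proof. exact: (measure_ge0 (@lebesgue_measure R \x m)%E). Qed.

Let lebesgue_succ_sigma_additive : semi_sigma_additive lebesgue_succ.
Proof.
by apply: measure_semi_sigma_additive; exact: measurable_rV_cons.
Qed.

HB.instance Definition _ := isMeasure.Build _ _ _ lebesgue_succ
  lebesgue_succ0 lebesgue_succ_ge0 lebesgue_succ_sigma_additive.

Let lebesgue_succ_sigma_finite : sigma_finite setT lebesgue_succ.
Proof.
have /sigma_finiteP[F [FT ndF Foo]] := sigma_finiteT (@lebesgue_measure R).
have /sigma_finiteP[G [GT ndG Goo]] := sigma_finiteT m.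
exists (fun k => rV_uncons @^-1` (F k `*` G k)).
  rewrite -preimage_bigcup -(preimage_setT rV_uncons) -setXTT FT GT.
  congr (_ @^-1` _); apply/seteqP; split=> [[x y] [/= [j _ Fx] [k _ Gy]]|].
    exists (maxn j k) => //; split.
      by move: x Fx; exact/subsetPset/ndF/leq_maxl.
    by move: y Gy; exact/subsetPset/ndG/leq_maxr.
  by move=> [x y] [k _ []/= ? ?]; split; exists k.
move=> k; have [mF Fk] := Foo k; have [mG Gk] := Goo k; split.
  rewrite -[X in measurable X]setTI; apply: measurable_rV_uncons => //.
  exact: measurableX.
rewrite /lebesgue_succ /pushforward -comp_preimage.
rewrite (_ : _ \o _ = id); last by apply/funext => p; exact: rV_consK.
by rewrite preimage_id product_measure1E// lte_mul_pinfty// ge0_fin_numE.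
Qed.

HB.instance Definition _ := Measure_isSigmaFinite.Build _ _ _ lebesgue_succ
  lebesgue_succ_sigma_finite.

End rV_cons.

Fixpoint lebesgue_rV {R : realType} n :
    {sigma_finite_measure set 'rV[R]_n -> \bar R} :=
  if n is n'.+1 then lebesgue_succ (lebesgue_rV n')
  else \d_(0 : 'rV[R]_0).

Lemma lebesgue_rV_box (R : realType) n (A : 'I_n -> set R) :
  (forall i, measurable (A i)) ->
  lebesgue_rV n [set x : 'rV[R]_n | forall i, A i (x 0 i)] =
  (\prod_(i < n) lebesgue_measure (A i))%E.
Proof.
elim: n A => [|n IHn] A mA.
  by rewrite big_ord0 /= diracE mem_set// => -[].
have mB : measurable [set x : 'rV[R]_n | forall i, A (lift ord0 i) (x 0 i)].
  rewrite (_ : mkset _ = \big[setI/setT]_(i < n)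
      ((fun x : 'rV[R]_n => x 0 i) @^-1` A (lift ord0 i))).
    apply: bigsetI_measurable => i _; rewrite -[X in measurable X]setTI.
    exact: measurable_coord.
  by rewrite -bigcap_seq; apply/seteqP; split=> x /= Ax i; [move=> _|];
    apply: Ax => //=; exact: mem_index_enum.
rewrite big_ord_recl -(IHn (fun j => A (lift ord0 j)))//.
rewrite -product_measure1E//=; last exact: (mA ord0).
rewrite /lebesgue_succ /pushforward; congr product_measure1.
apply/seteqP; split=> -[a v] /= => [AA|[Aa Av] i].
  split=> [|j]; first by have := AA ord0; rewrite mxE unlift_none.
  by have := AA (lift ord0 j); rewrite mxE liftK.
by rewrite mxE; case: unliftP => [j ->|->].
Qed.

Section sobolev.
Context {R : realType} {n : nat}.
Notation "'leb'" := (@lebesgue_rV R n).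

Definition euclidean_norm (x : 'rV[R]_n) : R := Num.sqrt (\sum_i x 0 i ^+ 2).

Definition euclidean_ball (r : R) : set 'rV[R]_n :=
  [set x | euclidean_norm x < r].

Definition partial (i : 'I_n) (f : 'rV[R]_n -> R) : 'rV[R]_n -> R :=
  fun x => 'D_(delta_mx 0 i) f x.

(* a list of m indices stands for a derivative of order m; for smooth
   functions the order of the list is irrelevant *)
Definition partials (s : seq 'I_n) (f : 'rV[R]_n -> R) : 'rV[R]_n -> R :=
  foldr partial f s.

Definition smooth (f : 'rV[R]_n -> R) : Prop :=
  forall s, continuous (partials s f) /\
    forall i x, derivable (partials s f) x (delta_mx 0 i).

Definition test_function (phi : 'rV[R]_n -> R) : Prop :=
  smooth phi /\ compact (closure [set x | phi x != 0]).

Definition loc_integrable (f : 'rV[R]_n -> R) : Prop :=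
  measurable_fun setT f /\
  forall K, compact K -> leb.-integrable K (EFin \o f).

Definition weak_derivative (s : seq 'I_n) (f g : 'rV[R]_n -> R) : Prop :=
  [/\ loc_integrable f, loc_integrable g &
      forall phi, test_function phi ->
        \int[leb]_x (f x * partials s phi x) =
        (-1) ^+ size s * \int[leb]_x (g x * phi x)].

(* a representative of the weak derivative, when there is one *)
Definition wderiv (s : seq 'I_n) (f : 'rV[R]_n -> R) : 'rV[R]_n -> R :=
  xget (fun=> 0) [set g | weak_derivative s f g].

Definition sobolev (k : nat) (f : 'rV[R]_n -> R) : Prop :=
  forall s : seq 'I_n, (size s <= k)%N ->
    exists2 g, weak_derivative s f g & g \in Lfun leb 2%:E.

(* The tuples of length m enumerate the entries of the full tensor D^m f, so
   mixed derivatives are counted with multiplicity: this is the equivalent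
   norm with square \sum_(m <= k) ||D^m f||_2^2. It is meaningful only when
   sobolev k f. *)
Definition sobolev_norm (k : nat) (f : 'rV[R]_n -> R) : \bar R :=
  ((\sum_(m < k.+1) \sum_(s : m.-tuple 'I_n)
      'N[leb]_2%:E[EFin \o wderiv s f] `^ 2) `^ 2^-1)%E.

Definition cvg_sobolev (k : nat) (D : set R) (f : R -> 'rV[R]_n -> R) (t : R)
    (g : 'rV[R]_n -> R) : Prop :=
  sobolev_norm k (fun x => f s x - g x) @[s --> within D t^'] --> 0%E.

Definition C1_sobolev (k : nat) (T : R) (f : R -> 'rV[R]_n -> R) : Prop :=
  exists f' : R -> 'rV[R]_n -> R, forall t, 0 <= t <= T ->
    [/\ sobolev k (f t), sobolev k (f' t),
        cvg_sobolev k `[0, T] (fun s x => (f s x - f t x) / (s - t)) t (f' t) &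
        cvg_sobolev k `[0, T] f' t (f' t)].

Definition wgrad (f : 'rV[R]_n -> R) (x : 'rV[R]_n) : 'rV[R]_n :=
  \row_j wderiv [:: j] f x.

(* the Jacobian matrix: entry (i, j) is d_j u_i *)
Definition wjacobian (u : 'rV[R]_n -> 'rV[R]_n) (x : 'rV[R]_n) : 'M[R]_n :=
  \matrix_(i, j) wderiv [:: j] (fun y => u y 0 i) x.

Definition wdiv (u : 'rV[R]_n -> 'rV[R]_n) (x : 'rV[R]_n) : R :=
  \tr (wjacobian u x).

(* d_t q + div F = h on R^n x (0, T), where at each time the divergence is
   taken in the sense of distributions on R^n *)
Definition balance_law (T : R) (q : R -> 'rV[R]_n -> R)
    (F : R -> 'rV[R]_n -> 'rV[R]_n) (h : R -> 'rV[R]_n -> R) : Prop :=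
  forall t, 0 < t < T ->
    [/\ loc_integrable (q t), forall j, loc_integrable (fun x => F t x 0 j),
        loc_integrable (h t) &
        forall phi, test_function phi ->
          is_derive t 1 (fun s => \int[leb]_x (q s x * phi x))
            (\sum_j \int[leb]_x (F t x 0 j * partial j phi x) +
             \int[leb]_x (h t x * phi x))].

End sobolev.

Section navier_stokes.
Context {R : realType} {n : nat}.
Notation "'leb'" := (@lebesgue_rV R n).

Definition heat_capacity (Rgas gamma : R) : R := Rgas / (gamma - 1).

(* the last clause is not implied by the others at a vacuum point *)
Definition polytropic_gas (Rgas A gamma : R) (rho S theta p e : R) : Prop :=
  let cv := heat_capacity Rgas gamma in
  [/\ p = Rgas * rho * theta, e = cv * theta,
      p = A * expR (S / cv) * rho `^ gamma & rho = 0 -> theta = 0].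

Variables (mu lambda kappa : R -> R -> R).

Definition strain (u : 'rV[R]_n -> 'rV[R]_n) (x : 'rV[R]_n) : 'M[R]_n :=
  wjacobian u x + (wjacobian u x)^T.

Definition viscous_stress (rho theta : 'rV[R]_n -> R)
    (u : 'rV[R]_n -> 'rV[R]_n) (x : 'rV[R]_n) : 'M[R]_n :=
  mu (rho x) (theta x) *: strain u x +
  (lambda (rho x) (theta x) * wdiv u x)%:M.

Definition dissipation (rho theta : 'rV[R]_n -> R)
    (u : 'rV[R]_n -> 'rV[R]_n) (x : 'rV[R]_n) : R :=
  mu (rho x) (theta x) / 2 * (\sum_i \sum_j strain u x i j ^+ 2) +
  lambda (rho x) (theta x) * wdiv u x ^+ 2.

(* ns_e_grad gives a meaning to kappa grad e: e is a multiple of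
   exp (S / cv) rho^(gamma - 1), which need not be smooth at vacuum. *)
Record navier_stokes_solution (Rgas A gamma : R) (k : nat) (T : R)
    (rho S : R -> 'rV[R]_n -> R) (u : R -> 'rV[R]_n -> 'rV[R]_n)
    (theta p e : R -> 'rV[R]_n -> R) : Prop := {
  ns_rho_reg : C1_sobolev k T rho;
  ns_S_reg : C1_sobolev k T S;
  ns_u_reg : forall i, C1_sobolev k T (fun t x => u t x 0 i);
  ns_rho_ge0 : forall t, 0 <= t <= T -> \forall x \ae leb, 0 <= rho t x;
  ns_state : forall t, 0 <= t <= T -> \forall x \ae leb,
    polytropic_gas Rgas A gamma (rho t x) (S t x) (theta t x) (p t x) (e t x);
  ns_mass : balance_law T rho (fun t x => rho t x *: u t x) (fun _ _ => 0);
  ns_momentum : forall i, balance_law T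
    (fun t x => rho t x * u t x 0 i)
    (fun t x => (rho t x * u t x 0 i) *: u t x + p t x *: delta_mx 0 i
                - row i (viscous_stress (rho t) (theta t) (u t) x))
    (fun _ _ => 0);
  ns_e_grad : forall t, 0 < t < T ->
    forall j, exists g, weak_derivative [:: j] (e t) g;
  ns_energy : balance_law T
    (fun t x => rho t x * e t x)
    (fun t x => (rho t x * e t x) *: u t x
                - kappa (rho t x) (theta t x) *: wgrad (e t) x)
    (fun t x => dissipation (rho t) (theta t) (u t) x - p t x * wdiv (u t) x)
}.

End navier_stokes.

Section moments.
Context {R : realType} {n : nat}.
Notation "'leb'" := (@lebesgue_rV R n).

Definition mass (rho : 'rV[R]_n -> R) : R := \int[leb]_x rho x.

Definition first_moment (rho : 'rV[R]_n -> R) (i : 'I_n) : R :=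
  \int[leb]_x (rho x * x 0 i).

Definition momentum (rho : 'rV[R]_n -> R) (u : 'rV[R]_n -> 'rV[R]_n)
    (i : 'I_n) : R :=
  \int[leb]_x (rho x * u x 0 i).

End moments.

(* Main.v *)
(* For each coordinate i and each sign the gas stays in the half-space where
   +-x_i <= r0. Suppose that at a time t the density vanishes on a half-space
   +-x_i > a. Against a test function supported there, the internal energy is
   nonnegative and vanishes at time t, so that its time derivative vanishes
   too; since the heat flux and the pressure are zero in vacuum, the energy
   equation reduces to the vanishing of the viscous dissipation, a positive
   definite form in the strain. Hence d_i u_i = 0 on the half-space, and u_i,
   being square integrable, is zero there. By continuity in time u_i is
   uniformly small on the half-space shortly after t, and the finite speed of
   propagation for the mass equation shows that the front +-x_i = a advances
   with arbitrarily small speed, that is, not at all.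

   The total mass and momentum of a compactly supported gas are conserved and
   the first moment has derivative the momentum. At time T the first moment is
   therefore m1 + m2 T, and the support bounds it by r0 times the mass.

   Continuity in time of the bounded functions rho and u comes from the Sobolev
   embedding H^k -> L^oo, obtained by pairing weak derivatives with smooth
   approximations of the indicators of boxes. *)
Require Import Defs.
From mathcomp Require Import all_boot all_order all_algebra ring lra.
From mathcomp Require Import all_classical all_reals all_analysis.
From mathcomp Require Import measurable_realfun.

Import Order.TTheory GRing.Theory Num.Theory.
Import numFieldNormedType.Exports.

Set Implicit Arguments.
Unset Strict Implicit.
Unset Printing Implicit Defensive.

Local Open Scope ring_scope.
Local Open Scope classical_set_scope.

(** * Smooth functions of one variable and their tensor products *)

Section smooth1.
Context {R : realType}.
Implicit Types f g : R -> R.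

(** The equations hold only in the sense of distributions in x, so neither characteristics nor
    pointwise identities are available: everything is reached by testing with products of
    one-variable bumps. In place of the flow of [u], the integrals of [rho] against the powers of a
    cutoff satisfy a chain of differential inequalities. The energy argument needs a two-sided time
    derivative at a minimum, hence an interior time; at [t = 0] there is no rigidity and the front
    is only known to move at a bounded speed. This is why the front is compared with
    [a + eta + eta * t]: the constant [eta] pays for the first instant, the slope for all later
    times, and [eta] then tends to 0. Half-spaces replace the complement of the ball because their
    normal is a fixed coordinate direction: the single equation d_i u_i = 0 is used along lines that
    stay in the vacuum up to infinity. Conservation of momentum rests on the same rigidity, since
    [mu 0 0 > 0] and vacuum alone does not cancel the viscous stress. *)

Variant smooth1 f : Prop :=
  Smooth1 of forall m x, derivable (f^`(m)) x 1.

(** Derivatives are peeled off starting from the innermost one, so that closure under sums, products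
    and affine changes of variable is an induction on the order: the derivative of a product is a
    sum of products of functions that are smooth up to the previous order. *)
Fixpoint smooth_upto m f : Prop :=
  if m is m'.+1 then (forall x, derivable f x 1) /\ smooth_upto m' f^`()
  else True.

Lemma smooth1P f : smooth1 f <-> forall m, smooth_upto m f.
Proof.
split=> [[sf] m|].
  elim: m f sf => [//|m IHm] f sf; split; first exact: (sf 0%N).
  by apply: IHm => p x; rewrite -derive1Sn; exact: sf.
move=> h; split=> m; elim: m f h => [|m IHm] f sf x; first by have [] := sf 1%N.
by rewrite derive1Sn; apply: IHm => p; have [] := sf p.+1.
Qed.

Lemma smooth_uptoS m f : smooth_upto m.+1 f -> smooth_upto m f.
Proof. by elim: m f => [//|m IHm] f [df sf]; split => //; exact: IHm. Qed.

Lemma is_derive_derive1 f g : (forall x : R, is_derive x 1 f (g x)) -> f^`() = g.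
Proof. by move=> fg; apply/funext => x; rewrite derive1E derive_val. Qed.

Lemma smooth1_derivable f : smooth1 f -> forall x, derivable f x 1.
Proof. by move=> [/(_ 0%N)]. Qed.

Lemma smooth1_is_derive f : smooth1 f -> forall x : R, is_derive x 1 f (f^`() x).
Proof.
by move=> sf x; rewrite derive1E; apply/derivableP; exact: smooth1_derivable.
Qed.

Lemma smooth1_derive f : smooth1 f -> smooth1 f^`().
Proof. by move=> [sf]; split=> m x; rewrite -derive1Sn. Qed.

Lemma smooth1_derive1n f m : smooth1 f -> smooth1 f^`(m).
Proof. by move=> sf; elim: m => [//|m IHm]; rewrite derive1nS; exact: smooth1_derive. Qed.

Lemma smooth1_prim f g :
  (forall x : R, is_derive x 1 f (g x)) -> smooth1 g -> smooth1 f.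
Proof.
move=> fg [sg]; split=> -[|m] x; first by have [] := fg x.
by rewrite derive1Sn (is_derive_derive1 fg).
Qed.

Lemma smooth1_continuous f : smooth1 f -> continuous f.
Proof.
by move=> sf x; apply/differentiable_continuous/derivable1_diffP/smooth1_derivable.
Qed.

Lemma smooth_uptoD m f g :
  smooth_upto m f -> smooth_upto m g -> smooth_upto m (f \+ g).
Proof.
elim: m f g => [//|m IHm] f g [df sf] [dg sg]; split.
  by move=> x; exact: derivableD.
rewrite (_ : _^`() = f^`() \+ g^`()); first exact: IHm.
by apply/funext => x /=; rewrite !derive1E deriveD.
Qed.

Lemma smooth_uptoM m f g :
  smooth_upto m f -> smooth_upto m g -> smooth_upto m (f \* g).
Proof.
elim: m f g => [//|m IHm] f g sf sg.
have [df sf'] := sf; have [dg sg'] := sg; split.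
  by move=> x; exact: derivableM.
rewrite (_ : _^`() = (f \* g^`()) \+ (g \* f^`())); last first.
  by apply/funext => x /=; rewrite !derive1E deriveM.
by apply: smooth_uptoD; apply: IHm => //; exact: smooth_uptoS.
Qed.

Lemma smooth1_cst c : smooth1 (fun=> c).
Proof.
apply/smooth1P => m; elim: m c => [//|m IHm] c; split.
  by move=> x; exact: derivable_cst.
rewrite (_ : _^`() = fun=> 0) //.
by apply/funext => x; rewrite derive1_cst.
Qed.

Lemma smooth1D f g : smooth1 f -> smooth1 g -> smooth1 (fun x => f x + g x).
Proof. by move=> /smooth1P sf /smooth1P sg; apply/smooth1P => m; exact: smooth_uptoD. Qed.

Lemma smooth1M f g : smooth1 f -> smooth1 g -> smooth1 (fun x => f x * g x).
Proof. by move=> /smooth1P sf /smooth1P sg; apply/smooth1P => m; exact: smooth_uptoM. Qed.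

Lemma smooth1Z c f : smooth1 f -> smooth1 (fun x => c * f x).
Proof. by apply: smooth1M; exact: smooth1_cst. Qed.

Lemma smooth1N f : smooth1 f -> smooth1 (fun x => - f x).
Proof.
move=> sf; rewrite (_ : (fun x => - f x) = (fun x => -1 * f x)); first exact: smooth1Z.
by apply/funext => x; rewrite mulN1r.
Qed.

Lemma smooth1B f g : smooth1 f -> smooth1 g -> smooth1 (fun x => f x - g x).
Proof. by move=> sf /smooth1N; exact: smooth1D. Qed.

Lemma smooth1_id : smooth1 (fun x => x).
Proof.
by apply: (@smooth1_prim _ (fun=> 1)); exact: smooth1_cst.
Qed.

Lemma smooth1X m f : smooth1 f -> smooth1 (fun x => f x ^+ m).
Proof.
move=> sf; elim: m => [|m IHm].
  rewrite (_ : (fun x => _) = fun=> 1); first exact: smooth1_cst.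
  by apply/funext => x; rewrite expr0.
rewrite (_ : (fun x => _) = (fun x => f x * f x ^+ m)); first exact: smooth1M.
by apply/funext => x; rewrite exprS.
Qed.

Lemma is_derive_affine f (a b x d : R) : is_derive (a * x + b) (1 : R) f d ->
  is_derive x (1 : R) (fun y => f (a * y + b)) (a * d).
Proof.
move=> fd.
have h : is_derive x (1 : R) (fun y => a * y + b) a.
  have -> : (fun y => a * y + b) = (a \*: (id : R -> R)) + cst b by [].
  apply: is_derive_eq; rewrite addr0; exact: mulr1.
by have := @is_derive1_comp _ f (fun y => a * y + b) x _ _ fd h; rewrite mulrC.
Qed.

Lemma derive1_affine f (a b : R) : smooth1 f ->
  (fun x => f (a * x + b))^`() = (fun x => a * derive1 f (a * x + b)).
Proof.
move=> sf; apply: is_derive_derive1 => x.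
by apply: is_derive_affine; exact: smooth1_is_derive.
Qed.

Lemma smooth1_affine f a b : smooth1 f -> smooth1 (fun x => f (a * x + b)).
Proof.
move=> sf; apply/smooth1P => m; elim: m f sf => [//|m IHm] f sf; split.
  by move=> x; have [] := is_derive_affine (smooth1_is_derive sf (a * x + b)).
rewrite derive1_affine//; apply: smooth_uptoM; last exact/IHm/smooth1_derive.
exact: ((smooth1P _).1 (smooth1_cst a)).
Qed.

Lemma derive1nZ (c : R) f m : smooth1 f ->
  (fun x => c * f x)^`(m) = (fun x => c * derive1n m f x).
Proof.
move=> sf; have [df] := sf; elim: m => [//|m IHm]; rewrite !derive1nS IHm.
apply/funext => x; rewrite !derive1E.
by rewrite (deriveZ (f := f^`(m)))//; exact: sf.
Qed.

Lemma derive1nB f g m : smooth1 f -> smooth1 g ->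
  (fun x => f x - g x)^`(m) = (fun x => derive1n m f x - derive1n m g x).
Proof.
move=> [sf] [sg]; elim: m => [//|m IHm]; rewrite !derive1nS IHm.
apply/funext => x; rewrite !derive1E.
by rewrite (deriveB (f := f^`(m)) (g := g^`(m))).
Qed.

Lemma derive1n_affine f a b m : smooth1 f ->
  (fun x => f (a * x + b))^`(m) = (fun x => a ^+ m * derive1n m f (a * x + b)).
Proof.
move=> sf; elim: m => [|m IHm].
  by rewrite derive1n0; apply/funext => x; rewrite expr0 mul1r.
rewrite derive1nS IHm -derive1n1 derive1nZ; last first.
  exact/smooth1_affine/smooth1_derive1n.
rewrite derive1n1 derive1_affine; last exact/smooth1_derive1n.
by apply/funext => x; rewrite exprSr mulrA derive1nS.
Qed.

Lemma is_derive0_eq f x y : (forall z : R, z \in `]x, y[%R -> is_derive z (1 : R) f 0) ->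
  (forall z, derivable f z 1) -> x <= y -> f x = f y.
Proof.
move=> f0 df; rewrite le_eqVlt => /predU1P[->//|xy].
have cf : {within `[x, y], continuous f}.
  apply: continuous_subspaceT => z.
  exact/differentiable_continuous/derivable1_diffP.
have [z _] := @MVT _ f (fun=> 0) _ _ xy f0 cf.
by rewrite mul0r => /eqP; rewrite subr_eq0 => /eqP.
Qed.

Lemma prim_exists f : continuous f -> (forall x, x <= 0 -> f x = 0) ->
  exists F : R -> R, (forall x : R, is_derive x 1 F (f x)) /\
    forall x, x <= 0 -> F x = 0.
Proof.
move=> cf f0.
have F0 x : x <= 0 -> \int[lebesgue_measure]_(t in `[-1, x]) f t = 0 :> R.
  move=> x0; rewrite (@eq_Rintegral _ _ _ _ _ (cst 0)) => [|t].
    by rewrite /Rintegral/= integral0.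
  by rewrite inE/= in_itv/= => /andP[_ tx]; rewrite f0// (le_trans tx).
(* The base point -1 lies strictly to the left of every [x >= 0], where the fundamental theorem of
   calculus applies; for [x < 0] the primitive is locally zero. *)
exists (fun x => \int[lebesgue_measure]_(t in `[-1, x]) f t); split=> // x.
have [x0|x0] := ltP x 0.
  rewrite f0 ?ltW//.
  apply: (@near_eq_is_derive _ _ _ (cst 0)).
  by near=> y; rewrite F0//; apply: ltW; near: y; exact: lt_nbhsl.
have xx : x < x + 1 by rewrite ltrDl.
have := @continuous_FTC1_closed R f (-1) x (x + 1) xx.
move=> [|||dF <-].
- apply: continuous_compact_integrable; first exact: segment_compact.
  by move=> ?; exact: continuous_subspaceT.
- by rewrite (lt_le_trans _ x0)// ltrN10.
- exact: cf.
- by rewrite derive1E; exact/derivableP.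
Unshelve. all: by end_near. Qed.

End smooth1.

(** * A smooth step from 0 to 1 *)

Section smooth_step.
Context {R : realType}.

(** The powers of [x^-1] close the family under differentiation: the derivative of [flat k] is
    [- k%:R * flat k.+1 x + flat k.+2 x], so that all members are smooth by one induction. *)
Definition flat (k : nat) (x : R) : R :=
  if 0 < x then x^-1 ^+ k * expR (- x^-1) else 0.

Let g k (x : R) : R := x^-1 ^+ k * expR (- x^-1).

Let dg k (x : R) : 0 < x ->
  is_derive x (1 : R) (g k) (- k%:R * g k.+1 x + g k.+2 x).
Proof.
move=> x0.
have dV : is_derive x (1 : R) (fun y => y^-1) (- x^-1 ^+ 2).
  have := @is_deriveV R id x 1 1.
  by rewrite gt_eqF// => /(_ isT) /(_ (is_derive_id _ _)); rewrite scaler1 exprVn.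
elim: k => [|k IHk].
  rewrite (_ : g 0 = expR \o (fun y => - y^-1)); last first.
    by apply/funext => y; rewrite /g expr0 mul1r.
  have dN : is_derive x (1 : R) (fun y : R => - y^-1) (x^-1 ^+ 2).
    by have := @is_deriveN _ _ _ _ _ _ _ dV; rewrite opprK.
  have := @is_derive1_comp _ expR _ x _ _ (is_derive_expR _) dN.
  by rewrite /g oppr0 mul0r add0r mulrC.
rewrite (_ : g k.+1 = g k \* (fun y => y^-1)); last first.
  by apply/funext => y; rewrite /g/= exprS; ring.
have := @is_deriveM _ _ _ _ _ _ _ _ IHk dV.
congr is_derive; rewrite /g /GRing.scale/= -[in RHS]natr1 !exprS expr0; ring.
Qed.

(** The term of order [k.+1] of the exponential series at [x^-1] gives the upper bound. It is what
    makes the difference quotient of [flat k] at 0, equal to [g k.+1] on the right, tend to 0. *)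
Let g_le k (x : R) : 0 < x -> 0 <= g k x <= (k.+1)`!%:R * x.
Proof.
move=> x0; rewrite /g; apply/andP; split.
  by rewrite mulr_ge0 ?expR_ge0// exprn_ge0// invr_ge0 ltW.
have y0 : 0 <= x^-1 by rewrite invr_ge0 ltW.
have := expR_ge1Dxn k y0; rewrite expRN.
set E := expR _ => hE.
have E0 : 0 < E by exact: expR_gt0.
have F0 : 0 < (k.+1)`!%:R :> R by rewrite ltr0n fact_gt0.
have {}hE : x^-1 ^+ k.+1 <= (k.+1)`!%:R * E.
  rewrite mulrC -ler_pdivrMr//; apply: le_trans hE.
  by rewrite lerDr.
rewrite ler_pdivrMr// mulrAC -ler_pdivrMr//; apply: le_trans hE.
by rewrite exprSr.
Qed.

Let is_derive_flat k (x : R) :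
  is_derive x (1 : R) (flat k) (- k%:R * flat k.+1 x + flat k.+2 x).
Proof.
have [x0|x0|->] := ltgtP x 0.
- rewrite /flat ltNge ltW//= mulr0 addr0.
  apply: (@near_eq_is_derive _ _ _ (cst 0)).
  near=> y; rewrite /flat ltNge (_ : y <= 0)//.
  by apply: ltW; near: y; exact: lt_nbhsl.
- rewrite /flat x0.
  apply: (@near_eq_is_derive _ _ _ (g k)); last exact: dg.
  near=> y; rewrite /flat ifT//.
  by near: y; exact: lt_nbhsr.
- rewrite /flat ltxx mulr0 addr0.
  have h : h^-1 *: ((flat k \o shift 0) (h *: 1) - flat k 0) @[h --> (0 : R)^'] --> (0 : R).
    apply/cvgrPdist_le => e e0; near=> h.
    rewrite sub0r normrN /flat/= ltxx subr0 addr0.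
    rewrite [_ *: 1]mulr1; case: ifPn => [h0|]; last by rewrite scaler0 normr0 ltW.
    have -> : h^-1 *: (h^-1 ^+ k * expR (- h^-1)) = g k.+1 h.
      by rewrite /g exprS -mulrA.
    have /andP[a b] := g_le k.+1 h0; rewrite ger0_norm//.
    apply: (le_trans b); rewrite -ler_pdivlMl; last by rewrite ltr0n fact_gt0.
    rewrite -[h]gtr0_norm//; near: h; apply: dnbhs0_le.
    by rewrite mulr_gt0// invr_gt0 ltr0n fact_gt0.
  by apply: DeriveDef; [apply/cvg_ex; exists 0|exact/cvg_lim].
Unshelve. all: by end_near. Qed.

Lemma smooth1_flat k : smooth1 (flat k).
Proof.
apply/smooth1P => m; elim: m k => [//|m IHm] k; split.
  by move=> x; have [] := is_derive_flat k x.
rewrite (is_derive_derive1 (is_derive_flat k)).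
apply: smooth_uptoD => //; apply: smooth_uptoM => //.
exact: ((smooth1P _).1 (smooth1_cst _)).
Qed.

Lemma smooth_step_exists : exists b : R -> R,
  [/\ smooth1 b, forall x, x <= 0 -> b x = 0, forall x, 1 <= x -> b x = 1 &
      forall x, 0 <= b x <= 1].
Proof.
pose w (x : R) := flat 0 x * flat 0 (- 1 * x + 1).
have sw : smooth1 w.
  by apply: smooth1M; [|apply: smooth1_affine]; exact: smooth1_flat.
have w0 x : x <= 0 -> w x = 0 by move=> x0; rewrite /w /flat ltNge x0 mul0r.
have w1 x : 1 <= x -> w x = 0.
  by move=> x1; rewrite /w /flat (_ : (0 < - 1 * x + 1) = false) ?mulr0//; apply/negbTE; lra.
have wge0 x : 0 <= w x.
  by rewrite /w /flat; do 2 case: ifP => _; rewrite ?mulr0 ?mul0r// !expr0 !mul1r mulr_ge0// expR_ge0.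
have [F [dF F0]] := prim_exists (smooth1_continuous sw) w0.
have ddF x : derivable F x 1 by have [] := dF x.
have sF : smooth1 F by exact: smooth1_prim dF sw.
have F1 x : 1 <= x -> F x = F 1.
  move=> x1; apply/esym/is_derive0_eq => // z; rewrite in_itv/= => /andP[z1 _].
  by rewrite -(w1 z) ?ltW.
have Fle x y : x <= y -> F x <= F y.
  rewrite le_eqVlt => /predU1P[->//|xy].
  have cF : {within `[x, y], continuous F}.
    by apply: continuous_subspaceT; exact: smooth1_continuous.
  have [z _] := @MVT _ F w _ _ xy (fun t _ => dF t) cF.
  by rewrite -subr_ge0 => ->; rewrite mulr_ge0// subr_ge0 ltW.
(* The mean value theorem is used on [1/4, 3/4], well inside the interval where [w] is positive;
   monotonicity of [F] then carries the increment over to [F 1]. *)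
have Fpos : 0 < F 1.
  have cF : {within `[1/4, 3/4], continuous F}.
    by apply: continuous_subspaceT; exact: smooth1_continuous.
  have h : (1/4 : R) < 3/4 by lra.
  have [z zI e] := @MVT _ F w _ _ h (fun t _ => dF t) cF.
  move: zI; rewrite in_itv/= => /andP[z1 z2].
  have wz : 0 < w z.
    have z0 : 0 < z by lra.
    have z3 : 0 < - 1 * z + 1 by lra.
    rewrite /w /flat z0 z3.
    by rewrite !expr0 !mul1r mulr_gt0// expR_gt0.
  have : 0 < w z * (3/4 - 1/4) by apply: mulr_gt0 => //; lra.
  rewrite -e; have : F 0 <= F (1/4) by apply: Fle; lra.
  have : F (3/4) <= F 1 by apply: Fle; lra.
  by rewrite (F0 0)// => h1 h2 h3; lra.
exists (fun x => (F 1)^-1 * F x); split.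
- exact: smooth1Z.
- by move=> x x0; rewrite (F0 x)// mulr0.
- by move=> x x1; rewrite (F1 x)// mulVf// gt_eqF.
- move=> x; have Fx0 : 0 <= F x.
    have [x0|/ltW x0] := leP x 0; first by rewrite (F0 x).
    by rewrite -(F0 0)//; exact: Fle.
  have Fx1 : F x <= F 1.
    have [x0|/ltW x0] := leP x 1; first exact: Fle.
    by rewrite (F1 x).
  by rewrite mulr_ge0 ?invr_ge0 ?(ltW Fpos)//= ler_pdivrMl// mulr1.
Qed.

End smooth_step.

(** * Tensor products of functions of one variable *)

Section tensor.
Context {R : realType} {n : nat}.
Implicit Types f : 'I_n -> R -> R.

(** The test functions constructed below are such products or their partial derivatives, so that all
    calculus in n variables reduces to one variable. *)
Definition tensor f (x : 'rV[R]_n) : R := \prod_l f l (x 0 l).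

Lemma tensorD1 f i x :
  tensor f x = f i (x 0 i) * \prod_(l | l != i) f l (x 0 l).
Proof. by rewrite /tensor (bigD1 i). Qed.

Lemma tensor_continuous f : (forall l, smooth1 (f l)) -> continuous (tensor f).
Proof.
move=> sf; apply: continuous_big => [[p q]|l _ x].
  exact: mul_continuous.
apply: (@continuous_comp _ _ _ (fun y : 'rV[R]_n => y 0 l) (f l)).
  exact: coord_continuous.
exact: smooth1_continuous.
Qed.

Definition tensor_diff i f : 'I_n -> R -> R :=
  fun l => if l == i then (f l)^`()%classic else f l.

Lemma tensor_is_derive i f x : smooth1 (f i) ->
  is_derive x (delta_mx 0 i : 'rV[R]_n) (tensor f) (tensor (tensor_diff i f) x).
Proof.
move=> sf; set c := \prod_(l | l != i) f l (x 0 l).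
have E (h : R) : h^-1 *: (tensor f (h *: delta_mx 0 i + x) - tensor f x) =
    h^-1 *: ((f i \o shift (x 0 i)) (h *: 1) - f i (x 0 i)) * c.
  rewrite !(tensorD1 _ i) !mxE !eqxx/=.
  rewrite (eq_bigr (fun l => f l (x 0 l))) => [|l /negbTE li]; last first.
    by rewrite !mxE eqxx eq_sym [(i == l)]eq_sym li mulr0 add0r.
  by rewrite -/c -mulrBl -scalerAl.
have D := smooth1_is_derive sf (x 0 i).
have d1 : h^-1 *: ((f i \o shift (x 0 i)) (h *: 1) - f i (x 0 i)) @[h --> (0 : R)^'] -->
   (derive1 (f i) (x 0 i) : R).
  have [d <-] := D; exact: d.
have d2 : h^-1 *: ((tensor f \o shift x) (h *: delta_mx 0 i) - tensor f x) @[h --> (0 : R)^'] -->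
   (tensor (tensor_diff i f) x : R).
  rewrite [tensor (tensor_diff i f) x](tensorD1 _ i) {1}/tensor_diff eqxx.
  rewrite (eq_bigr (fun l => f l (x 0 l))) => [|l /negbTE li]; last first.
    by rewrite /tensor_diff li.
  under eq_fun do rewrite /= E.
  by apply: cvgM; [exact: d1|exact: cvg_cst].
by apply: DeriveDef; [apply/cvg_ex; exists (tensor (tensor_diff i f) x)|exact/cvg_lim].
Qed.

Lemma partial_tensor i f : smooth1 (f i) ->
  partial i (tensor f) = tensor (tensor_diff i f).
Proof.
by move=> sf; apply/funext => x; rewrite /partial; have [_ ->] := tensor_is_derive x sf.
Qed.

Lemma partials_tensor s f : (forall l, smooth1 (f l)) ->
  partials s (tensor f) = tensor (fun l => derive1n (count_mem l s) (f l)).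
Proof.
move=> sf; elim: s => [//|i s IHs].
rewrite /= -/(partials s (tensor f)) IHs partial_tensor; last exact: smooth1_derive1n.
congr tensor; apply/funext => l; rewrite /tensor_diff [i == l]eq_sym.
by case: eqP => [->|_]; rewrite ?add1n ?derive1nS.
Qed.

Lemma tensor_test_function f (a b : 'I_n -> R) : (forall l, smooth1 (f l)) ->
  (forall l x, f l x != 0 -> a l <= x <= b l) ->
  test_function (tensor f).
Proof.
move=> sf fab; split.
  move=> s; rewrite partials_tensor//; split.
    by apply: tensor_continuous => l; exact: smooth1_derive1n.
  by move=> i x; have [] := @tensor_is_derive i (fun l => derive1n (count_mem l s) (f l)) x
    (smooth1_derive1n (count_mem i s) (sf i)).
have cK : compact [set v : 'rV[R]_n | forall i, `[a i, b i]%classic (v ord0 i)].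
  by apply: (@rV_compact R n (fun i => `[a i, b i]%classic)) => i; exact: segment_compact.
apply: (subclosed_compact _ cK); first exact: closed_closure.
rewrite closureE => v; apply; split.
  by apply: compact_closed => //; exact: norm_hausdorff.
move=> x /= /prodf_neq0 h i; rewrite /= in_itv/=.
exact/fab/h.
Qed.

End tensor.

(** * Integration over boxes *)

Section ae_integral.
Context d {T : measurableType d} {R : realType}.
Variable mu : {measure set T -> \bar R}.
Implicit Types f g : T -> R.

Lemma aeS (P Q : T -> Prop) : (forall x, P x -> Q x) ->
  (\forall x \ae mu, P x) -> \forall x \ae mu, Q x.
Proof. by move=> PQ; apply: filterS. Qed.

Lemma aeS2 (P Q S : T -> Prop) : (forall x, P x -> Q x -> S x) ->
  (\forall x \ae mu, P x) -> (\forall x \ae mu, Q x) -> \forall x \ae mu, S x.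
Proof. by move=> PQS; apply: filterS2. Qed.

Lemma Rintegral_ae_eq f g : measurable_fun setT f -> measurable_fun setT g ->
  (\forall x \ae mu, f x = g x) -> \int[mu]_x f x = \int[mu]_x g x.
Proof.
move=> mf mg fg; congr fine; apply: ae_eq_integral => //.
- exact/measurable_EFinP.
- exact/measurable_EFinP.
- by apply: filterS fg => x /= -> _.
Qed.

Lemma Rintegral_ae_ge0 f : measurable_fun setT f ->
  (\forall x \ae mu, 0 <= f x) -> 0 <= \int[mu]_x f x.
Proof.
move=> mf f0; rewrite (@Rintegral_ae_eq _ (fun x => `|f x|))//.
- by apply: Rintegral_ge0.
- exact: measurableT_comp.
- by apply: filterS f0 => x /ger0_norm ->.
Qed.

Lemma le_ae_Rintegral f g : mu.-integrable setT (EFin \o f) ->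
  mu.-integrable setT (EFin \o g) ->
  (\forall x \ae mu, f x <= g x) -> \int[mu]_x f x <= \int[mu]_x g x.
Proof.
move=> intf intg fg; rewrite -subr_ge0 -RintegralB//; apply: Rintegral_ae_ge0.
  by apply: measurable_funB; apply/measurable_EFinP; [case/integrableP: intg|case/integrableP: intf].
by apply: filterS fg => x; rewrite subr_ge0.
Qed.

Lemma Rintegral_eq0_ae f : mu.-integrable setT (EFin \o f) ->
  (\forall x \ae mu, 0 <= f x) -> \int[mu]_x f x = 0 ->
  \forall x \ae mu, f x = 0.
Proof.
move=> intf f0 If; have mf := measurable_int _ intf.
have : (\int[mu]_x `|(f x)%:E| = 0)%E.
  transitivity (\int[mu]_x (f x)%:E)%E.
    apply: ae_eq_integral => //; first exact: measurableT_comp.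
    by apply: filterS f0 => x /= fx _; rewrite ger0_norm.
  by rewrite -[LHS]fineK ?[fine _]If//; exact: integrable_fin_num.
move/(ae_eq_integral_abs _ measurableT mf).
by apply: filterS => x /= /(_ I) [].
Qed.

Lemma integrable_ae_bounded f g (C : R) : measurable_fun setT f ->
  mu.-integrable setT (EFin \o g) -> (\forall x \ae mu, `|f x| <= C * `|g x|) ->
  mu.-integrable setT (EFin \o f).
Proof.
move=> mf ig fg.
have mg : measurable_fun setT g by apply/measurable_EFinP; case/integrableP: ig.
have ih : mu.-integrable setT (EFin \o (fun x => C * `|g x|)).
  rewrite (_ : EFin \o _ = (fun x => C%:E * (`|g x|)%:E)%E); last by [].
  by apply: integrableZl => //; exact: integrable_norm.
case/integrableP: (ih) => mh hoo; apply/integrableP; split; first exact/measurable_EFinP.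
apply: le_lt_trans hoo; apply: ae_ge0_le_integral => //.
- by apply: measurableT_comp => //; exact/measurable_EFinP.
- exact: measurableT_comp.
- by apply: filterS fg => x /= fx _; rewrite lee_fin (le_trans fx)// ler_norm.
Qed.

Lemma Cauchy_Schwarz f g (A B : R) : measurable_fun setT f -> measurable_fun setT g ->
  ('N[mu]_2%:E[EFin \o f] <= A%:E)%E ->
  (\int[mu]_x (g x ^+ 2)%:E <= (B ^+ 2)%:E)%E -> 0 <= B ->
  mu.-integrable setT (EFin \o (fun x => f x * g x)) /\
  `|\int[mu]_x (f x * g x)| <= A * B.
Proof.
move=> mf mg fA gB B0.
have gB' : ('N[mu]_2%:E[EFin \o g] <= B%:E)%E.
  rewrite unlock /=.
  under eq_integral do rewrite powR_mulrn// real_normK ?num_real//.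
  rewrite (_ : B%:E = ((B ^+ 2)%:E `^ 2^-1)%E); last first.
    by rewrite poweR_EFin -powR_mulrn// -powRrM divff// powRr1.
  apply: gt0_ler_poweR => //; rewrite ?invr_ge0// in_itv/= leey andbT.
    by apply: integral_ge0 => x _; rewrite lee_fin sqr_ge0.
  by rewrite lee_fin sqr_ge0.
have hp : (2^-1 + 2^-1 = 1 :> R) by lra.
have two0 : 0 < 2 :> R by [].
have := @hoelder _ _ _ mu f g 2 2 mf mg two0 two0 hp.
rewrite Lnorm1/= => h.
have {}h : (\int[mu]_x `|(f x * g x)%:E| <= (A * B)%:E)%E.
  by apply: (le_trans h); rewrite EFinM lee_pmul ?Lnorm_ge0.
have mfg : measurable_fun setT (EFin \o (fun x => f x * g x)).
  exact/measurable_EFinP/measurable_funM.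
have ifg : mu.-integrable setT (EFin \o (fun x => f x * g x)).
  by apply/integrableP; split => //; rewrite (le_lt_trans h)// ltry.
split => //; rewrite -lee_fin; apply: le_trans h.
by rewrite EFin_normr_Rintegral//; exact: le_abse_integral.
Qed.

End ae_integral.

Section Rintegral_dominated.
Context d {T : measurableType d} {R : realType}.
Variable mu : {measure set T -> \bar R}.

Lemma Rintegral_dominated_cvg (f_ : (T -> R)^nat) (f g : T -> R) :
  (forall n, measurable_fun setT (f_ n)) -> measurable_fun setT f ->
  (forall x, f_ n x @[n --> \oo] --> f x) ->
  mu.-integrable setT (EFin \o g) -> (forall n x, `|f_ n x| <= g x) ->
  (\int[mu]_x f_ n x) @[n --> \oo] --> \int[mu]_x f x.
Proof.
move=> mf_ mf cf ig fg.
have mf_' n : measurable_fun setT (EFin \o f_ n) by exact/measurable_EFinP.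
have mf' : measurable_fun setT (EFin \o f) by exact/measurable_EFinP.
have h1 : {ae mu, forall x, setT x -> (EFin \o f_ n) x @[n --> \oo] --> (EFin \o f) x}.
  by apply: aeW => x _; apply: cvg_EFin; [exact: nearW|exact: cf].
have h2 : {ae mu, forall x n, setT x -> (`|(EFin \o f_ n) x| <= (EFin \o g) x)%E}.
  by apply: aeW => x n _; rewrite /= lee_fin.
have [i0 _ h3] := dominated_convergence measurableT mf_' mf' h1 ig h2.
apply: fine_cvg; rewrite fineK; last exact: integrable_fin_num.
exact: h3.
Qed.

End Rintegral_dominated.

Section box.
Context {R : realType} {n : nat}.
Notation "'leb'" := (@lebesgue_rV R n).
Implicit Types (a b : 'I_n -> R) (f g : 'rV[R]_n -> R).

(** The intervals are open on the left and closed on the right because a step [H] with [H 0 = 0],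
    placed at [s] and at [t] and made ever steeper, has a difference that converges at every point
    to the indicator of exactly this interval. *)
Definition box a b : set 'rV[R]_n := [set x | forall l, `]a l, b l]%classic (x 0 l)].

Lemma measurable_rV_box (A : 'I_n -> set R) : (forall i, measurable (A i)) ->
  measurable [set x : 'rV[R]_n | forall i, A i (x 0 i)].
Proof.
move=> mA; rewrite (_ : mkset _ = \big[setI/setT]_(i < n)
    ((fun x : 'rV[R]_n => x 0 i) @^-1` A i)).
  apply: bigsetI_measurable => i _; rewrite -[X in measurable X]setTI.
  exact: measurable_coord.
by rewrite -bigcap_seq; apply/seteqP; split=> x /= Ax i; [move=> _|];
  apply: Ax => //=; exact: mem_index_enum.
Qed.

Lemma measurable_box a b : measurable (box a b).
Proof.
by apply: (@measurable_rV_box (fun l => `]a l, b l]%classic)) => l; exact: measurable_itv.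
Qed.

Lemma box_measure a b : (forall l, a l <= b l) ->
  leb (box a b) = (\prod_l (b l - a l))%:E.
Proof.
move=> ab; rewrite (lebesgue_rV_box (A := fun l => `]a l, b l]%classic)); last first.
  by move=> l; exact: measurable_itv.
rewrite -prodEFin; apply: eq_bigr => l _; rewrite lebesgue_measure_itv/= lte_fin.
by rewrite lt_neqAle ab andbT; case: eqP => [->|_]; rewrite ?subrr// EFinB.
Qed.

Lemma box_measure_lty a b : (leb (box a b) < +oo)%E.
Proof.
rewrite (lebesgue_rV_box (A := fun l => `]a l, b l]%classic)); last by move=> l; exact: measurable_itv.
rewrite (eq_bigr (fun l => (Num.max (b l - a l) 0)%:E)); last first.
  move=> l _; rewrite lebesgue_measure_itv/= lte_fin.
  have [ab|ab] := ltP (a l) (b l); first by rewrite max_l ?EFinB// subr_ge0 ltW.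
  by rewrite max_r// subr_le0.
by rewrite prodEFin ltry.
Qed.

Lemma integrable_indic_box a b : leb.-integrable setT (EFin \o \1_(box a b)).
Proof.
have mb := measurable_box a b.
apply/integrableP; split; first by apply/measurable_EFinP; exact: measurable_indic.
under eq_integral do rewrite /= ger0_norm ?indicE//.
by rewrite integral_indic// setIT box_measure_lty.
Qed.

Lemma Rintegral_indic_box a b : (forall l, a l <= b l) ->
  \int[leb]_x \1_(box a b) x = \prod_l (b l - a l).
Proof.
move=> ab; rewrite /Rintegral integral_indic//; last exact: measurable_box.
by rewrite setIT [X in fine X](box_measure ab).
Qed.

Lemma measurable_tensor (f : 'I_n -> R -> R) :
  (forall l, measurable_fun setT (f l)) -> measurable_fun setT (tensor f).
Proof.
move=> mf; apply: measurable_prod => l _.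
by apply: (measurableT_comp (mf l)); exact: measurable_coord.
Qed.

Lemma loc_integrable_box f a b : loc_integrable f ->
  leb.-integrable (box a b) (EFin \o f).
Proof.
move=> [mf intf].
have cK : compact [set v : 'rV[R]_n | forall i, `[a i, b i]%classic (v ord0 i)].
  apply: (@rV_compact R n (fun i => `[a i, b i]%classic)) => i.
  exact: segment_compact.
apply: integrableS (intf _ cK).
- by apply: (@measurable_rV_box (fun l => `[a l, b l]%classic)) => l; exact: measurable_itv.
- exact: measurable_box.
- by move=> x xab l; have := xab l; rewrite /= !in_itv/= => /andP[/ltW -> ->].
Qed.

Lemma integrable_boxM f g a b (C : R) : loc_integrable f -> measurable_fun setT g ->
  (forall x, `|g x| <= C) -> (forall x, ~ box a b x -> g x = 0) ->
  leb.-integrable setT (EFin \o (fun x => f x * g x)).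
Proof.
move=> lf mg gC g0.
have mf : measurable_fun setT f by case: lf.
have ib : leb.-integrable setT (EFin \o (f \_ (box a b))).
  have := loc_integrable_box a b lf.
  by rewrite integrable_mkcond ?restrict_EFin//; exact: measurable_box.
apply: (@integrable_ae_bounded _ _ _ _ _ _ C _ ib).
  exact: measurable_funM.
apply: aeW => x /=; rewrite patchE; case: ifPn => [_|/negP xb].
  by rewrite normrM mulrC ler_wpM2r.
rewrite g0 ?mulr0 ?normr0 ?mulr0//.
by move=> h; apply: xb; rewrite inE.
Qed.

Lemma Cauchy_Schwarz_box f g a b (A S : R) : (forall l, a l <= b l) ->
  measurable_fun setT f -> measurable_fun setT g ->
  ('N[leb]_2%:E[EFin \o f] <= A%:E)%E ->
  (forall x, `|g x| <= S) -> (forall x, ~ box a b x -> g x = 0) ->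
  `|\int[leb]_x (f x * g x)| <= A * (S * Num.sqrt (\prod_l (b l - a l))).
Proof.
move=> ab mf mg fA gS g0.
have S0 : 0 <= S by exact: le_trans (normr_ge0 _) (gS 0).
have V0 : 0 <= \prod_l (b l - a l) by apply: prodr_ge0 => l _; rewrite subr_ge0.
have [] := @Cauchy_Schwarz _ _ _ leb f g A (S * Num.sqrt (\prod_l (b l - a l))) mf mg fA; last by [].
- have -> : ((S * Num.sqrt (\prod_l (b l - a l))) ^+ 2)%:E =
     (\int[leb]_x ((S ^+ 2)%:E * (\1_(box a b) x)%:E))%E.
    rewrite integralZl//; last first.
      exact: integrable_indic_box.
    rewrite integral_indic//; last exact: measurable_box.
    by rewrite setIT [X in (_ * X)%E](box_measure ab) exprMn sqr_sqrtr.
  apply: ge0_le_integral => //.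
  + by move=> x _; rewrite lee_fin sqr_ge0.
  + exact/measurable_EFinP/measurable_funX.
  + apply/measurable_EFinP/measurable_funM => //.
    exact: measurable_indic (measurable_box _ _).
  + move=> x _; rewrite lee_fin indicE; case: (boolP (x \in _)) => [_|/negP xb].
      by rewrite mulr1 -real_normK ?num_real// lerXn2r// ?nnegrE.
    rewrite g0 ?expr0n ?mulr0//; last by move=> h; apply: xb; rewrite inE.
- by rewrite mulr_ge0// sqrtr_ge0.
Qed.

End box.

(** * Functions whose integrals over all boxes are nonnegative *)

Section nonneg_on_boxes.
Context {R : realType}.

Lemma Rintegral_mkindic d (T : measurableType d) (mu : {measure set T -> \bar R})
    (D : set T) (f : T -> R) :
  \int[mu]_(x in D) f x = \int[mu]_x (f x * \1_D x).
Proof.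
rewrite Rintegral_mkcond; apply: eq_Rintegral => x _.
by rewrite patchE indicE; case: ifPn; rewrite ?mulr1 ?mulr0.
Qed.

(** The primitive of [g] from minus infinity is nondecreasing, and by Lebesgue differentiation its
    derivative is [g] almost everywhere. *)
Lemma ae_ge0_of_itv (g : R -> R) :
  (@lebesgue_measure R).-integrable setT (EFin \o g) ->
  (forall a b, a <= b -> 0 <= \int[lebesgue_measure]_(x in `]a, b]) g x) ->
  \forall x \ae (@lebesgue_measure R), 0 <= g x.
Proof.
move=> ig g0.
have igS A : measurable A -> (@lebesgue_measure R).-integrable A (EFin \o g).
  by move=> mA; apply: integrableS ig.
have lg : locally_integrable setT g by apply: open_integrable_locally => //; exact: openT.
have ig' y : (@lebesgue_measure R).-integrable `]-oo, y] (EFin \o g) by exact: igS.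
have := FTC1Ny ig' lg; set F := fun x => _.
have ndF x y : x <= y -> F x <= F y.
  move=> xy; rewrite -subr_ge0 /F.
  by rewrite Rintegral_itvB ?bnd_simp//; exact: g0.
apply: aeS.
move=> x /= [dF <-]; rewrite derive1E.
apply: limr_ge; first exact: dF.
near=> h; have h0 : h != 0 by near: h; exact: nbhs_dnbhs_neq.
rewrite /= [_ *: 1]mulr1 [_ *: _]/(h^-1 * _).
have [hp|hn|h00] := ltgtP h 0; last by rewrite h00 eqxx in h0.
  by apply: mulr_le0; [rewrite invr_le0 ltW|rewrite subr_le0; apply: ndF; lra].
by apply: mulr_ge0; [rewrite invr_ge0 ltW|rewrite subr_ge0; apply: ndF; lra].
Unshelve. all: by end_near. Qed.

(** Reduces real boxes to countably many, so that null sets depending on the box can be united. The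
    rational corners approach the real ones from above: then the indicators of these left-open boxes
    are eventually constant at each point, and dominated convergence applies. *)
Lemma Rintegral_box_ge0_rat n (f : 'rV[R]_n -> R) :
  (lebesgue_rV n).-integrable setT (EFin \o f) ->
  (forall a b : 'I_n -> rat,
     0 <= \int[lebesgue_rV n]_(x in box (ratr \o a) (ratr \o b)) f x) ->
  forall a b : 'I_n -> R, 0 <= \int[lebesgue_rV n]_(x in box a b) f x.
Proof.
move=> intf f0 a b.
have mf : measurable_fun setT f by apply/measurable_EFinP; case/integrableP: intf.
have approx (c : 'I_n -> R) : exists q : nat -> 'I_n -> rat,
    forall k l, c l < ratr (q k l) < c l + k.+1%:R^-1.
  have h k l : {r : rat | c l < ratr r < c l + k.+1%:R^-1}.
    apply: cid; have [|r] := @rat_in_itvoo R (c l) (c l + k.+1%:R^-1).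
      by rewrite ltrDl invr_gt0.
    by rewrite in_itv/= => ?; exists r.
  by exists (fun k l => sval (h k l)) => k l; exact: svalP (h k l).
have [p pP] := approx a; have [q qP] := approx b.
rewrite Rintegral_mkindic.
have small (e : R) : 0 < e -> \forall k \near \oo, k.+1%:R^-1 < e.
  by move=> e0; exact: (near_infty_natSinv_lt (PosNum e0)).
have cvg : (\int[lebesgue_rV n]_x
     (f x * \1_(box (ratr \o p k) (ratr \o q k)) x)) @[k --> \oo] -->
   \int[lebesgue_rV n]_x (f x * \1_(box a b) x).
  apply: (@Rintegral_dominated_cvg _ _ _ _ _ _ (fun x => `|f x|)).
  - move=> k; apply: measurable_funM => //; apply: measurable_indic.
    exact: measurable_box.
  - apply: measurable_funM => //; apply: measurable_indic; exact: measurable_box.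
  - move=> x; apply: cvgM; first exact: cvg_cst.
    apply: cvg_near_cst; apply: filterS (_ : \forall k \near \oo, forall l,
       (a l < x 0 l -> ratr (p k l) < x 0 l) /\ (b l < x 0 l -> ratr (q k l) < x 0 l)).
      move=> k hk; rewrite !indicE; congr (nat_of_bool _)%:R; apply/idP/idP; rewrite !inE.
        move=> h l; have := h l; have [h1 h2] := hk l.
        rewrite /= !in_itv/= => /andP[h3 h4].
        have /andP[/(le_lt_trans _) pl _] := pP k l.
        have /andP[ql _] := qP k l.
        apply/andP; split; first by apply: lt_trans h3; have /andP[] := pP k l.
        by rewrite leNgt; apply/negP => /h2; rewrite ltNge h4.
      move=> h l; have := h l; have [h1 h2] := hk l.
      rewrite /= !in_itv/= => /andP[h3 h4].
      by rewrite h1//= (le_trans h4)// ltW//; have /andP[] := qP k l.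
    apply: filter_forall => l.
    have ha : \forall k \near \oo, a l < x 0 l -> ratr (p k l) < x 0 l.
      have [h|h] := ltP (a l) (x 0 l); last by apply: nearW.
      have := small (x 0 l - a l); rewrite subr_gt0 => /(_ h).
      apply: filterS => k hk _; have /andP[_ h'] := pP k l.
      by apply: (lt_trans h'); rewrite -ltrBrDl.
    have hb : \forall k \near \oo, b l < x 0 l -> ratr (q k l) < x 0 l.
      have [h|h] := ltP (b l) (x 0 l); last by apply: nearW.
      have := small (x 0 l - b l); rewrite subr_gt0 => /(_ h).
      apply: filterS => k hk _; have /andP[_ h'] := qP k l.
      by apply: (lt_trans h'); rewrite -ltrBrDl.
    by near=> k; split; near: k.
  - exact: integrable_norm.
  - move=> k x; rewrite normrM indicE; case: (_ \in _); rewrite ?normr1 ?mulr1//.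
    by rewrite normr0 mulr0.
apply: (cvgr_to_ge cvg); apply: nearW => k.
by rewrite -Rintegral_mkindic.
Unshelve. all: by end_near. Qed.

Let measurable_rV_cons' n : @measurable_fun _ _ (measurableTypeR R * 'rV[R]_n)%type
  'rV[R]_n.+1 setT (@rV_cons R n) := @measurable_rV_cons R n.

Lemma integrable_rV_cons n (f : 'rV[R]_n.+1 -> R) :
  (lebesgue_rV n.+1).-integrable setT (EFin \o f) ->
  (@lebesgue_measure R \x lebesgue_rV n)%E.-integrable setT (EFin \o (f \o @rV_cons R n)).
Proof.
move=> /integrableP[mf foo]; apply/integrableP; split.
  exact: measurableT_comp mf (@measurable_rV_cons R n).
apply: le_lt_trans foo.
rewrite /= /lebesgue_succ.
rewrite (ge0_integral_pushforward (@measurable_rV_cons' n))//.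
by apply/measurable_EFinP/measurableT_comp => //; exact/measurable_EFinP.
Qed.

Lemma Rintegral_rV_cons n (f : 'rV[R]_n.+1 -> R) :
  (lebesgue_rV n.+1).-integrable setT (EFin \o f) ->
  \int[lebesgue_rV n.+1]_x f x =
  \int[lebesgue_measure]_x (\int[lebesgue_rV n]_y f (rV_cons (x, y))).
Proof.
move=> intf; have [mf _] := integrableP _ _ _ intf.
have i2 := integrable_rV_cons intf.
rewrite /Rintegral /= /lebesgue_succ (integral_pushforward (@measurable_rV_cons' n))//.
rewrite preimage_setT -(integral12_prod_meas1 i2).
congr fine; apply: ae_eq_integral => //.
- exact: (measurable_fubini_F i2).
- apply/measurable_EFinP.
  exact: (measurableT_comp (fine_measurable measurableT) (measurable_fubini_F i2)).
- have := ae_integrable1 i2.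
  apply: aeS.
  move=> x ix _; rewrite fineK//; exact: (integrable_fin_num _ ix).
Qed.

(** Fubini and induction on the dimension. For a fixed box in the last coordinates the slice
    integral is nonnegative for almost every first coordinate, by the case of one variable. The
    exceptional null sets are united over rational boxes, so the induction hypothesis holds on
    almost every slice; the set where [f] is negative then has null slices and is null. *)
Lemma ae_ge0_of_box n (f : 'rV[R]_n -> R) :
  (lebesgue_rV n).-integrable setT (EFin \o f) ->
  (forall a b : 'I_n -> R, 0 <= \int[lebesgue_rV n]_(x in box a b) f x) ->
  \forall x \ae lebesgue_rV n, 0 <= f x.
Proof.
elim: n f => [|n IHn] f intf f0.
  have mf : measurable_fun setT (EFin \o f) by case/integrableP: intf.
  apply: aeW => x; have -> : x = 0 by apply/rowP => -[].
  have := f0 (fun=> 0) (fun=> 1).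
  have bT : box (fun=> 0) (fun=> 1) = [set: 'rV[R]_0].
    by apply/seteqP; split => // y _ [].
  by rewrite bT /Rintegral /= integral_dirac// diracE in_setT mul1e.
have i2 := integrable_rV_cons intf.
have [mf _] := integrableP _ _ _ intf.
have mf2 : measurable_fun setT (f \o @rV_cons R n).
  by apply/measurable_EFinP; case/integrableP: i2.
have slice (a b : 'I_n -> R) : \forall x \ae (@lebesgue_measure R),
    0 <= \int[lebesgue_rV n]_(y in box a b) f (rV_cons (x, y)).
  pose g v := f v * \1_(box a b) (rV_uncons v).2.
  have mbox : measurable_fun setT (\1_(box a b) : _ -> R).
    by apply: measurable_indic; exact: measurable_box.
  have ig : (lebesgue_rV n.+1).-integrable setT (EFin \o g).
    apply: (@integrable_ae_bounded _ _ _ _ _ f 1) => //.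
      apply: measurable_funM; first exact/measurable_EFinP.
      apply: measurableT_comp => //.
      exact: measurableT_comp measurable_snd (@measurable_rV_uncons R n).
    apply: aeW => v; rewrite /g normrM mul1r indicE.
    by case: (_ \in _); rewrite ?normr1 ?mulr1// normr0 mulr0.
  have ig2 := integrable_fubini_F (integrable_rV_cons ig).
  have E x : \int[lebesgue_rV n]_(y in box a b) f (rV_cons (x, y)) =
      fine (fubini_F (lebesgue_rV n) (EFin \o (g \o @rV_cons R n)) x).
    rewrite Rintegral_mkindic; congr fine; apply: eq_integral => y _.
    by rewrite [RHS]/= /g rV_consK.
  suff : \forall x \ae (@lebesgue_measure R),
      0 <= fine (fubini_F (lebesgue_rV n) (EFin \o (g \o @rV_cons R n)) x).
    by apply: aeS => x; rewrite E.
  apply: ae_ge0_of_itv.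
    apply: le_integrable ig2 => //.
      apply/measurable_EFinP; apply: (measurableT_comp (fine_measurable measurableT)).
      exact: (measurable_fubini_F (integrable_rV_cons ig)).
    move=> x _; have fle (z : \bar R) : (`|(fine z)%:E| <= `|z|)%E.
      by case: z => [r| |] //=; rewrite normr0 leey.
    exact: fle.
  move=> al be albe; under eq_Rintegral do rewrite -E.
  pose a' : 'I_n.+1 -> R := fun l => if unlift ord0 l is Some j then a j else al.
  pose b' : 'I_n.+1 -> R := fun l => if unlift ord0 l is Some j then b j else be.
  have := f0 a' b'.
  rewrite Rintegral_mkindic Rintegral_rV_cons; last first.
    apply: (@integrable_ae_bounded _ _ _ _ _ f 1) => //.
      apply: measurable_funM; first exact/measurable_EFinP.
      by apply: measurable_indic; exact: measurable_box.
    apply: aeW => v; rewrite normrM mul1r indicE.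
    by case: (_ \in _); rewrite ?normr1 ?mulr1// normr0 mulr0.
  rewrite [X in _ -> 0 <= X]Rintegral_mkindic; congr (0 <= _).
  congr fine; apply: eq_integral => x _; congr EFin.
  rewrite [X in _ = X * _]Rintegral_mkindic.
  have E' y : (\1_(box a' b') (rV_cons (x, y)) : R) = \1_(box a b) y * \1_(`]al, be]%classic) x.
    rewrite !indicE -natrM mulnb; congr (nat_of_bool _)%:R.
    apply/idP/andP; rewrite !inE.
      move=> h; split; last by have := h ord0; rewrite /a' /b' /= unlift_none mxE unlift_none.
      by move=> l; have := h (lift ord0 l); rewrite /a' /b' /= liftK mxE liftK.
    move=> [h1 h2] l; rewrite /a' /b' /= mxE.
    by case: unliftP => [j|] _ //; exact: h1.
  under eq_Rintegral do rewrite E'.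
  rewrite !indicE; case: (_ \in _) => /=.
    by rewrite mulr1; apply: eq_Rintegral => y _; rewrite mulr1.
  rewrite mulr0 -[RHS](Rintegral_set0 (lebesgue_rV n) (fun=> 0)) [RHS]Rintegral_mkindic.
  by apply: eq_Rintegral => y _; rewrite !mulr0 mul0r.
have slices : \forall x \ae (@lebesgue_measure R), forall a b : 'I_n -> rat,
    0 <= \int[lebesgue_rV n]_(y in box (ratr \o a) (ratr \o b)) f (rV_cons (x, y)).
  pose P (k : nat) x := if (unpickle k : option ({ffun 'I_n -> rat} * {ffun 'I_n -> rat})) is Some p then
    0 <= \int[lebesgue_rV n]_(y in box (ratr \o p.1) (ratr \o p.2)) f (rV_cons (x, y)) else true.
  have hP k : \forall x \ae (@lebesgue_measure R), P k x.
    rewrite /P; case: unpickle => [p|]; last exact: aeW.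
    exact: slice.
  have := ae_foralln hP.
  apply: aeS.
  move=> x hx a b; have := hx (pickle (finfun a, finfun b)).
  rewrite /P pickleK /=; congr (0 <= _); congr Rintegral.
  by congr box; apply/funext => l /=; rewrite ffunE.
have fibers : \forall x \ae (@lebesgue_measure R),
    \forall y \ae lebesgue_rV n, 0 <= f (rV_cons (x, y)).
  have := ae_integrable1 i2; move: slices.
  apply: aeS2.
  move=> x hx ix; apply: IHn => //; exact: Rintegral_box_ge0_rat.
have mN : measurable [set x | f x < 0].
  have := (measurable_EFinP _ _).1 mf measurableT _ (measurable_itv `]-oo, (0:R)[%R).
  by rewrite setTI; congr measurable; apply/seteqP; split => x; rewrite /= in_itv/=.
exists [set x | f x < 0]; split => //; last by move=> x /= /negP; rewrite -ltNge.
have mN2 : measurable (@rV_cons R n @^-1` [set x | f x < 0]).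
  by rewrite -[X in measurable X]setTI; exact: measurable_rV_cons'.
rewrite /= /lebesgue_succ /pushforward /product_measure1.
rewrite (@ae_eq_integral _ _ _ _ _ (cst 0%E)) ?integral0//.
  exact: measurable_fun_xsection.
move: fibers; apply: aeS.
move=> x hx _ /=; apply/negligibleP; first exact: measurable_xsection.
apply: negligibleS hx => y /=.
by rewrite /xsection /= inE /= => h; apply/negP; rewrite -ltNge.
Qed.

End nonneg_on_boxes.

(** * Smooth approximations of boxes and the Sobolev embedding *)

Section ramp.
Context {R : realType} {n : nat}.
Notation "'leb'" := (@lebesgue_rV R n).
Implicit Types (a b c d : 'I_n -> R) (f : 'rV[R]_n -> R).

(** Smoothed indicator of []s, t]] with transitions of width [4^-1 ^+ j]. With base 4 the square
    root of this width, which enters through L^2 norms, is the plain power [2^-1 ^+ j]. *)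
Definition ramp (H : R -> R) (j : nat) (s t y : R) : R :=
  H (4 ^+ j * y + - (4 ^+ j * s)) - H (4 ^+ j * y + - (4 ^+ j * t)).

Definition ramp_box H j a b : 'rV[R]_n -> R := tensor (fun l => ramp H j (a l) (b l)).

Variables (H : R -> R) (C : R).
Hypotheses (mH : measurable_fun setT H) (HC : forall z, `|H z| <= C).
Hypotheses (H0 : forall z, z <= 0 -> H z = 0) (H1 : forall z, 1 <= z -> H z = 1).

Lemma ramp_out j s t y : s <= t -> y <= s \/ t + 1 <= y -> ramp H j s t y = 0.
Proof.
have p4 : 0 < 4 ^+ j :> R by rewrite exprn_gt0.
have p1 : 1 <= 4 ^+ j :> R by rewrite exprn_ege1// ler1n.
rewrite /ramp => st [ys|ty].
  by rewrite !H0 ?subrr//; nra.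
by rewrite !H1 ?subrr//; nra.
Qed.

Lemma ramp_le j s t y : `|ramp H j s t y| <= C + C.
Proof. by rewrite (le_trans (ler_normB _ _))// lerD. Qed.

Lemma measurable_ramp j s t : measurable_fun setT (ramp H j s t).
Proof.
have mA u : measurable_fun setT (fun y : R => 4 ^+ j * y + - (4 ^+ j * u)).
  by apply: measurable_funD => //; apply: measurable_funM.
by apply: measurable_funB; apply: (measurableT_comp mH (mA _)).
Qed.

Lemma ramp_cvg s t y : s <= t ->
  ramp H j s t y @[j --> \oo] --> (\1_(`]s, t]%classic) y : R).
Proof.
move=> st; have big (e : R) : 0 < e -> \forall j \near \oo, 1 <= 4 ^+ j * e.
  move=> e0; have [N Ne] : exists N, 1 <= N%:R * e.
    exists (Num.bound e^-1).
    by rewrite -ler_pdivrMr// div1r ltW// archi_boundP// invr_ge0 ltW.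
  exists N => // j /= Nj; apply: (le_trans Ne); rewrite ler_pM2r//.
  rewrite -natrX ler_nat; apply: (leq_trans Nj).
  by apply: ltnW; exact: ltn_expl.
have zero u j : y <= u -> H (4 ^+ j * y + - (4 ^+ j * u)) = 0.
  by move=> yu; rewrite H0// -mulrBr mulr_ge0_le0// subr_le0.
have one u : u < y -> \forall j \near \oo, H (4 ^+ j * y + - (4 ^+ j * u)) = 1.
  move=> uy; have := big (y - u); rewrite subr_gt0 => /(_ uy).
  by apply: filterS => j; rewrite mulrBr => h; exact: H1.
rewrite /ramp; apply: cvg_near_cst.
have [ys|sy] := leP y s.
  apply: nearW => j; rewrite !zero ?(le_trans ys)// subrr.
  by rewrite indicE memNset//= in_itv/= ltNge ys.
have [yt|ty] := leP y t.
  apply: filterS (one _ sy) => j ->; rewrite zero// subr0.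
  by rewrite indicE mem_set//= in_itv/= sy.
apply: filterS2 (one _ sy) (one _ ty) => j -> ->; rewrite subrr.
by rewrite indicE memNset//= in_itv/= [y <= t]leNgt ty andbF.
Qed.

Lemma ramp_box_le j a b x : `|ramp_box H j a b x| <= (C + C) ^+ n.
Proof.
rewrite /ramp_box /tensor normr_prod (_ : _ ^+ n = \prod_(l < n) (C + C)).
  by apply: ler_prod => l _; rewrite normr_ge0 ramp_le.
by rewrite prodr_const card_ord.
Qed.

Lemma ramp_box_out j a b x : (forall l, a l <= b l) ->
  ~ box a (fun l => b l + 1) x -> ramp_box H j a b x = 0.
Proof.
move=> ab /existsNP[l]; rewrite /= in_itv/= => /negP; rewrite negb_and -leNgt -ltNge => h.
rewrite /ramp_box (tensorD1 _ l) ramp_out ?mul0r//.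
by case/orP: h => h; [left|right; exact: ltW].
Qed.

Lemma measurable_ramp_box j a b : measurable_fun setT (ramp_box H j a b).
Proof. by apply: measurable_tensor => l; exact: measurable_ramp. Qed.

Lemma ramp_box_cvg f a b : loc_integrable f -> (forall l, a l <= b l) ->
  (\int[leb]_x (f x * ramp_box H j a b x)) @[j --> \oo] -->
  \int[leb]_(x in box a b) f x.
Proof.
move=> lf ab; have mf : measurable_fun setT f by case: lf.
have mb := measurable_box a b.
have mb1 : measurable (box a (fun l => b l + 1)) by exact: measurable_box.
rewrite Rintegral_mkindic.
apply: (@Rintegral_dominated_cvg _ _ _ _ _ _
    (fun x => `|f x| * ((C + C) ^+ n * \1_(box a (fun l => b l + 1)) x))).
- by move=> j; apply: measurable_funM => //; exact: measurable_ramp_box.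
- by apply: measurable_funM => //; exact: measurable_indic.
- move=> x; apply: cvgM; first exact: cvg_cst.
  have -> : \1_(box a b) x = \prod_l \1_(`]a l, b l]%classic) (x 0 l) :> R.
    rewrite indicE; have [|/negP h] := boolP (x \in box a b).
      rewrite inE => h; rewrite big1// => l _; rewrite indicE mem_set//; exact: h.
    have /existsNP[l hl] : ~ box a b x by move=> h'; apply: h; rewrite inE.
    by rewrite (bigD1 l)//= indicE memNset// mul0r.
  rewrite /ramp_box /tensor.
  apply: cvg_big => [[p q]|l _]; first exact: mul_continuous.
  exact: ramp_cvg.
- apply: (@integrable_boxM _ _ (fun x => `|f x|) _ a (fun l => b l + 1) ((C + C) ^+ n)).
  + case: lf => _ If; split; first exact: measurableT_comp.
    by move=> K cK; exact/integrable_norm/If.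
  + by apply: measurable_funM => //; exact: measurable_indic.
  + move=> x; have p0 : 0 <= (C + C) ^+ n.
      by rewrite exprn_ge0// addr_ge0// (le_trans (normr_ge0 _) (HC 0)).
    rewrite indicE normrM ger0_norm//.
    by case: (_ \in _); rewrite ?normr1 ?mulr1 ?normr0 ?mulr0.
  + by move=> x xb; rewrite indicE memNset// mulr0.
- move=> j x; rewrite normrM ler_wpM2l//.
  have [xb|/negP xb] := boolP (x \in box a (fun l => b l + 1)).
    by rewrite indicE xb mulr1 ramp_box_le.
  have xb' : ~ box a (fun l => b l + 1) x by move=> h; apply: xb; rewrite inE.
  by rewrite ramp_box_out// normr0 indicE memNset// mulr0.
Qed.

(** Weak formulations see smooth functions only, not indicators of boxes. In the limit of steep
    ramps the hypothesis bounds the average of [f] over each subbox of [box c d] by [M], which is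
    the nonnegativity of the integrals of [M - f] there. *)
Lemma ae_le_of_ramp_box f c d (M : R) : loc_integrable f ->
  (forall a b, (forall l, [&& c l <= a l, a l <= b l & b l <= d l]) ->
     \forall j \near \oo,
       \int[leb]_x (f x * ramp_box H j a b x) <= M * \prod_l (b l - a l)) ->
  \forall x \ae leb, box c d x -> f x <= M.
Proof.
move=> lf hf; have mf : measurable_fun setT f by case: lf.
have hbox a b : (forall l, [&& c l <= a l, a l <= b l & b l <= d l]) ->
    \int[leb]_(x in box a b) f x <= M * \prod_l (b l - a l).
  move=> h; have ab l : a l <= b l by have /and3P[] := h l.
  exact: cvgr_to_le (ramp_box_cvg lf ab) (hf _ _ h).
have mcd := measurable_box c d.
have i1 := integrable_indic_box c d.
have i2 := @integrable_boxM _ _ f (\1_(box c d)) c d 1 lf.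
have {}i2 : leb.-integrable setT (EFin \o (fun x => f x * \1_(box c d) x)).
  apply: i2 => [|x|x xb]; first exact: measurable_indic.
    by rewrite indicE; case: (_ \in _); rewrite ?normr1 ?normr0.
  by rewrite indicE memNset.
pose g x := M * \1_(box c d) x - f x * \1_(box c d) x.
have ig : leb.-integrable setT (EFin \o g).
  have := integrableB measurableT (integrableZl measurableT M i1) i2.
  by [].
suff : \forall x \ae leb, 0 <= g x.
  apply: aeS => x; rewrite /g indicE => + xcd.
  by rewrite mem_set// !mulr1 subr_ge0.
apply: ae_ge0_of_box => // a b.
(* Any test box is intersected with [box c d], where the hypothesis is available; an empty
   intersection contributes 0. *)
pose a' l := Num.max (a l) (c l); pose b' l := Num.min (b l) (d l).
have E x : g x * \1_(box a b) x = M * \1_(box a' b') x - f x * \1_(box a' b') x.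
  rewrite /g -!mulrBl -mulrA; congr (_ * _).
  rewrite -[LHS]/((\1_(box c d) \* \1_(box a b)) x) -indicI; congr (\1_ _ x).
  apply/seteqP; split=> y.
    move=> [h1 h2] l; have := h1 l; have := h2 l.
    rewrite /= !in_itv/= gt_max le_min => /andP[-> ->] /andP[-> ->] //.
  move=> h; split=> l; have := h l; rewrite /= !in_itv/= gt_max le_min.
    by move=> /andP[/andP[_ ->] /andP[_ ->]].
  by move=> /andP[/andP[-> _] /andP[-> _]].
rewrite Rintegral_mkindic; under eq_Rintegral do rewrite E.
have [ab|] := pselect (forall l, a' l <= b' l); last first.
  move=> /existsNP[l /negP]; rewrite -ltNge => bal.
  have b0 x : \1_(box a' b') x = 0 :> R.
    rewrite indicE memNset// => h; have := h l; rewrite /= in_itv/= => /andP[h1 h2].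
    by have := lt_le_trans (lt_trans bal h1) h2; rewrite ltxx.
  under eq_Rintegral do rewrite b0 !mulr0 subr0.
  by apply: Rintegral_ge0.
have j1 := integrable_indic_box a' b'.
have j2 : leb.-integrable setT (EFin \o (fun x => f x * \1_(box a' b') x)).
  apply: (@integrable_boxM _ _ f _ a' b' 1) => // [|x|x xb].
  - by apply: measurable_indic; exact: measurable_box.
  - by rewrite indicE; case: (_ \in _); rewrite ?normr1 ?normr0.
  - by rewrite indicE memNset.
have jM : leb.-integrable setT (EFin \o (fun x => M * \1_(box a' b') x)).
  exact: (integrableZl measurableT M j1).
rewrite RintegralB// RintegralZl// Rintegral_indic_box// -Rintegral_mkindic subr_ge0.
apply: hbox => l; rewrite /a' /b' ab andTb.
by rewrite le_max lexx orbT ge_min lexx orbT.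
Qed.

End ramp.

(** * Smooth steps with vanishing moments *)

Section kernel.
Context {R : realType}.

Lemma flat_outside_bounded (f : R -> R) (c : R) : continuous f ->
  (forall z, z <= 0 -> f z = 0) -> (forall z, 1 <= z -> f z = c) ->
  exists2 C, 0 <= C & forall z, `|f z| <= C.
Proof.
move=> cf f0 f1.
have cn : {within `[0, 1], continuous (fun z => `|f z|)}.
  by apply: continuous_subspaceT => z; apply: cvg_norm; exact: cf.
have [z _ hz'] := EVT_max ler01 cn.
have hz t : 0 <= t <= 1 -> `|f t| <= `|f z| by move=> t01; apply: hz'; rewrite in_itv.
exists `|f z| => // y; have [y0|y0] := ltP y 0.
  by rewrite f0 ?normr0// ltW.
have [y1|y1] := leP y 1; first by apply: hz; rewrite y0.
by have := hz 1; rewrite (f1 y (ltW y1)) (f1 1)// ler01 lexx; exact.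
Qed.

Lemma smooth_step_derive_bounded (f : R -> R) (c : R) : smooth1 f ->
  (forall z, z <= 0 -> f z = 0) -> (forall z, 1 <= z -> f z = c) ->
  exists2 L, 0 <= L & forall y, `|derive1 f y| <= L.
Proof.
move=> sf f0 f1.
have df0 z : z < 0 -> derive1 f z = 0.
  move=> z0; rewrite derive1E.
  suff D : is_derive z (1 : R) f 0 by have [_ ->] := D.
  apply: (@near_eq_is_derive _ _ _ (cst 0)); near=> y; rewrite f0//.
  by apply: ltW; near: y; exact: lt_nbhsl.
have df1 z : 1 < z -> derive1 f z = 0.
  move=> z0; rewrite derive1E.
  suff D : is_derive z (1 : R) f 0 by have [_ ->] := D.
  apply: (@near_eq_is_derive _ _ _ (cst c)); near=> y; rewrite f1//.
  by apply: ltW; near: y; exact: lt_nbhsr.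
have cn : {within `[0, 1], continuous (fun z => `|derive1 f z|)}.
  apply: continuous_subspaceT => z; apply: cvg_norm.
  exact: (smooth1_continuous (smooth1_derive sf)).
have [z _ hz'] := EVT_max ler01 cn.
have hz t : 0 <= t <= 1 -> `|derive1 f t| <= `|derive1 f z|.
  by move=> t01; apply: hz'; rewrite in_itv.
have bd y : `|derive1 f y| <= `|derive1 f z|.
  have [y0|y0] := ltP y 0; first by rewrite df0 ?normr0.
  have [y1|y1] := leP y 1; first by apply: hz; rewrite y0.
  by rewrite df1 ?normr0.
by exists `|derive1 f z|.
Unshelve. all: by end_near. Qed.

Lemma derive_bounded_lipschitz (f : R -> R) (L : R) : smooth1 f ->
  (forall y, `|derive1 f y| <= L) -> forall x y, `|f x - f y| <= L * `|x - y|.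
Proof.
move=> sf bd x y.
wlog xy : x y / x < y.
  move=> h; have [|xy|->] := ltgtP x y; first exact: h.
    by rewrite distrC [`|x - y|]distrC; exact: h.
  by rewrite !subrr normr0 mulr0.
have cf : {within `[x, y], continuous f}.
  by apply: continuous_subspaceT; exact: smooth1_continuous.
have [u _ e] := @MVT _ f (derive1 f) _ _ xy (fun t _ => smooth1_is_derive sf t) cf.
rewrite distrC e normrM [`|x - y|]distrC ler_wpM2r//.
Qed.

(* [H (4 z) - H z] is a [k]-th derivative exactly when the moments of orders
   [1, ..., k - 1] of [H^`()] vanish. *)
Lemma vanishing_moment_step (k : nat) : exists H V : R -> R, exists c : R,
  [/\ smooth1 H, (forall z, z <= 0 -> H z = 0) & forall z, 1 <= z -> H z = 1] /\
  [/\ smooth1 V, (forall z, z <= 0 -> V z = 0), (forall z, 1 <= z -> V z = c) &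
     forall z, H (4 * z) - H z = derive1n k.+1 V z].
Proof.
(* Since [V] is 0 to the left of 0 and constant to the right of 1, its difference with its copy
   contracted by 4 vanishes outside [0, 1], and a primitive of the difference is again of the same
   kind as [V]. *)
have prim (V : R -> R) c : smooth1 V -> (forall z, z <= 0 -> V z = 0) ->
    (forall z, 1 <= z -> V z = c) -> exists W : R -> R, exists c' : R,
    [/\ smooth1 W, (forall z, z <= 0 -> W z = 0), (forall z, 1 <= z -> W z = c') &
      forall z, derive1 W z = V (4 * z + 0) - V z].
  move=> sV V0 V1; pose w z := V (4 * z + 0) - V z.
  have sw : smooth1 w by apply: smooth1B => //; exact: smooth1_affine.
  have w0 z : z <= 0 -> w z = 0.
    by move=> z0; rewrite /w !V0 ?subrr//; lra.
  have w1 z : 1 <= z -> w z = 0.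
    by move=> z0; rewrite /w !V1 ?subrr//; lra.
  have [W [dW W0]] := prim_exists (smooth1_continuous sw) w0.
  exists W, (W 1); split => //.
  - exact: smooth1_prim dW sw.
  - move=> z z1; apply/esym/is_derive0_eq => // y.
    by rewrite in_itv/= => /andP[y1 _]; rewrite -(w1 y) ?ltW.
  - by move=> z; rewrite (is_derive_derive1 dW).
elim: k => [|k [H [V [c [[sH H0 H1] [sV V0 V1 HV]]]]]].
  have [H [sH H0 H1 _]] := @smooth_step_exists R.
  have [V [c [sV V0 V1 dV]]] := prim H 1 sH H0 H1.
  exists H, V, c; split; split => // z.
  by rewrite derive1n1 dV addr0.
have [W [c' [sW W0 W1 dW]]] := prim V c sV V0 V1.
(* Richardson extrapolation. Contracting a function by 4 multiplies its derivative of order [k.+1]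
   by [q^-1]; the combination of [H (4 * z)] and [q * H z] therefore turns the increment into a
   derivative of order [k.+1] of [V (4 * z) - V z], which has one more primitive [W]. The factor
   [(1 - q)^-1] restores the value 1 beyond 1. *)
pose q : R := 4^-1 ^+ k.+1.
have q1 : q < 1 by rewrite exprn_ilt1// ?invr_ge0//; lra.
have q0 : 0 < q by rewrite exprn_gt0// invr_gt0.
have nq : 1 - q != 0 by rewrite gt_eqF// subr_gt0.
exists (fun z => (1 - q)^-1 * (H (4 * z + 0) - q * H z)), (fun z => (q / (1 - q)) * W z),
  (q / (1 - q) * c'); split; split.
- have s1 : smooth1 (fun z => H (4 * z + 0)) by exact: smooth1_affine.
  exact: smooth1Z (smooth1B s1 (smooth1Z q sH)).
- by move=> z z0; rewrite !H0 ?mulr0 ?subrr ?mulr0//; lra.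
- by move=> z z1; rewrite !H1 ?mulr1 ?mulVf//; lra.
- exact: smooth1Z.
- by move=> z z0; rewrite W0 ?mulr0.
- by move=> z z1; rewrite W1.
- move=> z; rewrite derive1nZ// derive1Sn.
  have -> : derive1 W = (fun z => V (4 * z + 0) - V z) by apply/funext.
  rewrite derive1nB//; last exact: smooth1_affine.
  rewrite derive1n_affine// -!HV !addr0 -/q.
  have q4 : q * 4 ^+ k.+1 = 1 by rewrite /q -exprMn mulVf ?expr1n.
  have -> : q / (1 - q) * (4 ^+ k.+1 * (H (4 * (4 * z)) - H (4 * z)) - (H (4 * z) - H z)) =
    (1 - q)^-1 * (q * 4 ^+ k.+1 * (H (4 * (4 * z)) - H (4 * z)) - q * (H (4 * z) - H z)) by ring.
  by rewrite q4; ring.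
Qed.

End kernel.

Section ramp_L2.
Context {R : realType} {n : nat}.
Notation "'leb'" := (@lebesgue_rV R n).

Lemma sqrt_le (x y : R) : 0 <= y -> x <= y ^+ 2 -> Num.sqrt x <= y.
Proof.
move=> y0 xy; rewrite -[leRHS]ger0_norm// -sqrtr_sqr.
by rewrite ler_wsqrtr.
Qed.

Lemma sqrt_prod (I : finType) (F : I -> R) : (forall i, 0 <= F i) ->
  Num.sqrt (\prod_i F i) = \prod_i Num.sqrt (F i).
Proof.
move=> F0.
suff [] : 0 <= \prod_i F i /\ Num.sqrt (\prod_i F i) = \prod_i Num.sqrt (F i) by [].
apply: (big_ind2 (fun x y => 0 <= x /\ Num.sqrt x = y)) => //.
- by rewrite sqrtr1.
- by move=> x1 x2 y1 y2 [x10 <-] [y10 <-]; rewrite mulr_ge0// sqrtrM.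
Qed.

(** [S] times the root of the length of the support bounds the L^2 norm of a ramp, and the bound
    must be linear in [t - s] to yield averages later. If [t - s] is at least the transition width,
    the trivial bound [C + C] is enough and gives the term in [C]; on shorter intervals the two
    steps nearly cancel, and the Lipschitz bound gives the term in [L]. Both scales [j] and [j.+1]
    are allowed since the scale is raised one coordinate at a time. *)
Lemma ramp_sup (H : R -> R) (C L : R) (i j : nat) (s t : R) :
  0 <= C -> 0 <= L -> (forall z, `|H z| <= C) ->
  (forall x y, `|H x - H y| <= L * `|x - y|) -> (j <= i <= j.+1)%N -> s <= t ->
  exists S, [/\ 0 <= S, (forall y, `|ramp H i s t y| <= S) &
    S * Num.sqrt (t - s + 4^-1 ^+ j) <= (4 * C + 8 * L) * 2 ^+ j * (t - s)].
Proof.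
move=> C0 L0 HC HL /andP[ji ij] st.
have d0 : 0 < 4^-1 ^+ j :> R by rewrite exprn_gt0// invr_gt0.
have p0 : 0 < 2 ^+ j :> R by rewrite exprn_gt0.
have p1 : 1 <= 2 ^+ j :> R by rewrite exprn_ege1// ler1n.
have pd : 2 ^+ j * 2 ^+ j * 4^-1 ^+ j = 1 :> R.
  by rewrite -!exprMn (_ : 2 * 2 / 4 = 1 :> R) ?expr1n//; lra.
have i4 : 4 ^+ i <= 4 * (2 ^+ j * 2 ^+ j) :> R.
  rewrite -exprMn (_ : 2 * 2 = 4 :> R); last by lra.
  by rewrite -exprS ler_eXn2l// ltr1n.
set d := 4^-1 ^+ j in d0 pd *; set p := 2 ^+ j in p0 p1 pd i4 *.
have ts0 : 0 <= t - s by rewrite subr_ge0.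
have [dts|tsd] := leP d (t - s).
  exists (C + C); split; [by rewrite addr_ge0|by move=> y; exact: ramp_le|].
  have h : Num.sqrt (t - s + d) <= 2 * p * (t - s).
    apply: sqrt_le; first by rewrite !mulr_ge0// ltW.
    have : 1 <= p * p * (t - s) by rewrite -pd ler_wpM2l// mulr_ge0// ltW.
    set u := t - s in ts0 dts *; move=> h1.
    have : u * 1 <= u * (p * p * u) by rewrite ler_wpM2l.
    rewrite (_ : (2 * p * u) ^+ 2 = 4 * (u * (p * p * u))); last by ring.
    by move=> h2; lra.
  have h2 : (C + C) * Num.sqrt (t - s + d) <= (C + C) * (2 * p * (t - s)).
    by rewrite ler_wpM2l// addr_ge0.
  have : 0 <= 8 * L * p * (t - s) by rewrite !mulr_ge0// ltW.
  by move=> h3; lra.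
exists (L * (4 ^+ i * (t - s))); split.
- by rewrite mulr_ge0// mulr_ge0// exprn_ge0.
- move=> y; apply: (le_trans (HL _ _)).
  rewrite (_ : _ - _ = 4 ^+ i * (t - s)); last by ring.
  by rewrite ger0_norm// mulr_ge0// exprn_ge0.
- have h : Num.sqrt (t - s + d) <= 2 * p * d.
    apply: sqrt_le; first by rewrite !mulr_ge0// ltW.
    rewrite (_ : (2 * p * d) ^+ 2 = 4 * (p * p * d) * d); last by ring.
    by rewrite pd; lra.
  have h1 : L * (4 ^+ i * (t - s)) <= L * (4 * (p * p) * (t - s)).
    by rewrite ler_wpM2l// ler_wpM2r.
  have h2 : L * (4 ^+ i * (t - s)) * Num.sqrt (t - s + d) <=
      L * (4 * (p * p) * (t - s)) * (2 * p * d).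
    by rewrite ler_pM// ?sqrtr_ge0// mulr_ge0// mulr_ge0// exprn_ge0.
  apply: (le_trans h2).
  rewrite (_ : L * (4 * (p * p) * (t - s)) * (2 * p * d) = 8 * L * p * (t - s) * (p * p * d)); last by ring.
  have : 0 <= 4 * C * p * (t - s) by rewrite !mulr_ge0// ltW.
  by rewrite pd; lra.
Qed.

(** Cauchy-Schwarz on the box enlarged by the coarser transition width [4^-1 ^+ j], with the sup
    bound and the root of the volume factored over the coordinates. Each coordinate costs a factor
    [2 ^+ j]. *)
Lemma tensor_ramp_bound (g : 'rV[R]_n -> R) (Hs : 'I_n -> R -> R) (c : 'I_n -> R) (C L G : R)
    (J : 'I_n -> nat) (j : nat) (a b : 'I_n -> R) :
  0 <= C -> 0 <= L -> (forall l z, `|Hs l z| <= C) ->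
  (forall l x y, `|Hs l x - Hs l y| <= L * `|x - y|) ->
  (forall l z, z <= 0 -> Hs l z = 0) -> (forall l z, 1 <= z -> Hs l z = c l) ->
  (forall l, measurable_fun setT (Hs l)) ->
  (forall l, (j <= J l <= j.+1)%N) -> (forall l, a l <= b l) ->
  measurable_fun setT g -> ('N[leb]_2%:E[EFin \o g] <= G%:E)%E ->
  `|\int[leb]_x (g x * tensor (fun l => ramp (Hs l) (J l) (a l) (b l)) x)| <=
  G * ((4 * C + 8 * L) ^+ n * 2 ^+ (j * n) * \prod_l (b l - a l)).
Proof.
move=> C0 L0 HC HL H0 H1 mH jJ ab mg gG.
have /choice[S hS] := fun l => ramp_sup C0 L0 (HC l) (HL l) (jJ l) (ab l).
have d0 : 0 < 4^-1 ^+ j :> R by rewrite exprn_gt0// invr_gt0.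
have G0 : 0 <= G by rewrite -lee_fin (le_trans _ gG)// Lnorm_ge0.
have mT : measurable_fun setT (tensor (fun l => ramp (Hs l) (J l) (a l) (b l))).
  by apply: measurable_tensor => l; exact: measurable_ramp.
have TS x : `|tensor (fun l => ramp (Hs l) (J l) (a l) (b l)) x| <= \prod_l S l.
  rewrite /tensor normr_prod; apply: ler_prod => l _.
  by rewrite normr_ge0/=; have [_ + _] := hS l; exact.
have T0 x : ~ box a (fun l => b l + 4^-1 ^+ j) x ->
    tensor (fun l => ramp (Hs l) (J l) (a l) (b l)) x = 0.
  move=> /existsNP[l]; rewrite /= in_itv/= => /negP; rewrite negb_and -leNgt -ltNge => h.
  rewrite (tensorD1 _ l).
  have p4 : 0 < 4 ^+ (J l) :> R by rewrite exprn_gt0.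
  suff -> : ramp (Hs l) (J l) (a l) (b l) (x 0 l) = 0 by rewrite mul0r.
  have al := ab l; rewrite /ramp -!mulrBr; case/orP: h => h.
    by rewrite !H0 ?subrr// mulr_ge0_le0 ?subr_le0 ?(ltW p4)//; exact: le_trans h al.
  have h1 : 1 <= 4 ^+ J l * (x 0 l - b l).
    have /andP[jl _] := jJ l.
    have : 4 ^+ j * 4^-1 ^+ j <= 4 ^+ J l * (x 0 l - b l).
      have hJ : 4 ^+ j <= 4 ^+ J l :> R by rewrite ler_weXn2l// ler1n.
      have e1 : 0 <= 4 ^+ j :> R by rewrite exprn_ge0.
      apply: (ler_pM e1 (ltW d0) hJ).
      by rewrite lerBrDl ltW.
    by rewrite -exprMn divff// expr1n.
  by rewrite !H1 ?subrr// (le_trans h1)// ler_pM2l// lerD2l lerN2.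
have ab' l : a l <= b l + 4^-1 ^+ j by rewrite (le_trans (ab l))// lerDl ltW.
apply: (le_trans (Cauchy_Schwarz_box ab' mg mT gG TS T0)).
rewrite ler_wpM2l// sqrt_prod; last by move=> l; rewrite subr_ge0.
rewrite -big_split/= exprM.
have -> : (4 * C + 8 * L) ^+ n * 2 ^+ j ^+ n = \prod_(l < n) ((4 * C + 8 * L) * 2 ^+ j).
  by rewrite prodr_const card_ord exprMn.
rewrite -big_split/=; apply: ler_prod => l _.
have [S0 _] := hS l; rewrite mulr_ge0 ?sqrtr_ge0//=.
by rewrite (_ : b l + 4^-1 ^+ j - a l = b l - a l + 4^-1 ^+ j)//; lra.
Qed.

End ramp_L2.

(** * The Sobolev embedding into bounded functions *)

Section embedding.
Context {R : realType} {n : nat}.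
Notation "'leb'" := (@lebesgue_rV R n).
Implicit Types (a b : 'I_n -> R) (f : 'rV[R]_n -> R).

Lemma smooth1_ramp (H : R -> R) j s t : smooth1 H -> smooth1 (ramp H j s t).
Proof. by move=> sH; apply: smooth1B; exact: smooth1_affine. Qed.

Lemma derive1n_ramp (V : R -> R) k j s t y : smooth1 V ->
  derive1n k (ramp V j s t) y = 4 ^+ j ^+ k * ramp (derive1n k V) j s t y.
Proof.
move=> sV; rewrite /ramp derive1nB; [|exact: smooth1_affine..].
by rewrite !derive1n_affine// mulrBr.
Qed.

Lemma ramp_scale_diff (H V : R -> R) k j s t y : smooth1 V ->
  (forall z, H (4 * z) - H z = derive1n k V z) ->
  ramp H j.+1 s t y - ramp H j s t y = 4^-1 ^+ j ^+ k * derive1n k (ramp V j s t) y.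
Proof.
move=> sV HV; rewrite derive1n_ramp// mulrA -!exprMn mulVf ?expr1n// ?mul1r// /ramp -!HV.
have E u : 4 ^+ j.+1 * y + - (4 ^+ j.+1 * u) = 4 * (4 ^+ j * y + - (4 ^+ j * u)).
  by rewrite exprS; ring.
by rewrite !E; ring.
Qed.

Lemma tensor_ramp_test_function (Hs : 'I_n -> R -> R) (c : 'I_n -> R) (J : 'I_n -> nat) a b :
  (forall l, smooth1 (Hs l)) ->
  (forall l z, z <= 0 -> Hs l z = 0) -> (forall l z, 1 <= z -> Hs l z = c l) ->
  (forall l, a l <= b l) ->
  test_function (tensor (fun l => ramp (Hs l) (J l) (a l) (b l))).
Proof.
move=> sH H0 H1 ab; apply: (@tensor_test_function _ _ _ a (fun l => b l + 1)) => [l|l x].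
  exact: smooth1_ramp.
have p4 : 0 < 4 ^+ J l :> R by rewrite exprn_gt0.
have p1 : 1 <= 4 ^+ J l :> R by rewrite exprn_ege1// ler1n.
have al := ab l; apply: contraNT => /negP h; apply/eqP; rewrite /ramp -!mulrBr.
have [xa|ax] := ltP x (a l).
  by rewrite !H0 ?subrr// mulr_ge0_le0 ?(ltW p4)// subr_le0; lra.
have bx : b l + 1 <= x.
  by rewrite leNgt; apply/negP => xb; apply: h; rewrite ax ltW.
have h1 : 1 <= 4 ^+ J l * (x - b l).
  rewrite -[leLHS]mulr1; apply: ler_pM => //; lra.
by rewrite !H1 ?subrr// (le_trans h1)// ler_pM2l// lerD2l lerN2.
Qed.

Lemma measurable_smooth1 (H : R -> R) : smooth1 H -> measurable_fun setT H.
Proof. by move=> sH; apply: continuous_measurable_fun; exact: smooth1_continuous. Qed.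

Section step.
Variables (k : nat) (H V : R -> R) (cV C L : R).
Hypotheses (sH : smooth1 H) (sV : smooth1 V).
Hypotheses (H0 : forall z, z <= 0 -> H z = 0) (H1 : forall z, 1 <= z -> H z = 1).
Hypotheses (V0 : forall z, z <= 0 -> V z = 0) (V1 : forall z, 1 <= z -> V z = cV).
Hypothesis HV : forall z, H (4 * z) - H z = derive1n k V z.
Hypotheses (C0 : 0 <= C) (L0 : 0 <= L).
Hypotheses (HC : forall z, `|H z| <= C) (VC : forall z, `|V z| <= C).
Hypotheses (HL : forall x y, `|H x - H y| <= L * `|x - y|)
  (VL : forall x y, `|V x - V y| <= L * `|x - y|).
Variables (f g0 : 'rV[R]_n -> R) (g : 'I_n -> 'rV[R]_n -> R) (G : R).
Hypotheses (fg0 : weak_derivative [::] f g0)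
  (fg : forall i, weak_derivative (nseq k i) f (g i)).
Hypotheses (g0G : ('N[leb]_2%:E[EFin \o g0] <= G%:E)%E)
  (gG : forall i, ('N[leb]_2%:E[EFin \o g i] <= G%:E)%E).

Let D := 4 * C + 8 * L.

Let rampJ a b (J : 'I_n -> nat) := tensor (fun l => ramp H (J l) (a l) (b l)).

Let integrable_rampJ a b J : (forall l, a l <= b l) ->
  leb.-integrable setT (EFin \o (fun x => f x * rampJ a b J x)).
Proof.
move=> ab; have [lf _ _] := fg0.
apply: (@integrable_boxM _ _ _ _ a (fun l => b l + 1) ((C + C) ^+ n)) => //.
- by apply: measurable_tensor => l; apply: measurable_ramp; exact: measurable_smooth1.
- move=> x; rewrite /rampJ /tensor normr_prod (_ : _ ^+ n = \prod_(l < n) (C + C)).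
    by apply: ler_prod => l _; rewrite normr_ge0; exact: ramp_le.
  by rewrite prodr_const card_ord.
- move=> x /existsNP[l]; rewrite /= in_itv/= => /negP; rewrite negb_and -leNgt -ltNge => h.
  rewrite /rampJ (tensorD1 _ l) (ramp_out H0 H1) ?mul0r//.
  by case/orP: h => h; [left|right; exact: ltW].
Qed.

(** Refining the scale in the direction [i] alone changes the test function by [4^-1 ^+ j ^+ k]
    times a pure derivative of order [k] in that direction, which is moved onto [f]. The gain
    [4^-1 ^+ j ^+ k] against the loss [2 ^+ (j * n)] of the L^2 bound leaves at most [2^-1 ^+ j]
    exactly because [n < 2 * k]: this is where the Sobolev exponent enters. *)
Let one_coordinate a b (J J' : 'I_n -> nat) (i : 'I_n) j : (forall l, a l <= b l) ->
  (forall l, (j <= J l <= j.+1)%N) -> J i = j -> J' i = j.+1 ->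
  (forall l, l != i -> J' l = J l) -> (n < 2 * k)%N ->
  `|\int[leb]_x (f x * rampJ a b J' x) - \int[leb]_x (f x * rampJ a b J x)| <=
  G * D ^+ n * 2^-1 ^+ j * \prod_l (b l - a l).
Proof.
move=> ab jJ Ji Ji' JJ' nk.
pose Hs l := if l == i then V else H.
pose Q := tensor (fun l => ramp (Hs l) (J l) (a l) (b l)).
have E x : rampJ a b J' x - rampJ a b J x = 4^-1 ^+ j ^+ k * partials (nseq k i) Q x.
  rewrite /Q partials_tensor; last first.
    by move=> l; apply: smooth1_ramp; rewrite /Hs; case: ifP.
  rewrite /rampJ !(tensorD1 _ i) Ji Ji' /Hs eqxx count_nseq/= eqxx mul1n.
  rewrite mulrA -(@ramp_scale_diff H)//.
  have -> : \prod_(l | l != i) derive1n (count_mem l (nseq k i))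
      (ramp (if l == i then V else H) (J l) (a l) (b l)) (x 0 l) =
    \prod_(l | l != i) ramp H (J l) (a l) (b l) (x 0 l).
    apply: eq_bigr => l li.
    by rewrite count_nseq/= eq_sym (negbTE li) mul0n.
  by rewrite [RHS]mulrBl; congr (_ * _ - _); apply: eq_bigr => l li; rewrite JJ'.
have tQ : test_function Q.
  apply: (@tensor_ramp_test_function _ (fun l => if l == i then cV else 1)) => // l;
    by rewrite /Hs; case: ifP => // _.
rewrite -RintegralB//; [|exact: integrable_rampJ..].
under eq_Rintegral do rewrite -mulrBr E mulrCA.
have [lf lg fgi] := fg i.
have iQ : leb.-integrable setT (EFin \o (fun x => f x * partials (nseq k i) Q x)).
  have -> : (fun x => f x * partials (nseq k i) Q x) =
      (fun x => 4 ^+ j ^+ k * (f x * rampJ a b J' x - f x * rampJ a b J x)).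
    apply/funext => x; rewrite -mulrBr E.
    have e : 4 ^+ j ^+ k * 4^-1 ^+ j ^+ k = 1 :> R by rewrite -!exprMn divff// !expr1n.
    set P := partials _ _ x; rewrite -[LHS]mul1r -[X in X * _ = _]e; ring.
  exact: (integrableZl measurableT (4 ^+ j ^+ k)
    (integrableB measurableT (integrable_rampJ J' ab) (integrable_rampJ J ab))).
rewrite RintegralZl// fgi// size_nseq !normrM [`|(-1) ^+ k|]normrX normrN1 expr1n mul1r.
have mg : measurable_fun setT (g i) by case: lg.
have bound : `|\int[leb]_x (g i x * Q x)| <= G * (D ^+ n * 2 ^+ (j * n) * \prod_l (b l - a l)).
  apply: (@tensor_ramp_bound _ _ (g i) Hs (fun l => if l == i then cV else 1)) => //;
    by move=> l; rewrite /Hs; case: ifP => // _; exact: measurable_smooth1.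
have d0 : 0 <= 4^-1 ^+ j ^+ k :> R by rewrite !exprn_ge0// invr_ge0.
rewrite [`|4^-1 ^+ j ^+ k|]ger0_norm//.
apply: (le_trans (ler_wpM2l d0 bound)).
have P0 : 0 <= \prod_l (b l - a l) by apply: prodr_ge0 => l _; rewrite subr_ge0.
have G0 : 0 <= G by rewrite -lee_fin (le_trans _ g0G)// Lnorm_ge0.
have D0 : 0 <= D ^+ n by rewrite exprn_ge0// addr_ge0// mulr_ge0.
have h : 4^-1 ^+ j ^+ k * 2 ^+ (j * n) <= 2^-1 ^+ j :> R.
  have e : 4^-1 = 2^-1 * 2^-1 :> R by lra.
  have -> : 4^-1 ^+ j ^+ k = 2^-1 ^+ (j * n) * 2^-1 ^+ (j * (2 * k - n)) :> R.
    rewrite e -expr2 -!exprM -exprD -mulnDr subnKC 1?ltnW//.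
    by rewrite !mulnA [(2 * j)%N]mulnC.
  rewrite mulrAC -exprMn mulVf// expr1n mul1r.
  apply: ler_wiXn2l; [by rewrite invr_ge0|by lra|].
  by rewrite leq_pmulr// subn_gt0.
rewrite (_ : _ * (G * _) = G * D ^+ n * (4^-1 ^+ j ^+ k * 2 ^+ (j * n)) * \prod_l (b l - a l)).
  by rewrite ler_wpM2r// ler_wpM2l// mulr_ge0.
by ring.
Qed.

Let one_scale a b j : (forall l, a l <= b l) -> (n < 2 * k)%N ->
  `|\int[leb]_x (f x * ramp_box H j.+1 a b x) - \int[leb]_x (f x * ramp_box H j a b x)| <=
  n%:R * (G * D ^+ n * 2^-1 ^+ j * \prod_l (b l - a l)).
Proof.
(* Hybrid scales: the first [m] coordinates are already refined, and consecutive hybrids differ in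
   one coordinate. *)
move=> ab nk; pose Jm m (l : 'I_n) := if (l < m)%N then j.+1 else j.
set B := (G * _ * _ * _).
suff h m : (m <= n)%N -> `|\int[leb]_x (f x * rampJ a b (Jm m) x) -
    \int[leb]_x (f x * rampJ a b (Jm 0) x)| <= m%:R * B.
  have := h n (leqnn n); rewrite (_ : Jm n = fun=> j.+1).
    by rewrite (_ : Jm 0 = fun=> j).
  by apply/funext => l; rewrite /Jm ltn_ord.
elim: m => [|m IHm] mn; first by rewrite subrr normr0 mul0r.
rewrite -natr1 mulrDl mul1r.
rewrite (_ : _ - _ = (\int[leb]_x (f x * rampJ a b (Jm m) x) -
    \int[leb]_x (f x * rampJ a b (Jm 0) x)) +
   (\int[leb]_x (f x * rampJ a b (Jm m.+1) x) -
    \int[leb]_x (f x * rampJ a b (Jm m) x))); last by ring.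
apply: (le_trans (ler_normD _ _)); apply: lerD; first exact/IHm/ltnW.
apply: (@one_coordinate _ _ _ _ (Ordinal mn)) => //; rewrite /Jm/=.
- by move=> l; case: ifP; rewrite leqnn leqnSn.
- by rewrite ltnn.
- by rewrite ltnSn.
- by move=> l /eqP lm; rewrite ltnS leq_eqVlt; case: eqP => // e; case: lm; exact: val_inj.
Qed.

Lemma ramp_box_integral_bound a b j : (forall l, a l <= b l) -> (n < 2 * k)%N ->
  `|\int[leb]_x (f x * ramp_box H j a b x)| <=
  (1 + 2 * n%:R) * D ^+ n * G * \prod_l (b l - a l).
Proof.
move=> ab nk.
have P0 : 0 <= \prod_l (b l - a l) by apply: prodr_ge0 => l _; rewrite subr_ge0.
have G0 : 0 <= G by rewrite -lee_fin (le_trans _ g0G)// Lnorm_ge0.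
have D0 : 0 <= D ^+ n by rewrite exprn_ge0// addr_ge0// mulr_ge0.
set B := D ^+ n * G * \prod_l (b l - a l).
have B0 : 0 <= B by rewrite !mulr_ge0.
(* Partial sum of the geometric series of the changes of scale, in closed form for the induction.
   Scale 0 is paid for by the L^2 norm of [f] itself. *)
suff h : `|\int[leb]_x (f x * ramp_box H j a b x)| <= B + 2 * n%:R * B * (1 - 2^-1 ^+ j).
  apply: (le_trans h).
  rewrite (_ : (1 + _) * _ * _ * _ = B + 2 * n%:R * B * 1); last by rewrite /B; ring.
  rewrite lerD2l; apply: ler_wpM2l; first by rewrite !mulr_ge0.
  by rewrite gerBl exprn_ge0// invr_ge0.
elim: j => [|j IHj].
  rewrite expr0 subrr mulr0 addr0.
  have [lf lg fgi] := fg0.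
  rewrite fgi; last exact: (@tensor_ramp_test_function _ (fun=> 1)).
  rewrite /= expr0 mul1r.
  have mg0 : measurable_fun setT g0 by case: lg.
  have mH := measurable_smooth1 sH.
  have := @tensor_ramp_bound _ _ g0 (fun=> H) (fun=> 1) C L G (fun=> 0%N) 0 a b C0 L0
    (fun=> HC) (fun=> HL) (fun=> H0) (fun=> H1) (fun=> mH) (fun=> isT) ab mg0 g0G.
  by rewrite mul0n expr0 mulr1 /B -/D mulrCA !mulrA.
rewrite (_ : \int[leb]_x _ = (\int[leb]_x (f x * ramp_box H j.+1 a b x) -
    \int[leb]_x (f x * ramp_box H j a b x)) + \int[leb]_x (f x * ramp_box H j a b x)); last by ring.
apply: (le_trans (ler_normD _ _)).
apply: (le_trans (lerD (one_scale j ab nk) IHj)).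
rewrite (_ : n%:R * _ = n%:R * B * 2^-1 ^+ j); last by rewrite /B; ring.
rewrite exprS; set q := 2^-1 ^+ j; set u := n%:R * B.
rewrite (_ : 2 * n%:R * B = 2 * u); last by rewrite /u mulrA.
lra.
Qed.

End step.

(** Smoothed averages of [f] over boxes are bounded uniformly in the scale, which bounds [f] and
    [- f] on every cube. Of the derivatives of order [k], the pure ones enter, one for each
    direction. *)
Theorem Sobolev_bounded k : (n < 2 * k)%N -> exists2 K : R, 0 <= K &
  forall (f g0 : 'rV[R]_n -> R) (g : 'I_n -> 'rV[R]_n -> R) (G : R),
  weak_derivative [::] f g0 -> (forall i, weak_derivative (nseq k i) f (g i)) ->
  ('N[leb]_2%:E[EFin \o g0] <= G%:E)%E ->
  (forall i, ('N[leb]_2%:E[EFin \o g i] <= G%:E)%E) ->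
  \forall x \ae leb, `|f x| <= K * G.
Proof.
case: k => [|k]; first by rewrite muln0.
move=> nk; have [H [V [cV [[sH H0 H1] [sV V0 V1 HV]]]]] := @vanishing_moment_step R k.
have [CH CH0 HCH] := flat_outside_bounded (smooth1_continuous sH) H0 H1.
have [CV CV0 VCV] := flat_outside_bounded (smooth1_continuous sV) V0 V1.
have [LH LH0 /(derive_bounded_lipschitz sH) HLH] := smooth_step_derive_bounded sH H0 H1.
have [LV LV0 /(derive_bounded_lipschitz sV) VLV] := smooth_step_derive_bounded sV V0 V1.
pose C := CH + CV; pose L := LH + LV.
have C0 : 0 <= C by rewrite addr_ge0.
have L0 : 0 <= L by rewrite addr_ge0.
exists ((1 + 2 * n%:R) * (4 * C + 8 * L) ^+ n).
  by rewrite mulr_ge0 ?exprn_ge0// addr_ge0// mulr_ge0.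
move=> f g0 g G fg0 fg g0G gG.
have HC z : `|H z| <= C by rewrite (le_trans (HCH z))// lerDl.
have bound a b j : (forall l, a l <= b l) ->
    `|\int[leb]_x (f x * ramp_box H j a b x)| <=
    (1 + 2 * n%:R) * (4 * C + 8 * L) ^+ n * G * \prod_l (b l - a l).
  move=> ab; apply: (@ramp_box_integral_bound k.+1 H V cV C L _ _ _ _ _ _ _ _ _ _ _ _ _ f g0 g G) => //.
  - by move=> z; rewrite (le_trans (VCV z))// lerDr.
  - by move=> x y; rewrite (le_trans (HLH x y))// ler_wpM2r// lerDl.
  - by move=> x y; rewrite (le_trans (VLV x y))// ler_wpM2r// lerDr.
set M := _ * G in bound *.
have [lf _ _] := fg0.
have mH := measurable_smooth1 sH.
have lNf : loc_integrable (fun x => - f x).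
  have [mf If] := lf; split; first exact: measurableT_comp.
  by move=> K cK; exact: (integrableN (If K cK)).
have up m : \forall x \ae leb, box (fun=> - m%:R) (fun=> m%:R) x -> f x <= M.
  apply: (ae_le_of_ramp_box mH HC H0 H1 lf) => a b abh.
  have ab l : a l <= b l by have /and3P[] := abh l.
  by apply: nearW => j; apply: le_trans (bound a b j ab); exact: ler_norm.
have lo m : \forall x \ae leb, box (fun=> - m%:R) (fun=> m%:R) x -> - f x <= M.
  apply: (ae_le_of_ramp_box mH HC H0 H1 lNf) => a b abh.
  have ab l : a l <= b l by have /and3P[] := abh l.
  apply: nearW => j; apply: le_trans (bound a b j ab).
  under eq_Rintegral do rewrite mulNr -mulN1r.
  rewrite RintegralZl//; first by rewrite mulN1r -normrN ler_norm.
  apply: (@integrable_boxM _ _ _ _ a (fun l => b l + 1) ((C + C) ^+ n)) => //.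
  - exact: measurable_ramp_box.
  - by move=> x; exact: ramp_box_le.
  - by move=> x; exact: ramp_box_out.
apply: aeS2 (ae_foralln up) (ae_foralln lo) => x hu hl.
pose m := Num.bound (\sum_l `|x 0 l|).
have xm : box (fun=> - m%:R) (fun=> m%:R) x.
  move=> l; rewrite /= in_itv/=.
  have h : `|x 0 l| < m%:R.
    apply: le_lt_trans (archi_boundP _); last by apply: sumr_ge0.
    by rewrite (bigD1 l)//= lerDl; apply: sumr_ge0.
  by move: h; rewrite ltr_norml => /andP[-> /ltW ->].
by rewrite ler_norml lerNl (hl m)//= (hu m).
Qed.

End embedding.

(** * Measurability, test functions and weak derivatives *)

Section test_functions.
Context {R : realType} {n : nat}.
Notation "'leb'" := (@lebesgue_rV R n).

(** The sigma-algebra is generated by the coordinates, so the topology has to be linked to it: an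
    open set is the union of the countably many rational boxes that it contains. *)
Lemma open_measurable_rV (U : set 'rV[R]_n) : open U -> measurable U.
Proof.
move=> oU.
pose B (p : {ffun 'I_n -> rat} * {ffun 'I_n -> rat}) := box (ratr \o p.1) (ratr \o p.2) : set 'rV[R]_n.
have -> : U = \bigcup_k (if unpickle k is Some p then
    if pselect (B p `<=` U) then B p else set0 else set0).
  apply/seteqP; split => x /=; last first.
    move=> [k _]; case: unpickle => [p|//]; case: pselect => [h|//]; exact: h.
  move=> Ux; have := open_nbhs_nbhs (conj oU Ux).
  move=> /nbhs_ballP[e /= e0 xeU].
  have h1 (l : 'I_n) : {r : rat | x 0 l - e / 2 < ratr r < x 0 l}.
    apply: cid; have [|r] := @rat_in_itvoo R (x 0 l - e / 2) (x 0 l); first by lra.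
    by rewrite in_itv/= => ?; exists r.
  have h2 (l : 'I_n) : {r : rat | x 0 l < ratr r < x 0 l + e / 2}.
    apply: cid; have [|r] := @rat_in_itvoo R (x 0 l) (x 0 l + e / 2); first by lra.
    by rewrite in_itv/= => ?; exists r.
  pose p := (finfun (fun l => sval (h1 l)), finfun (fun l => sval (h2 l))).
  exists (pickle p) => //; rewrite pickleK; case: pselect => [? /=|].
    move=> l; rewrite /= !ffunE in_itv/=.
    by move: (svalP (h1 l)) (svalP (h2 l)) => /andP[_ ->] /andP[/ltW -> _].
  move=> []; move=> y hy; apply: xeU; split => // i j; rewrite ord1.
  have := hy j; rewrite /= !ffunE in_itv/= => /andP[a1 a2].
  have /andP[b1 _] := svalP (h1 j); have /andP[_ b2] := svalP (h2 j).
  by rewrite /ball/= ltr_norml; apply/andP; split; lra.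
apply: bigcup_measurable => k _; case: unpickle => [p|]; last exact: measurable0.
by case: pselect => ? /=; [exact: measurable_box|exact: measurable0].
Qed.

Lemma continuous_measurable_rV (f : 'rV[R]_n -> R) : continuous f -> measurable_fun setT f.
Proof.
move=> /continuousP cf; apply: (measurability _ (RGenOpens.measurableE R)).
move=> _ [_ [a [b ->] <-]]; rewrite setTI.
by apply: open_measurable_rV; apply: cf; exact: interval_open.
Qed.

Lemma partials_out (phi : 'rV[R]_n -> R) (s : seq 'I_n) (K : set 'rV[R]_n) x :
  closed K -> (forall y, ~ K y -> phi y = 0) -> ~ K x -> partials s phi x = 0.
Proof.
move=> cK phi0; elim: s x => [|i s IHs] x Kx; first exact: phi0.
rewrite /= -/(partials s phi) /partial.
have h : \forall y \near x, cst 0 y = partials s phi y.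
  have : nbhs x (~` K) by apply: open_nbhs_nbhs; split => //; exact: closed_openC.
  by apply: filterS => y Ky; rewrite IHs.
by rewrite -(near_eq_derive _ h) derive_cst.
Qed.

Lemma integrable_test (f phi : 'rV[R]_n -> R) (s : seq 'I_n) :
  loc_integrable f -> test_function phi ->
  leb.-integrable setT (EFin \o (fun x => f x * partials s phi x)).
Proof.
move=> [mf If] [sphi cK]; set K := closure _ in cK.
have cs : continuous (partials s phi) by have [] := sphi s.
have clK : closed K by exact: closed_closure.
have mK : measurable K.
  by rewrite -(setCK K); apply: measurableC; apply: open_measurable_rV; exact: closed_openC.
have p0 x : ~ K x -> partials s phi x = 0.
  apply: partials_out => // y Ky; apply/eqP/negP => /negP h; apply: Ky.
  exact: subset_closure.
have [C hC] : exists C, forall x, `|partials s phi x| <= C.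
  have [K0|/set0P K0] := eqVneq K set0.
    by exists 0 => x; rewrite p0 ?normr0// K0.
  have cn : {within K, continuous (fun x => `|partials s phi x|)}.
    by apply: continuous_subspaceT => x; exact: (cvg_norm (cs x)).
  have [c _ hc] := compact_EVT_max K0 cK cn.
  exists `|partials s phi c| => x; have [Kx|Kx] := pselect (K x).
    by apply: hc; rewrite inE.
  by rewrite p0// normr0.
have ms : measurable_fun setT (partials s phi) by exact: continuous_measurable_rV.
have := If K cK; rewrite integrable_mkcond// restrict_EFin => iK.
apply: (@integrable_ae_bounded _ _ _ _ _ _ C _ iK); first exact: measurable_funM.
apply: aeW => x; rewrite patchE; case: ifPn => [_|/negP Kx].
  by rewrite normrM mulrC ler_wpM2r.
by rewrite p0 ?mulr0 ?normr0 ?mulr0// => h; apply: Kx; rewrite inE.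
Qed.

Lemma compact_measurable_rV (K : set 'rV[R]_n) : compact K -> measurable K.
Proof.
move=> cK; have clK : closed K.
  by apply: compact_closed => //; exact: norm_hausdorff.
by rewrite -(setCK K); apply: measurableC; apply: open_measurable_rV; exact: closed_openC.
Qed.

Lemma loc_integrableB (f g : 'rV[R]_n -> R) : loc_integrable f -> loc_integrable g ->
  loc_integrable (fun x => f x - g x).
Proof.
move=> [mf If] [mg Ig]; split; first exact: measurable_funB.
move=> K cK; have mK := compact_measurable_rV cK.
exact: (integrableB mK (If K cK) (Ig K cK)).
Qed.

Lemma loc_integrableZ (c : R) (f : 'rV[R]_n -> R) : loc_integrable f ->
  loc_integrable (fun x => c * f x).
Proof.
move=> [mf If]; split; first exact: measurable_funM.
move=> K cK; have mK := compact_measurable_rV cK.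
exact: (integrableZl mK c (If K cK)).
Qed.

Lemma weak_derivativeB (s : seq 'I_n) (f f' g g' : 'rV[R]_n -> R) :
  weak_derivative s f f' -> weak_derivative s g g' ->
  weak_derivative s (fun x => f x - g x) (fun x => f' x - g' x).
Proof.
move=> [lf lf' ff'] [lg lg' gg']; split; [exact: loc_integrableB..|].
move=> phi tphi.
have E (u v : 'rV[R]_n -> R) t : loc_integrable u -> loc_integrable v ->
    \int[leb]_x ((u x - v x) * partials t phi x) =
    \int[leb]_x (u x * partials t phi x) - \int[leb]_x (v x * partials t phi x).
  move=> lu lv; rewrite -RintegralB//; [|exact: integrable_test..].
  by apply: eq_Rintegral => x _; rewrite mulrBl.
by rewrite E// ff'// gg'// -mulrBr -(E f' g' [::]).
Qed.

Lemma weak_derivativeZ (s : seq 'I_n) (c : R) (f f' : 'rV[R]_n -> R) :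
  weak_derivative s f f' -> weak_derivative s (fun x => c * f x) (fun x => c * f' x).
Proof.
move=> [lf lf' ff']; split; [exact: loc_integrableZ..|].
move=> phi tphi.
have E (u : 'rV[R]_n -> R) t : loc_integrable u ->
    \int[leb]_x (c * u x * partials t phi x) = c * \int[leb]_x (u x * partials t phi x).
  move=> lu; rewrite -RintegralZl//; last exact: integrable_test.
  by apply: eq_Rintegral => x _; rewrite mulrA.
by rewrite E// ff'// mulrCA -(E f' [::]).
Qed.

Lemma wderivP (s : seq 'I_n) (f : 'rV[R]_n -> R) :
  (exists g, weak_derivative s f g) -> weak_derivative s f (wderiv s f).
Proof. by move=> [g fg]; apply: (@xgetPex _ (fun=> 0) [set g | weak_derivative s f g]); exists g. Qed.

End test_functions.

(** * From the Sobolev norm to uniform bounds in space *)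

Section time_continuity.
Context {R : realType} {n : nat}.
Notation "'leb'" := (@lebesgue_rV R n).

Lemma sobolev_norm_wderiv k (f : 'rV[R]_n -> R) (s : seq 'I_n) : (size s <= k)%N ->
  ('N[leb]_2%:E[EFin \o wderiv s f] <= sobolev_norm k f)%E.
Proof.
move=> sk.
have N0 t : (0 <= 'N[leb]_2%:E[EFin \o wderiv t f] `^ 2)%E by exact: poweR_ge0.
have -> : ('N[leb]_2%:E[EFin \o wderiv s f] =
    ('N[leb]_2%:E[EFin \o wderiv s f] `^ 2) `^ 2^-1)%E.
  by rewrite -poweRrM divff// poweRe1// Lnorm_ge0.
apply: gt0_ler_poweR => //; rewrite ?invr_ge0// ?in_itv/= ?leey ?andbT//.
  by apply: sume_ge0 => m _; apply: sume_ge0.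
have sk' : (size s < k.+1)%N by [].
rewrite (bigD1 (Ordinal sk'))//= (bigD1 (in_tuple s))//= -addeA.
rewrite leeDl// adde_ge0//; first exact: sume_ge0.
by apply: sume_ge0 => m _; exact: sume_ge0.
Qed.

Lemma sobolev_ae_bounded k (f : 'rV[R]_n -> R) : (n < 2 * k)%N -> sobolev k f ->
  exists2 M : R, 0 <= M & \forall x \ae leb, `|f x| <= M.
Proof.
move=> nk sf; have [K K0 HK] := @Sobolev_bounded R n k nk.
have fin g : g \in Lfun leb 2%:E -> exists2 A : R, 0 <= A & ('N[leb]_2%:E[EFin \o g] <= A%:E)%E.
  move=> gL; exists (fine (Lnorm leb 2%:E (EFin \o g))); first by rewrite fine_ge0// Lnorm_ge0.
  rewrite fineK// ge0_fin_numE ?Lnorm_ge0//.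
  by move: gL; rewrite inE => /andP[_]; rewrite inE.
have [g0 fg0 /fin[A0 A00 g0A]] := sf [::] isT.
have h (i : 'I_n) : exists p : ('rV[R]_n -> R) * R, [/\ weak_derivative (nseq k i) f p.1, 0 <= p.2 &
    ('N[leb]_2%:E[EFin \o p.1] <= p.2%:E)%E].
  have [|g fg /fin[A A1 gA]] := sf (nseq k i); first by rewrite size_nseq.
  by exists (g, A).
have /choice[p hp] := h.
pose G := A0 + \sum_i (p i).2.
have S0 : 0 <= \sum_i (p i).2 by apply: sumr_ge0 => i _; have [] := hp i.
exists (K * G); first by rewrite mulr_ge0// addr_ge0.
apply: (HK f g0 (fun i => (p i).1)) => //.
- by move=> i; have [] := hp i.
- by apply: (le_trans g0A); rewrite lee_fin lerDl.
- move=> i; have [_ _ h2] := hp i; apply: (le_trans h2); rewrite lee_fin /G (bigD1 i)//=.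
  rewrite addrCA lerDl addr_ge0//; apply: sumr_ge0 => j _; by have [] := hp j.
Qed.

(** Existence of the weak derivatives is assumed because [wderiv] is 0 when there is none, and the
    norm then controls nothing. *)
Lemma sobolev_norm_ae_bound k : (n < 2 * k)%N -> exists2 K : R, 0 <= K &
  forall (f : 'rV[R]_n -> R) (G : R),
  (forall s, (size s <= k)%N -> exists g, weak_derivative s f g) ->
  (sobolev_norm k f <= G%:E)%E -> \forall x \ae leb, `|f x| <= K * G.
Proof.
move=> nk; have [K K0 HK] := @Sobolev_bounded R n k nk.
exists K => // f G ef fG.
apply: (HK f (wderiv [::] f) (fun i => wderiv (nseq k i) f)).
- by apply: wderivP; exact: ef.
- by move=> i; apply: wderivP; apply: ef; rewrite size_nseq.
- by apply: le_trans fG; exact: sobolev_norm_wderiv.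
- by move=> i; apply: le_trans fG; apply: sobolev_norm_wderiv; rewrite size_nseq.
Qed.

Lemma C1_sobolev_bounded k T (f : R -> 'rV[R]_n -> R) t : (n < 2 * k)%N ->
  C1_sobolev k T f -> 0 <= t <= T ->
  exists2 M : R, 0 <= M & \forall x \ae leb, `|f t x| <= M.
Proof. by move=> nk [f' hf] tT; have [sf _ _ _] := hf t tT; exact: sobolev_ae_bounded nk sf. Qed.

(** Near [t] the difference quotient is within distance 1 of the derivative in the Sobolev norm,
    hence within [K] almost everywhere. The derivative at [t] being bounded by [M], the function is
    Lipschitz at [t] with constant below [K + M + 1], where the last 1 only keeps the divisor
    positive. *)
Lemma C1_sobolev_continuous k T (f : R -> 'rV[R]_n -> R) t (e : R) : (n < 2 * k)%N ->
  C1_sobolev k T f -> 0 <= t <= T -> 0 < e ->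
  exists2 d : R, 0 < d & forall s, 0 <= s <= T -> `|s - t| < d ->
    \forall x \ae leb, `|f s x - f t x| <= e.
Proof.
move=> nk [f' hf] tT e0; have [sft sft' cv _] := hf t tT.
have [M M0 hM] := sobolev_ae_bounded nk sft'.
have [K K0 HK] := sobolev_norm_ae_bound nk.
have lt1 : nbhs (0%E : \bar R) [set y | (y < 1)%E].
  by apply: open_nbhs_nbhs; split; [exact: open_ereal_lt_ereal|rewrite /= lte01].
have := cv _ lt1; rewrite /= /nbhs /= /within /= => /nbhs_ballP[d /= d0 hd].
pose d' := Num.min d (e / (K + M + 1)).
have KM : 0 < K + M + 1 by lra.
exists d' => [|s sT std]; first by rewrite lt_min d0 divr_gt0.
have [->|st] := eqVneq s t; first by apply: aeW => x; rewrite subrr normr0 ltW.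
move: std; rewrite lt_min => /andP[std ste].
have hlt : (sobolev_norm k (fun x => (f s x - f t x) / (s - t) - f' t x)%R < 1)%E.
  have sb : ball t d s by rewrite /ball/= distrC.
  have sD : `[0, T]%classic s by rewrite /= in_itv.
  exact: (hd s sb st sD).
have [sfs _ _ _] := hf s sT.
have := HK (fun x => (f s x - f t x) / (s - t) - f' t x) 1; move/(_ _ (ltW hlt)).
have ex r : (size r <= k)%N -> exists g, weak_derivative r
    (fun x => (f s x - f t x) / (s - t) - f' t x) g.
  move=> rk; have [g1 w1 _] := sfs r rk; have [g2 w2 _] := sft r rk; have [g3 w3 _] := sft' r rk.
  have := weak_derivativeB (weak_derivativeZ (s - t)^-1 (weak_derivativeB w1 w2)) w3.
  set u := (fun x => _ : R); set v := (fun x => _) => w; exists v.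
  suff -> : (fun x => (f s x - f t x) / (s - t) - f' t x) = u by [].
  by apply/funext => x; rewrite /u mulrC.
move=> /(_ ex) hh; apply: aeS2 hh hM => x h1 h2.
have st0 : s - t != 0 by rewrite subr_eq0.
rewrite (_ : f s x - f t x = (s - t) * (((f s x - f t x) / (s - t) - f' t x) + f' t x)); last first.
  by rewrite subrK mulrC divfK.
rewrite normrM; apply: (@le_trans _ _ (`|s - t| * (K + M + 1))).
  rewrite ler_wpM2l//; apply: (le_trans (ler_normD _ _)).
  by rewrite mulr1 in h1; lra.
by rewrite -ler_pdivlMr// ltW.
Qed.

End time_continuity.

(** * Continuity in time and finite speed of propagation *)

Section Linf_continuity.
Context {R : realType} {n : nat}.
Notation "'leb'" := (@lebesgue_rV R n).

Lemma Rintegral_sum d (S : measurableType d) (mu : {measure set S -> \bar R})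
    (I : Type) (r : seq I) (f : I -> S -> R) :
  (forall i, mu.-integrable setT (EFin \o f i)) ->
  mu.-integrable setT (EFin \o (fun x => \sum_(i <- r) f i x)) /\
  \int[mu]_x (\sum_(i <- r) f i x) = \sum_(i <- r) \int[mu]_x f i x.
Proof.
move=> fi; elim: r => [|i r [IH1 IH2]].
  rewrite (_ : (fun x => \sum_(i <- [::]) f i x) = cst 0); last first.
    by apply/funext => x; rewrite big_nil.
  rewrite big_nil; split; [exact: integrable0|by rewrite /Rintegral/= integral0].
rewrite (_ : (fun x => \sum_(j <- i :: r) f j x) =
    (fun x => f i x + \sum_(j <- r) f j x)); last first.
  by apply/funext => x; rewrite big_cons.
rewrite big_cons RintegralD// IH2; split => //.
exact: (integrableD measurableT (fi i) IH1).
Qed.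

(** Continuity with values in L^oo, stated together with measurability and boundedness at each time
    so that it passes to products and to integrals against bounded weights supported in a box. *)
Definition Linf_continuous (T : R) (q : R -> 'rV[R]_n -> R) :=
  forall t, 0 <= t <= T ->
    (measurable_fun setT (q t) /\ exists M : R, \forall x \ae leb, `|q t x| <= M) /\
    forall e : R, 0 < e -> exists2 d : R, 0 < d & forall s, 0 <= s <= T -> `|s - t| < d ->
      \forall x \ae leb, `|q s x - q t x| <= e.

Lemma sobolev_loc_integrable k (f : 'rV[R]_n -> R) : sobolev k f -> loc_integrable f.
Proof. by move=> /(_ [::] isT)[g []]. Qed.

Lemma C1_sobolev_Linf k T (f : R -> 'rV[R]_n -> R) : (n < 2 * k)%N ->
  C1_sobolev k T f -> Linf_continuous T f.
Proof.
move=> nk Cf t tT; split; [split|].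
- have [f' hf] := Cf; have [/sobolev_loc_integrable[]] := hf t tT; by [].
- by have [M _ hM] := C1_sobolev_bounded nk Cf tT; exists M.
- by move=> e e0; exact: C1_sobolev_continuous nk Cf tT e0.
Qed.

Lemma Linf_continuousM T (q r : R -> 'rV[R]_n -> R) : Linf_continuous T q ->
  Linf_continuous T r -> Linf_continuous T (fun t x => q t x * r t x).
Proof.
move=> cq cr t tT; have [[mq [M qM]] cqt] := cq t tT; have [[mr [N rN]] crt] := cr t tT.
split; first split; first exact: measurable_funM.
  exists (M * N); apply: aeS2 qM rN => x qM rN.
  by rewrite normrM ler_pM.
move=> e e0; pose A := `|M| + `|N| + 1.
have A1 : 1 <= A by rewrite lerDr addr_ge0.
pose e' := Num.min 1 (e / A / 2).
have A0 : 0 < A by rewrite (lt_le_trans _ A1).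
have e'0 : 0 < e' by rewrite lt_min ltr01 !divr_gt0.
have [d1 d10 h1] := cqt e' e'0; have [d2 d20 h2] := crt e' e'0.
exists (Num.min d1 d2) => [|s sT]; first by rewrite lt_min d10.
rewrite lt_min => /andP[/(h1 _ sT) k1 /(h2 _ sT) k2].
have k3 := aeS2 (fun x a b => conj a b) k1 k2.
have k4 := aeS2 (fun x a b => conj a b) qM rN.
apply: aeS2 k3 k4 => x [l1 l2] [l3 l4].
have rs : `|r s x| <= A.
  rewrite -[r s x](subrK (r t x)) (le_trans (ler_normD _ _))// /A.
  have : e' <= 1 by rewrite ge_min lexx.
  have := ler_norm N; have := normr_ge0 M; lra.
have qt : `|q t x| <= A.
  by apply: (le_trans l3); rewrite /A; have := ler_norm M; have := normr_ge0 N; lra.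
rewrite (_ : _ - _ = (q s x - q t x) * r s x + q t x * (r s x - r t x)); last by ring.
apply: (le_trans (ler_normD _ _)); rewrite !normrM.
have eA : e' * A <= e / 2.
  by rewrite -ler_pdivlMr// mulrAC ge_min lexx orbT.
have g1 : `|q s x - q t x| * `|r s x| <= e' * A by rewrite ler_pM.
have g2 : `|q t x| * `|r s x - r t x| <= A * e' by rewrite ler_pM.
by rewrite mulrC in g2; lra.
Qed.

Lemma integrable_Linf_box (q phi : 'rV[R]_n -> R) (M S : R) a b : measurable_fun setT q ->
  measurable_fun setT phi -> (\forall x \ae leb, `|q x| <= M) -> (forall x, `|phi x| <= S) ->
  (forall x, ~ box a b x -> phi x = 0) -> (forall l, a l <= b l) ->
  leb.-integrable setT (EFin \o (fun x => q x * phi x)) /\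
  `|\int[leb]_x (q x * phi x)| <= M * S * \prod_l (b l - a l).
Proof.
move=> mq mphi qM phiS phi0 ab.
have i1 := integrable_indic_box a b.
have h x : `|q x| <= M -> `|q x * phi x| <= M * S * \1_(box a b) x.
  move=> qxM; rewrite normrM indicE; have [_|/negP xb] := boolP (x \in box a b).
    by rewrite mulr1 ler_pM.
  by rewrite phi0 ?normr0 ?mulr0// => hb; apply: xb; rewrite inE.
have iq : leb.-integrable setT (EFin \o (fun x => q x * phi x)).
  apply: (@integrable_ae_bounded _ _ _ _ _ _ (M * S) _ i1); first exact: measurable_funM.
  apply: aeS qM => x /h hx; apply: (le_trans hx).
  by rewrite ger0_norm// indicE.
split => //; apply: (le_trans (le_normr_Rintegral _ iq)) => //.
rewrite -(Rintegral_indic_box ab) -RintegralZl//.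
apply: le_ae_Rintegral; [exact: integrable_norm| |exact: aeS h qM].
exact: (integrableZl measurableT (M * S) i1).
Qed.

Lemma Linf_integral_continuous T (q : R -> 'rV[R]_n -> R) (phi : 'rV[R]_n -> R) (S : R) a b :
  Linf_continuous T q -> measurable_fun setT phi -> (forall x, `|phi x| <= S) ->
  (forall x, ~ box a b x -> phi x = 0) -> (forall l, a l <= b l) ->
  {within `[0, T], continuous (fun t => \int[leb]_x (q t x * phi x))}.
Proof.
move=> cq mphi phiS phi0 ab; apply/subspace_continuousP => t; rewrite /= in_itv/= => tT.
have [[mqt [M qM]] cqt] := cq t tT.
pose C := S * \prod_l (b l - a l).
have P0 : 0 <= \prod_l (b l - a l) by apply: prodr_ge0 => l _; rewrite subr_ge0.
have C0 : 0 <= C by rewrite mulr_ge0// (le_trans (normr_ge0 _) (phiS 0)).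
apply/cvgrPdist_le => e e0.
have e'0 : 0 < e / (C + 1) by rewrite divr_gt0// ltr_wpDl.
have [d d0 hd] := cqt _ e'0.
rewrite near_withinE; apply/nbhs_ballP; exists d => //= s; rewrite /ball/= distrC => std.
rewrite in_itv/= => sT; have [[mqs [N qN]] _] := cq s sT.
have [is_ _] := integrable_Linf_box mqs mphi qN phiS phi0 ab.
have [it_ _] := integrable_Linf_box mqt mphi qM phiS phi0 ab.
rewrite distrC -RintegralB//.
have md : measurable_fun setT (fun x => q s x - q t x) by exact: measurable_funB.
have [_ hb] := integrable_Linf_box md mphi (hd s sT std) phiS phi0 ab.
under eq_Rintegral do rewrite -mulrBl.
apply: (le_trans hb); rewrite -mulrA -/C mulrAC ler_pdivrMr ?ltr_wpDl//.
by rewrite ler_wpM2l ?(ltW e0)// lerDl.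
Qed.

End Linf_continuity.

(** * Propagation of vacuum by the mass equation *)

Section finite_speed.
Context {R : realType} {n : nat}.
Notation "'leb'" := (@lebesgue_rV R n).

Lemma tensorX (b : 'I_n -> R -> R) m x :
  tensor (fun l y => b l y ^+ m) x = tensor b x ^+ m.
Proof. by rewrite /tensor -prodrXl. Qed.

Lemma partial_tensorX (b : 'I_n -> R -> R) m j x : (forall l, smooth1 (b l)) ->
  partial j (tensor (fun l y => b l y ^+ m.+1)) x =
  m.+1%:R * tensor b x ^+ m * partial j (tensor b) x.
Proof.
move=> sb.
have -> : tensor (fun l y => b l y ^+ m.+1) = tensor b ^+ m.+1.
  by apply/funext => y; rewrite tensorX exprfctE.
have [d e] := tensor_is_derive x (sb j).
by rewrite /partial deriveX.
Qed.

Lemma tensor_partial_out (b : 'I_n -> R -> R) (lo hi : 'I_n -> R) s x :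
  (forall l, smooth1 (b l)) -> (forall l y, b l y != 0 -> lo l <= y <= hi l) ->
  ~ box (fun l => lo l - 1) hi x -> partials s (tensor b) x = 0.
Proof.
move=> sb bsupp xK.
have cK : compact [set v : 'rV[R]_n | forall i, `[lo i, hi i]%classic (v ord0 i)].
  by apply: (@rV_compact R n (fun i => `[lo i, hi i]%classic)) => i; exact: segment_compact.
apply: (@partials_out _ _ _ _ [set v : 'rV[R]_n | forall i, `[lo i, hi i]%classic (v ord0 i)]).
- by apply: compact_closed => //; exact: norm_hausdorff.
- move=> y /existsNP[l]; rewrite /= in_itv/= => h; rewrite (tensorD1 _ l).
  have [->|/bsupp//] := eqVneq (b l (y 0 l)) 0; by rewrite mul0r.
- move=> h; apply: xK => l; have := h l; rewrite /= !in_itv/= => /andP[h1 ->].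
  by rewrite andbT; lra.
Qed.

Lemma smooth1_bounded (f : R -> R) (a c : R) : smooth1 f ->
  (forall y, f y != 0 -> a <= y <= c) -> exists C, forall y, `|f y| <= C.
Proof.
move=> sf fac; have [ca|ac] := ltP c a.
  exists 0 => y; have [->|/fac] := eqVneq (f y) 0; first by rewrite normr0.
  by move=> /andP[h1 h2]; have := le_lt_trans (le_trans h1 h2) ca; rewrite ltxx.
have cn : {within `[a, c], continuous (fun z => `|f z|)}.
  by apply: continuous_subspaceT => z; apply: cvg_norm; exact: smooth1_continuous.
have [z _ hz'] := EVT_max ac cn.
have hz t : a <= t <= c -> `|f t| <= `|f z| by move=> ht; apply: hz'; rewrite in_itv.
exists `|f z| => y; have [->|/fac h] := eqVneq (f y) 0; first by rewrite normr0.
exact: hz.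
Qed.

Variables (T : R) (rho : R -> 'rV[R]_n -> R) (u : R -> 'rV[R]_n -> 'rV[R]_n).
Hypothesis crho : Linf_continuous T rho.
Hypothesis rho_ge0 : forall t, 0 <= t <= T -> \forall x \ae leb, 0 <= rho t x.
Hypothesis mass_eq : balance_law T rho (fun t x => rho t x *: u t x) (fun _ _ => 0).

(* With [y_m s = \int rho(s) beta^m], the mass equation gives
   [y_m' <= m B y_(m-1)], hence [y_m s <= Y (B (s - t0))^m]; for
   [B (s - t0) < 1] this tends to [0]. *)
Lemma vacuum_propagation (b : 'I_n -> R -> R) (lo hi : 'I_n -> R) (t0 t1 B N : R) :
  (forall l, smooth1 (b l)) -> (forall l y, 0 <= b l y <= 1) ->
  (forall l y, b l y != 0 -> lo l <= y <= hi l) -> (forall l, lo l <= hi l) ->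
  0 <= t0 -> t1 <= T -> 0 <= B -> B * (t1 - t0) < 1 ->
  (forall s, t0 <= s <= t1 -> \forall x \ae leb, rho s x <= N) ->
  (\forall x \ae leb, rho t0 x * tensor b x = 0) ->
  (forall s, t0 < s < t1 -> \forall x \ae leb,
    `|rho s x * \sum_j u s x 0 j * partial j (tensor b) x| <= B * rho s x) ->
  forall s, t0 <= s <= t1 -> \forall x \ae leb, tensor b x = 1 -> rho s x = 0.
Proof.
move=> sb b01 bsupp lohi t00 t1T B0 Bt1 rhoN vac speed.
set beta := tensor b in vac speed *.
have beta01 x : 0 <= beta x <= 1.
  rewrite /beta /tensor prodr_ge0/=; last by move=> l _; have /andP[] := b01 l (x 0 l).
  by apply: prodr_ile1 => l _; exact: b01.
pose K := box (fun l => lo l - 1) hi.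
have lohi' l : lo l - 1 <= hi l by have := lohi l; lra.
have betaK x : ~ K x -> beta x = 0 by move=> xK; exact: (@tensor_partial_out b lo hi [::]).
have mbeta : measurable_fun setT beta.
  by apply: measurable_tensor => l; exact: measurable_smooth1.
have mK : measurable K by exact: measurable_box.
(* The indicator matters for [m = 0] alone, where the weight 1 would not have bounded support; for
   positive [m] it leaves [beta x ^+ m] unchanged. *)
pose w m x := beta x ^+ m * \1_K x.
have mw m : measurable_fun setT (w m).
  by apply: measurable_funM; [exact: measurable_funX|exact: measurable_indic].
have w1 m x : `|w m x| <= 1.
  have /andP[h0 h1] := beta01 x.
  rewrite normrM normrX ger0_norm// indicE.
  case: (_ \in _); rewrite ?normr1 ?normr0 ?mulr1 ?mulr0 ?ler01//.
  by rewrite exprn_ile1.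
have wK m x : ~ K x -> w m x = 0 by move=> xK; rewrite /w indicE memNset ?mulr0.
have tT s : t0 <= s <= t1 -> 0 <= s <= T.
  by move=> /andP[h1 h2]; rewrite (le_trans t00 h1) (le_trans h2 t1T).
have rhoN' s : t0 <= s <= t1 -> \forall x \ae leb, `|rho s x| <= N.
  move=> st; apply: aeS2 (rho_ge0 (tT _ st)) (rhoN s st) => x h0 h1.
  by rewrite ger0_norm.
have irho s m : t0 <= s <= t1 -> leb.-integrable setT (EFin \o (fun x => rho s x * w m x)).
  move=> st; have [[mr _] _] := crho (tT _ st).
  by have [] := integrable_Linf_box mr (mw m) (rhoN' s st) (w1 m) (wK m) lohi'.
pose Y := N * 1 * \prod_l (hi l - (lo l - 1)).
have key m s : t0 <= s <= t1 -> \int[leb]_x (rho s x * w m x) <= Y * (B * (s - t0)) ^+ m.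
  elim: m s => [|m IHm] s st.
    have [[mr _] _] := crho (tT _ st).
    have [_] := integrable_Linf_box mr (mw 0) (rhoN' s st) (w1 0) (wK 0) lohi'.
    by rewrite expr0 mulr1; apply: le_trans; exact: ler_norm.
  pose bm l (y : R) := b l y ^+ m.+1.
  have sbm l : smooth1 (bm l) by apply: smooth1X.
  have bmsupp l y : bm l y != 0 -> lo l <= y <= hi l.
    by rewrite /bm expf_eq0/= => /bsupp.
  have tphi : test_function (tensor bm) by exact: tensor_test_function bmsupp.
  have phiE x : tensor bm x = w m.+1 x.
    rewrite tensorX /w indicE; have [_|/negP xK] := boolP (x \in K); first by rewrite mulr1.
    by rewrite mulr0 -/beta betaK ?expr0n// => h; apply: xK; rewrite inE.
  pose F r := \int[leb]_x (rho r x * tensor bm x).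
  (* The subtracted power is the exact solution, zero at [t0], of the equation driven by the bound
     for [m]. Hence [z] is nonincreasing and starts from 0. *)
  pose z r := F r - Y * (B * (r - t0)) ^+ m.+1.
  have FE r : F r = \int[leb]_x (rho r x * w m.+1 x).
    by apply: eq_Rintegral => x _; rewrite phiE.
  have F0 : F t0 = 0.
    rewrite /F (@Rintegral_ae_eq _ _ _ _ _ (fun=> 0)) /Rintegral ?integral0//.
      have t0t0 : t0 <= t0 <= t1 by have /andP[h1 h2] := st; rewrite lexx (le_trans h1 h2).
      have [[mr _] _] := crho (tT _ t0t0).
      apply: measurable_funM => //; apply: measurable_tensor => l.
      exact: measurable_smooth1.
    by apply: aeS vac => x; rewrite tensorX exprS mulrA -/beta => ->; rewrite mul0r.
  have [t0s|ts0] := ltP t0 s; last first.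
    have -> : s = t0 by apply/eqP; rewrite eq_le ts0; have /andP[] := st.
    by rewrite subrr mulr0 expr0n mulr0 -FE F0.
  have dpoly r : is_derive r (1 : R) (fun r => Y * (B * (r - t0)) ^+ m.+1)
      (m.+1%:R * B * (Y * (B * (r - t0)) ^+ m)).
    have dX (y : R) : is_derive y (1 : R) (fun y : R => Y * y ^+ m.+1) (Y * (m.+1%:R * y ^+ m)).
      have -> : (fun y : R => Y * y ^+ m.+1) = Y \*: ((id : R -> R) ^+ m.+1).
        by apply/funext => v; rewrite exprfctE.
      by apply: is_derive_eq; rewrite [_ *: 1]mulr1.
    have := is_derive_affine (dX (B * r + - (B * t0))).
    rewrite (_ : (fun y => Y * (B * y + - (B * t0)) ^+ m.+1) = (fun r => Y * (B * (r - t0)) ^+ m.+1)).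
      by rewrite (_ : B * _ = m.+1%:R * B * (Y * (B * (r - t0)) ^+ m))//; rewrite mulrBr; ring.
    by apply/funext => y; rewrite mulrBr.
  have dF r : t0 < r < s -> exists2 D, is_derive r (1 : R) F D &
      D <= m.+1%:R * B * (Y * (B * (r - t0)) ^+ m).
    move=> /andP[t0r rs].
    have rt1 : r < t1 by have /andP[_] := st; exact: lt_le_trans.
    have r0T : 0 < r < T by rewrite (le_lt_trans t00 t0r) (lt_le_trans rt1 t1T).
    have rt : t0 <= r <= t1 by rewrite !ltW.
    have [lr lru l0 /(_ _ tphi) dr] := mass_eq r0T.
    eexists; first exact: dr.
    have i1 j : leb.-integrable setT
        (EFin \o (fun x => (rho r x *: u r x) 0 j * partial j (tensor bm) x)).
      exact: (integrable_test [:: j] (lru j) tphi).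
    have [i2 <-] := Rintegral_sum (index_enum 'I_n) i1.
    rewrite [X in _ + X](_ : _ = 0) ?addr0; last first.
      by under eq_Rintegral do rewrite mul0r; rewrite /Rintegral integral0.
    have i3 := integrableZl measurableT (m.+1%:R * B) (irho r m rt).
    apply: (@le_trans _ _ (\int[leb]_x (m.+1%:R * B * (rho r x * w m x)))); last first.
      rewrite RintegralZl//; last exact: irho.
      by rewrite ler_wpM2l ?mulr_ge0// IHm.
    apply: le_ae_Rintegral => //.
    have rt' : t0 < r < t1 by rewrite t0r.
    apply: aeS2 (speed r rt') (rho_ge0 (tT _ rt)) => x sp rx0.
    have -> : \sum_(j <- index_enum 'I_n) (rho r x *: u r x) 0 j * partial j (tensor bm) x =
       m.+1%:R * beta x ^+ m * (rho r x * \sum_j u r x 0 j * partial j beta x).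
      rewrite mulr_sumr mulr_sumr; apply: eq_bigr => j _.
      by rewrite /bm partial_tensorX// mxE -/beta; ring.
    have /andP[bx0 _] := beta01 x.
    have [xK|/negP xK] := boolP (x \in K).
      rewrite /w indicE xK mulr1 (_ : m.+1%:R * B * _ = m.+1%:R * beta x ^+ m * (B * rho r x)); last by ring.
      rewrite ler_wpM2l ?mulr_ge0 ?exprn_ge0//.
      by apply: le_trans sp; exact: ler_norm.
    rewrite big1 ?mulr0 ?mulr0; last first.
      have xK' : ~ K x by move=> h; apply: xK; rewrite inE.
      move=> j _; have := @tensor_partial_out b lo hi [:: j] x sb bsupp xK'.
      by rewrite /= -/beta => ->; rewrite mulr0.
    have wx0 : 0 <= w m x by apply: mulr_ge0; [exact: exprn_ge0|rewrite indicE].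
    by apply: mulr_ge0; exact: mulr_ge0.
  have cF : {within `[0, T], continuous F}.
    rewrite (_ : F = fun r => \int[leb]_x (rho r x * w m.+1 x)); last exact/funext.
    exact: (Linf_integral_continuous crho (mw _) (w1 _) (wK _) lohi').
  have cz : {within `[t0, s], continuous z}.
    have sub : `[t0, s]%classic `<=` `[0, T]%classic.
      move=> r; rewrite /= !in_itv/= => /andP[h1 h2].
      have /andP[_ h3] := tT _ st.
      by rewrite (le_trans t00 h1) (le_trans h2 h3).
    have cF' := continuous_subspaceW sub cF.
    have cp : {within `[t0, s], continuous (fun r => Y * (B * (r - t0)) ^+ m.+1)}.
      apply: continuous_subspaceT => q.
      by apply/differentiable_continuous/derivable1_diffP; have [] := dpoly q.
    by move=> r; apply: cvgB; [exact: cF'|exact: cp].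
  have dz r : t0 < r < s -> exists2 D, is_derive r (1 : R) z D & D <= 0.
    move=> hr; have [D dD leD] := dF r hr.
    exists (D - m.+1%:R * B * (Y * (B * (r - t0)) ^+ m)); last by rewrite subr_le0.
    exact: (is_deriveB dD (dpoly r)).
  have dz1 r : r \in `]t0, s[%R -> derivable z r 1.
    by rewrite in_itv/= => /dz[D [dD _] _].
  have dz0 r : r \in `]t0, s[%R -> derive1 z r <= 0.
    by rewrite in_itv/= derive1E => /dz[D [_ ->]].
  have := ler0_derive1_le_cc dz1 dz0 cz.
  move=> /(_ s t0); rewrite !in_itv/= !lexx (ltW t0s) => /(_ isT isT isT) zs.
  rewrite -FE -subr_le0; apply: (le_trans zs).
  rewrite /z subrr mulr0 expr0n/= mulr0 subr0 F0//.
move=> s st; have ts := tT _ st; have [[mr _] _] := crho ts.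
pose A := [set x | 1 <= beta x].
have mA : measurable A.
  have := mbeta measurableT _ (measurable_itv `[(1 : R), +oo[%R).
  by rewrite setTI; congr measurable; apply/seteqP; split => x; rewrite /= in_itv/= andbT.
have A1 x : `|\1_A x| <= 1 :> R by rewrite indicE; case: (_ \in _); rewrite ?normr1 ?normr0.
have AK x : ~ K x -> \1_A x = 0 :> R.
  by move=> xK; rewrite indicE memNset// /A/= betaK// => /(lt_le_trans ltr01); rewrite ltxx.
have [iA _] := integrable_Linf_box mr (measurable_indic mA) (rhoN' s st) A1 AK lohi'.
(* On [A] the weight is 1 for every [m], so the mass in [A] lies below all these bounds at once. *)
have le0 m : \int[leb]_x (rho s x * \1_A x) <= Y * (B * (s - t0)) ^+ m.
  apply: le_trans (key m s st); apply: le_ae_Rintegral => //; first exact: irho.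
  apply: aeS (rho_ge0 ts) => x rx0; rewrite ler_wpM2l//.
  have [/set_mem xA|/negP xA] := boolP (x \in A); last first.
    have /andP[b0 _] := beta01 x.
    by rewrite indicE (negbTE (introN idP xA)) /w mulr_ge0// exprn_ge0.
  rewrite indicE mem_set// /w indicE mem_set ?mulr1; first exact: exprn_ege1.
  by apply: contrapT => /betaK b0; move: xA; rewrite /A/= b0 ler10.
have r01 : `|B * (s - t0)| < 1.
  move: st => /andP[h1 h2]; rewrite ger0_norm ?mulr_ge0 ?subr_ge0//.
  by apply: le_lt_trans Bt1; rewrite ler_wpM2l// lerD2r.
have I0 : \int[leb]_x (rho s x * \1_A x) <= 0.
  have cv : Y * (B * (s - t0)) ^+ m @[m --> \oo] --> Y * 0.
    by apply: cvgM; [exact: cvg_cst|exact: cvg_expr].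
  rewrite -(mulr0 Y); apply: (cvgr_to_ge cv).
  by apply: nearW => m; exact: le0.
have rA0 : \forall x \ae leb, 0 <= rho s x * \1_A x.
  by apply: aeS (rho_ge0 ts) => x rx0; rewrite mulr_ge0// indicE.
have Ie : \int[leb]_x (rho s x * \1_A x) = 0.
  apply/eqP; rewrite eq_le I0/=; apply: Rintegral_ae_ge0 rA0.
  exact: measurable_funM mr (measurable_indic mA).
apply: aeS (Rintegral_eq0_ae iA rA0 Ie) => x h bx.
by move: h; rewrite indicE mem_set ?mulr1// /A/= bx.
Qed.

End finite_speed.

(** * Speed of a vacuum front *)

Section half_space.
Context {R : realType}.

(** [C] bounds the derivative of one fixed step and is uniform in the position and in the two
    widths. These are independent because a front needs a transition of prescribed width on one
    side, while all other sides may be as flat as desired. The sign [sg] reflects the line. *)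
Lemma bump_exists : exists2 C : R, 0 <= C & forall sg p q1 r q2 : R, sg = 1 \/ sg = -1 ->
  0 < q1 -> 0 < q2 -> exists b : R -> R,
  [/\ smooth1 b, forall y, 0 <= b y <= 1, forall y, sg * y <= p \/ r <= sg * y -> b y = 0,
   forall y, p + q1 <= sg * y <= r - q2 -> b y = 1 &
   forall y, `|derive1 b y| <= C / q1 + C / q2].
Proof.
have [S [sS S0 S1 S01]] := @smooth_step_exists R.
have [C C0 hC] := smooth_step_derive_bounded sS S0 S1.
exists C => // sg p q1 r q2 hsg q10 q20.
have sg1 : `|sg| = 1 by case: hsg => ->; rewrite ?normrN normr1.
pose f1 y := S (sg / q1 * y + - (p / q1)); pose f2 y := S (- (sg / q2) * y + r / q2).
have s1 : smooth1 f1 by exact: smooth1_affine.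
have s2 : smooth1 f2 by exact: smooth1_affine.
have E1 y : sg / q1 * y + - (p / q1) = (sg * y - p) / q1 by rewrite mulrBl mulrAC.
have E2 y : - (sg / q2) * y + r / q2 = (r - sg * y) / q2 by rewrite mulrBl mulNr mulrAC addrC.
have f101 y : 0 <= f1 y <= 1 by exact: S01.
have f201 y : 0 <= f2 y <= 1 by exact: S01.
have d1 y : `|derive1 f1 y| <= C / q1.
  rewrite /f1 derive1_affine// normrM normf_div sg1 (gtr0_norm q10) mul1r mulrC.
  by rewrite ler_wpM2r// invr_ge0 ltW.
have d2 y : `|derive1 f2 y| <= C / q2.
  rewrite /f2 derive1_affine// normrM normrN normf_div sg1 (gtr0_norm q20) mul1r mulrC.
  by rewrite ler_wpM2r// invr_ge0 ltW.
exists (fun y => f1 y * f2 y); split.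
- exact: smooth1M.
- move=> y; have /andP[a1 a2] := f101 y; have /andP[a3 a4] := f201 y.
  by rewrite mulr_ge0//= mulr_ile1.
- move=> y [h|h].
    by rewrite /f1 E1 S0 ?mul0r// mulr_le0_ge0 ?invr_ge0 ?(ltW q10)// subr_le0.
  by rewrite /f2 E2 [X in _ * X]S0 ?mulr0// mulr_le0_ge0 ?invr_ge0 ?(ltW q20)// subr_le0.
- move=> y /andP[h1 h2]; rewrite /f1 /f2 E1 E2 !S1 ?mulr1// ler_pdivlMr// mul1r; lra.
- move=> y; have D1 := smooth1_is_derive s1 y; have D2 := smooth1_is_derive s2 y.
  have D := @is_deriveM _ _ f1 f2 y 1 _ _ D1 D2.
  rewrite derive1E.
  have -> : (fun y => f1 y * f2 y) = f1 * f2 by [].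
  have [_ ->] := D; apply: (le_trans (ler_normD _ _)).
  have /andP[a1 a2] := f101 y; have /andP[a3 a4] := f201 y.
  rewrite addrC; apply: lerD; rewrite normrM.
    by rewrite -[leRHS]mul1r ler_pM// ger0_norm.
  by rewrite -[leRHS]mul1r ler_pM// ger0_norm.
Qed.

Lemma smooth1_derive0 (f : R -> R) (sg p y : R) : sg = 1 \/ sg = -1 ->
  (forall z, sg * z <= p -> f z = 0) -> sg * y < p -> derive1 f y = 0.
Proof.
move=> hsg f0 yp; rewrite derive1E.
suff D : is_derive y (1 : R) f 0 by have [_ ->] := D.
apply: (@near_eq_is_derive _ _ _ (cst 0)).
suff h : \forall z \near y, sg * z < p by apply: filterS h => z /ltW /f0.
move: yp; case: hsg => ->; rewrite ?mul1r ?mulN1r => yp; near=> z.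
  by rewrite mul1r; near: z; exact: lt_nbhsl.
by rewrite mulN1r ltrNl; near: z; apply: lt_nbhsr; rewrite ltrNl.
Unshelve. all: by end_near. Qed.

Context {n : nat}.
Notation "'leb'" := (@lebesgue_rV R n).
Variables (T : R) (rho : R -> 'rV[R]_n -> R) (u : R -> 'rV[R]_n -> 'rV[R]_n).
Hypothesis crho : Linf_continuous T rho.
Hypothesis rho_ge0 : forall t, 0 <= t <= T -> \forall x \ae leb, 0 <= rho t x.
Hypothesis mass_eq : balance_law T rho (fun t x => rho t x *: u t x) (fun _ _ => 0).

Definition vacuum_beyond (i : 'I_n) (sg a t : R) :=
  {ae leb, forall x : 'rV[R]_n, a < sg * x 0 i -> rho t x = 0}.

(** The cutoff rises in the direction [i] within a width [w2] just below [w] and has all its other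
    transitions spread over a huge width [q]. The gas then crosses it at a rate of about
    [C * e / w2]: the normal velocity [e] meets the steep side, while the bound [M] on the full
    velocity meets only slopes of order [C / q]. Thus [C] is independent of [M]. *)
Lemma vacuum_beyond_propagation : exists2 C : R, 0 <= C &
  forall (i : 'I_n) (sg a w e M N t0 t1 : R), sg = 1 \/ sg = -1 ->
  0 <= t0 -> t0 <= t1 -> t1 <= T -> 0 <= e -> 0 <= M -> C * e * (t1 - t0) < w ->
  (forall s, t0 <= s <= t1 -> \forall x \ae leb, rho s x <= N) ->
  (forall s, t0 <= s <= t1 -> \forall x \ae leb, forall j, `|u s x 0 j| <= M) ->
  (forall s, t0 <= s <= t1 -> {ae leb, forall x : 'rV[R]_n, a < sg * x 0 i -> `|u s x 0 i| <= e}) ->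
  vacuum_beyond i sg a t0 -> forall s, t0 <= s <= t1 -> vacuum_beyond i sg (a + w) s.
Proof.
have [C C0 bumps] := bump_exists; exists C => // i sg a w e M N t0 t1 hsg t00 t01 t1T e0 M0 Cw
  rhoN uM ue vac s st.
pose tau := t1 - t0; have tau0 : 0 <= tau by rewrite subr_ge0.
(* The slack in [C * e * tau < w] is halved: the cutoff starts at distance [w1] beyond the vacuum
   boundary and still has the width [w2 > C * e * tau] in which to rise. *)
pose w1 := (w - C * e * tau) / 2; pose w2 := w - w1.
have w10 : 0 < w1 by rewrite divr_gt0// subr_gt0.
have Cw2 : C * e * tau < w2 by rewrite /w2 /w1 /tau; lra.
have Ce0 : 0 <= C * e by exact: mulr_ge0.
have w20 : 0 < w2 by apply: le_lt_trans Cw2; exact: mulr_ge0.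
pose Q := C * e + n%:R * (M * (C + C)).
have CC0 : 0 <= C + C by rewrite addr_ge0.
have Q0 : 0 <= Q by apply: addr_ge0; [exact: mulr_ge0|apply: mulr_ge0 => //; exact: mulr_ge0].
pose g := 1 - C * e * tau / w2.
have g0 : 0 < g by rewrite subr_gt0 ltr_pdivrMr// mul1r.
(* [g] is what the steep side leaves of the total budget 1 for [B * (t1 - t0)]; [q] is chosen so
   large that the flat sides fit into it. *)
pose q := Q * tau / g + 1.
have q0 : 0 < q by rewrite ltr_wpDl//; apply: divr_ge0; [exact: mulr_ge0|exact: ltW].
have Qq : Q * tau / q < g.
  have gq : g * q = Q * tau + g.
    by rewrite [LHS]mulrDr mulr1 [g * _]mulrC divfK ?gt_eqF.
  by rewrite ltr_pdivrMr// gq ltrDl.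
pose B := C * e / w2 + Q / q.
have B0 : 0 <= B.
  by apply: addr_ge0; apply: divr_ge0 => //; exact: ltW.
have Bt : B * (t1 - t0) < 1.
  rewrite -/tau /B mulrDl [C * e / w2 * _]mulrAC [Q / q * _]mulrAC.
  by move: Qq; rewrite /g; lra.
suff region (m : nat) : {ae leb, forall x : 'rV[R]_n, (a + w <= sg * x 0 i) /\
    (forall j, `|x 0 j| <= m%:R) -> rho s x = 0}.
  have := ae_foralln region; apply: aeS => x h ax.
  pose m := Num.bound (\sum_l `|x 0 l|).
  apply: (h m); split => [|j]; first exact: ltW.
  rewrite ltW//; apply: le_lt_trans (archi_boundP _); last by apply: sumr_ge0.
  by rewrite (bigD1 j)//= lerDl; apply: sumr_ge0.
(* The plateau in the direction [i] begins exactly at [a + w1 + w2 = a + w]; at the other ends it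
   contains the cube of size [m], with room [q] for the decay. *)
pose p l := if l == i then a + w1 else - m%:R - q.
pose r l := if l == i then `|a| + `|w| + m%:R + q else m%:R + q.
pose q1 l := if l == i then w2 else q.
have q10 l : 0 < q1 l by rewrite /q1; case: ifP.
have /choice[b hb] := fun l => bumps sg (p l) (q1 l) (r l) q hsg (q10 l) q0.
have m0 : 0 <= m%:R :> R by [].
pose A l := `|p l| + `|r l|.
have sb l : smooth1 (b l) by have [] := hb l.
have b01 l y : 0 <= b l y <= 1 by have [_ h _ _ _] := hb l.
have bsupp l y : b l y != 0 -> - A l <= y <= A l.
  have [_ _ h _ _] := hb l; move=> by0.
  have h1 : p l < sg * y by rewrite ltNge; apply: contraNN by0 => hh; rewrite h//; left.
  have h2 : sg * y < r l by rewrite ltNge; apply: contraNN by0 => hh; rewrite h//; right.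
  have k1 := ler_norm (r l); have k2 := ler_norm (- p l); rewrite normrN in k2.
  have k3 := normr_ge0 (p l); have k4 := normr_ge0 (r l).
  by case: hsg => e1; rewrite e1 ?mul1r ?mulN1r in h1 h2; apply/andP; rewrite /A; split; lra.
have A0 l : - A l <= A l by rewrite ge0_cp// addr_ge0.
have vac' : \forall x \ae leb, rho t0 x * tensor b x = 0.
  apply: aeS vac => x h; have [/h ->|xa] := ltP a (sg * x 0 i); first by rewrite mul0r.
  have [_ _ h0 _ _] := hb i.
  rewrite (tensorD1 _ i) h0 ?mul0r ?mulr0//; left; rewrite /p eqxx.
  by rewrite (le_trans xa)// lerDl ltW.
have speed r' : t0 < r' < t1 -> \forall x \ae leb,
    `|rho r' x * \sum_j u r' x 0 j * partial j (tensor b) x| <= B * rho r' x.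
  move=> /andP[h1 h2]; have rt : t0 <= r' <= t1 by rewrite !ltW.
  have rT : 0 <= r' <= T by rewrite (le_trans t00 (ltW h1)) (le_trans (ltW h2) t1T).
  have k1 := aeS2 (fun x a b => conj a b) (uM r' rt) (ue r' rt).
  apply: aeS2 k1 (rho_ge0 rT) => x [xM xe] x0.
  rewrite normrM (ger0_norm x0) mulrC ler_wpM2r//.
  have pb j : `|partial j (tensor b) x| <= `|derive1 (b j) (x 0 j)|.
    rewrite partial_tensor// (tensorD1 _ j) /tensor_diff eqxx normrM.
    rewrite -[leRHS]mulr1 ler_wpM2l// normr_prod; apply: prodr_ile1 => l /negbTE ->.
    by rewrite normr_ge0 ger0_norm; have /andP[] := b01 l (x 0 l).
  have [xa|ax] := leP (sg * x 0 i) a.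
    have xp : sg * x 0 i < p i by rewrite /p eqxx; apply: (le_lt_trans xa); rewrite ltrDl.
    have [_ _ h0 _ _] := hb i.
    rewrite big1 ?normr0// => j _; rewrite partial_tensor// (tensorD1 _ i) /tensor_diff.
    case: eqP => [_|_]; last by rewrite h0 ?mul0r ?mulr0//; left; exact: ltW.
    rewrite (@smooth1_derive0 _ sg (p i))// ?mul0r ?mulr0//.
    by move=> z hz; apply: h0; left.
  apply: (le_trans (ler_norm_sum _ _ _)); rewrite (bigD1 i)//=.
  have t1' : `|u r' x 0 i * partial i (tensor b) x| <= C * e / w2 + C * e / q.
    rewrite normrM; apply: (@le_trans _ _ (e * (C / w2 + C / q))).
      apply: ler_pM => //; first exact: xe.
      by apply: (le_trans (pb i)); have [_ _ _ _ h] := hb i; have := h (x 0 i); rewrite /q1 eqxx.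
    by rewrite mulrDr !mulrA [e * C]mulrC.
  have t2 : \sum_(j < n | j != i) `|u r' x 0 j * partial j (tensor b) x| <= n%:R * (M * (C + C)) / q.
    apply: (@le_trans _ _ (\sum_(j < n) M * (C + C) / q)); last first.
      by rewrite sumr_const card_ord -[leLHS]mulr_natl !mulrA.
    rewrite [leRHS](bigD1 i)//=; apply: ler_wpDl.
      by apply: divr_ge0; [exact: mulr_ge0|exact: ltW].
    apply: ler_sum => j ji; rewrite normrM -mulrA; apply: ler_pM => //.
    apply: (le_trans (pb j)); have [_ _ _ _ h] := hb j; have := h (x 0 j).
    by rewrite /q1 (negbTE ji) mulrDl.
  by rewrite /B /Q mulrDl; lra.
have := @vacuum_propagation R n T rho u crho rho_ge0 mass_eq b (fun l => - A l) A t0 t1 B N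
  sb b01 bsupp A0 t00 t1T B0 Bt rhoN vac' speed s st.
apply: aeS => x h [ax xm]; apply: h; rewrite /tensor big1// => l _.
have [_ _ _ h1 _] := hb l; apply: h1.
have xml := xm l; have sxm : `|sg * x 0 l| <= m%:R.
  by rewrite normrM; case: hsg => ->; rewrite ?normrN normr1 mul1r.
move: sxm; rewrite ler_norml => /andP[k1 k2].
rewrite /p /q1 /r; case: eqP => [li|_]; last by apply/andP; split; lra.
rewrite li in k1 k2 *; apply/andP; split; first by rewrite /w2; lra.
by have := normr_ge0 a; have := normr_ge0 w; lra.
Qed.

End half_space.

(** * Rigidity of vacuum half-spaces *)

Section rigidity.
Context {R : realType} {n : nat}.
Notation "'leb'" := (@lebesgue_rV R n).

Lemma partials_cat s1 s2 (phi : 'rV[R]_n -> R) :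
  partials s1 (partials s2 phi) = partials (s1 ++ s2) phi.
Proof. by rewrite /partials foldr_cat. Qed.

Lemma test_function_partial j (phi : 'rV[R]_n -> R) :
  test_function phi -> test_function (partial j phi).
Proof.
move=> [sphi cK]; split.
  by move=> s; rewrite -[partial j phi]/(partials [:: j] phi) partials_cat; exact: sphi.
apply: (subclosed_compact _ cK); first exact: closed_closure.
rewrite closureE => x; apply; split; first exact: closed_closure.
move=> y /= hy; apply: contrapT => yK; move/eqP: hy; apply.
have phi0 z : ~ closure [set x | phi x != 0] z -> phi z = 0.
  by move=> zK; apply/eqP/negP => /negP h; apply: zK; exact: subset_closure.
exact: (@partials_out _ _ phi [:: j] _ y (@closed_closure _ _) phi0 yK).
Qed.

Lemma half_space_cutoff (i : 'I_n) (sg a : R) (m : nat) : sg = 1 \/ sg = -1 ->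
  exists phi : 'rV[R]_n -> R, [/\ test_function phi, forall x, 0 <= phi x <= 1,
    forall s (x : 'rV[R]_n), sg * x 0 i <= a -> partials s phi x = 0 &
    forall x : 'rV[R]_n, a + 2 / m.+1%:R <= sg * x 0 i <= a + m%:R -> (forall l, `|x 0 l| <= m%:R) ->
      phi x = 1].
Proof.
move=> hsg; have [C C0 bumps] := @bump_exists R.
pose d : R := m.+1%:R^-1; have d0 : 0 < d by rewrite invr_gt0.
(* The rise starts at [a + d] and not at [a], so that the support stays inside a closed half-space
   away from the boundary and all derivatives vanish also at points where [sg * x 0 i] equals
   [a]. *)
pose p l := if l == i then a + d else - m%:R - 1.
pose q l := if l == i then d else 1.
pose r l := if l == i then a + m%:R + 1 else m%:R + 1.
have q0 l : 0 < q l by rewrite /q; case: ifP.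
have /choice[b hb] := fun l => bumps sg (p l) (q l) (r l) 1 hsg (q0 l) ltr01.
have sb l : smooth1 (b l) by have [] := hb l.
have b01 l y : 0 <= b l y <= 1 by have [_ h _ _ _] := hb l.
have m0 : 0 <= m%:R :> R by [].
have bsupp l y : b l y != 0 -> - (`|p l| + `|r l|) <= y <= `|p l| + `|r l|.
  have [_ _ h _ _] := hb l; move=> by0.
  have h1 : p l < sg * y by rewrite ltNge; apply: contraNN by0 => hh; rewrite h//; left.
  have h2 : sg * y < r l by rewrite ltNge; apply: contraNN by0 => hh; rewrite h//; right.
  have k1 := ler_norm (r l); have k2 := ler_norm (- p l); rewrite normrN in k2.
  have k3 := normr_ge0 (p l); have k4 := normr_ge0 (r l).
  by case: hsg => e1; rewrite e1 ?mul1r ?mulN1r in h1 h2; apply/andP; split; lra.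
exists (tensor b); split.
- exact: tensor_test_function bsupp.
- move=> x; rewrite /tensor prodr_ge0/=; last by move=> l _; have /andP[] := b01 l (x 0 l).
  by apply: prodr_ile1 => l _; exact: b01.
- move=> s x xa; apply: (@partials_out _ _ _ s [set y : 'rV[R]_n | a + d <= sg * y 0 i]).
  + have cf : continuous (fun y : 'rV[R]_n => sg * y 0 i).
      have cg : continuous (fun z : R => sg * z) by move=> z; apply: cvgM; [exact: cvg_cst|exact: cvg_id].
      move=> y; apply: (@continuous_comp _ _ _ (fun y : 'rV[R]_n => y 0 i) (fun z => sg * z)).
        exact: coord_continuous.
      exact: cg.
    by move/continuous_closedP : cf => /(_ [set z | a + d <= z]); apply; exact: closed_ge.
  + move=> y /= /negP; rewrite -ltNge => h; rewrite (tensorD1 _ i).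
    by have [_ _ h0 _ _] := hb i; rewrite h0 ?mul0r//; left; rewrite /p eqxx ltW.
  + by move=> /= h; have := le_trans h xa; lra.
- move=> x /andP[h1 h2] h3; rewrite /tensor big1// => l _.
  have [_ _ _ h4 _] := hb l; apply: h4; rewrite /p /q /r.
  rewrite -/d in h1; clearbody d.
  case: eqP => [->|_]; first by apply/andP; split; lra.
  have : `|sg * x 0 l| <= m%:R.
    by rewrite normrM; case: hsg => ->; rewrite ?normrN normr1 mul1r.
  by rewrite ler_norml => /andP[k1 k2]; apply/andP; split; lra.
Qed.

Lemma half_space_exhaustion (mu : {measure set 'rV[R]_n -> \bar R}) (i : 'I_n) (sg a : R)
    (P : 'rV[R]_n -> Prop) :
  (forall m : nat, {ae mu, forall x : 'rV[R]_n,
     a + 2 / m.+1%:R <= sg * x 0 i <= a + m%:R -> (forall l, `|x 0 l| <= m%:R) -> P x}) ->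
  {ae mu, forall x : 'rV[R]_n, a < sg * x 0 i -> P x}.
Proof.
move=> h; apply: aeS (ae_foralln h) => x hx xa.
pose y := sg * x 0 i - a; have y0 : 0 < y by rewrite subr_gt0.
pose K := 2 / y + y + \sum_l `|x 0 l|.
have S0 : 0 <= \sum_l `|x 0 l| by apply: sumr_ge0.
have y2 : 0 < 2 / y by rewrite divr_gt0.
have K0 : 0 <= K by apply: addr_ge0 => //; apply: addr_ge0; exact: ltW.
have Kb := archi_boundP K0; set m := Num.bound K in Kb.
have m1 : m%:R < m.+1%:R :> R by rewrite ltr_nat.
apply: (hx m) => [|l]; last first.
  have : `|x 0 l| <= \sum_l `|x 0 l| by rewrite (bigD1 l)//= lerDl; apply: sumr_ge0.
  by move: Kb; rewrite /K; lra.
apply/andP; split; last by move: Kb; rewrite /K /y; lra.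
have : 2 / m.+1%:R <= y.
  rewrite ler_pdivrMr// mulrC -ler_pdivrMr//; apply: le_trans (ltW m1).
  by apply: le_trans (ltW Kb); rewrite /K -addrA lerDl addr_ge0// ltW.
by rewrite /y lerBrDl.
Qed.

Lemma trace_sqr_le (s : 'I_n -> R) : (\sum_i s i) ^+ 2 <= n%:R * \sum_i s i ^+ 2.
Proof.
have h i j : s i * s j <= 2^-1 * (s i ^+ 2 + s j ^+ 2).
  by have := sqr_ge0 (s i - s j); rewrite sqrrB; lra.
rewrite expr2 mulr_suml; apply: (@le_trans _ _ (\sum_i \sum_j 2^-1 * (s i ^+ 2 + s j ^+ 2))).
  by apply: ler_sum => i _; rewrite mulr_sumr; apply: ler_sum => j _; exact: h.
have e1 i : \sum_j 2^-1 * (s i ^+ 2 + s j ^+ 2) = 2^-1 * (n%:R * s i ^+ 2 + \sum_j s j ^+ 2).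
  by rewrite -mulr_sumr big_split/= sumr_const card_ord mulr_natl.
rewrite (eq_bigr _ (fun i _ => e1 i)) -mulr_sumr big_split/= -mulr_sumr.
by rewrite sumr_const card_ord -[X in _ + X]mulr_natl; lra.
Qed.

(** Here [S] is the strain and [2^-1 * \tr S] the divergence. For [l0 >= 0] the first term is
    enough; for [l0 < 0] the trace is bounded by Cauchy-Schwarz on the diagonal, and what remains is
    [(n%:R * l0 + 2 * m0) / 4]. *)
Lemma dissipation_form_ge (m0 l0 : R) (S : 'M[R]_n) : 0 < m0 -> 0 < n%:R * l0 + 2 * m0 ->
  exists2 c : R, 0 < c &
    c * (\sum_i \sum_j S i j ^+ 2) <= m0 / 2 * (\sum_i \sum_j S i j ^+ 2) + l0 * (2^-1 * \tr S) ^+ 2.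
Proof.
move=> m00 nl; pose Q := \sum_i \sum_j S i j ^+ 2.
have dQ : \sum_i S i i ^+ 2 <= Q.
  apply: ler_sum => i _; rewrite (bigD1 i)//= lerDl.
  by apply: sumr_ge0 => j _; exact: sqr_ge0.
have D0 : 0 <= \sum_i S i i ^+ 2 by apply: sumr_ge0 => i _; exact: sqr_ge0.
have tr : (\tr S) ^+ 2 <= n%:R * \sum_i S i i ^+ 2 by exact: (trace_sqr_le (fun i => S i i)).
have n0 : 0 <= n%:R :> R by [].
have t0 := sqr_ge0 (\tr S).
have E : (2^-1 * \tr S) ^+ 2 = 4^-1 * (\tr S) ^+ 2 by rewrite exprMn expr2; congr (_ * _); lra.
rewrite E -/Q; have [l00|l00] := leP 0 l0.
  exists (m0 / 2); first by rewrite divr_gt0.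
  by rewrite lerDl mulr_ge0// mulr_ge0// invr_ge0.
exists ((n%:R * l0 + 2 * m0) / 4); first by rewrite divr_gt0.
have h : (\tr S) ^+ 2 <= n%:R * Q by apply: (le_trans tr); rewrite ler_wpM2l.
have : l0 * (n%:R * Q) <= l0 * (\tr S) ^+ 2 by rewrite ler_wnM2l// ltW.
by lra.
Qed.

End rigidity.

(** * The strain vanishes in a vacuum half-space *)

Section vacuum_rigidity.
Context {R : realType} {n : nat}.
Notation "'leb'" := (@lebesgue_rV R n).
Variables (mu lambda kappa : R -> R -> R) (Rgas A gamma T : R) (k : nat).
Variables (rho S theta p e : R -> 'rV[R]_n -> R) (u : R -> 'rV[R]_n -> 'rV[R]_n).
Hypotheses (Rgas_gt0 : 0 < Rgas) (A_gt0 : 0 < A) (gamma_gt1 : 1 < gamma).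
Hypotheses (mu_gt0 : 0 < mu 0 0) (lambda_gt0 : 0 < n%:R * lambda 0 0 + 2 * mu 0 0).
Hypothesis sol : navier_stokes_solution mu lambda kappa Rgas A gamma k T
  rho S u theta p e.

Lemma energy_ge0 t : 0 <= t <= T -> \forall x \ae leb, 0 <= rho t x * e t x.
Proof.
move=> tT; apply: aeS2 (ns_rho_ge0 sol tT) (ns_state sol tT) => x r0 [pE eE pA _].
have cv0 : 0 < heat_capacity Rgas gamma by rewrite divr_gt0// subr_gt0.
have p0 : 0 <= p t x.
  by rewrite pA mulr_ge0 ?powR_ge0// mulr_ge0 ?expR_ge0// ltW.
have : 0 <= rho t x * theta t x.
  by move: p0; rewrite pE -mulrA pmulr_rge0.
by rewrite eE mulrCA => h; rewrite mulr_ge0// ltW.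
Qed.

Lemma vacuum_state i sg a t : 0 <= t <= T -> vacuum_beyond rho i sg a t ->
  {ae leb, forall x : 'rV[R]_n, a < sg * x 0 i ->
    [/\ rho t x = 0, theta t x = 0, p t x = 0 & e t x = 0]}.
Proof.
move=> tT vac; apply: aeS2 vac (ns_state sol tT) => x vx [pE eE _ th0] xa.
by have r0 := vx xa; rewrite pE eE (th0 r0) !mulr0.
Qed.

(* The internal energy against a nonnegative test function supported in the
   vacuum is minimal at time [t], so that its time derivative vanishes. *)
Lemma vacuum_strain i sg a t : sg = 1 \/ sg = -1 -> 0 < t < T -> vacuum_beyond rho i sg a t ->
  {ae leb, forall x : 'rV[R]_n, a < sg * x 0 i -> strain (u t) x = 0}.
Proof.
move=> hsg tT vac.
have tT' : 0 <= t <= T by have /andP[h1 h2] := tT; rewrite !ltW.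
have vs := vacuum_state tT' vac.
apply: half_space_exhaustion => m.
have [phi [tphi phi01 phi0 phi1]] := half_space_cutoff i a m hsg.
have [lq lF lh _] := ns_energy sol tT.
pose y s := \int[leb]_x (rho s x * e s x * phi x).
have phi0' (x : 'rV[R]_n) : sg * x 0 i <= a -> phi x = 0 by exact: (phi0 [::]).
have y0 s : 0 < s < T -> 0 <= y s.
  move=> sT; have [ls _ _ _] := ns_energy sol sT.
  have sT' : 0 <= s <= T by have /andP[h1 h2] := sT; rewrite !ltW.
  apply: Rintegral_ae_ge0.
    apply: measurable_funM; first by case: ls.
    by apply: continuous_measurable_rV; have [+ _] := tphi => /(_ [::])[].
  by apply: aeS (energy_ge0 sT') => x h; rewrite mulr_ge0//; have /andP[] := phi01 x.
have yt : y t = 0.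
  rewrite /y (@Rintegral_ae_eq _ _ _ _ _ (fun=> 0)) /Rintegral ?integral0//.
    by apply/measurable_EFinP; exact: measurable_int (integrable_test [::] lq tphi).
  apply: aeS vs => x h; have [/h[-> _ _ _]|/phi0' ->] := ltP a (sg * x 0 i).
    by rewrite !mul0r.
  by rewrite mulr0.
have dy s : s \in `]0, T[%R -> derivable y s 1.
  by rewrite in_itv/= => sT; have [_ _ _ /(_ _ tphi)[]] := ns_energy sol sT.
have tI : t \in `]0, T[%R by rewrite in_itv.
have T0 : 0 <= T by have /andP[h1 h2] := tT'; exact: le_trans h1 h2.
(* [y] is nonnegative on the open interval and 0 at [t]; being an interior minimum forces the
   derivative to vanish. *)
have D0 := derive1_at_min T0 dy tI.
have {}D0 : is_derive t (1 : R) y 0.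
  by apply: D0 => s; rewrite in_itv/= yt => sT; exact: y0.
have [_ _ _ /(_ _ tphi) D1] := ns_energy sol tT.
have vE : \sum_j \int[leb]_x (((rho t x * e t x) *: u t x
      - kappa (rho t x) (theta t x) *: wgrad (e t) x) 0 j * partial j phi x) +
    \int[leb]_x ((dissipation mu lambda (rho t) (theta t) (u t) x
      - p t x * wdiv (u t) x) * phi x) = 0.
  by have [_ <-] := D1; have [_ ->] := D0.
(* Convection disappears with [rho]. On the support of [phi] the conductivity is the constant
   [kappa 0 0], so the weak gradient of the energy can be integrated by parts against
   [partial j phi], leaving only [e t], which is 0 there. *)
have flux j : \int[leb]_x (((rho t x * e t x) *: u t x
      - kappa (rho t x) (theta t x) *: wgrad (e t) x) 0 j * partial j phi x) = 0.
  have we := wderivP (ns_e_grad sol tT j).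
  have [le lge weE] := we.
  have tdphi : test_function (partial j phi) by exact: test_function_partial.
  have out (x : 'rV[R]_n) : sg * x 0 i <= a -> partial j phi x = 0 by exact: (phi0 [:: j]).
  have i1 := integrable_test [:: j] (lF j) tphi.
  have i2 := integrable_test [::] lge tdphi.
  have i3 := integrable_test [:: j] le tdphi.
  transitivity (\int[leb]_x (- kappa 0 0 * (wderiv [:: j] (e t) x * partial j phi x))).
    apply: Rintegral_ae_eq.
    - by apply/measurable_EFinP; exact: measurable_int i1.
    - by apply: measurable_funM => //; apply/measurable_EFinP; exact: measurable_int i2.
    apply: aeS vs => x hx; have [/hx[r0 th0 _ e0]|/out ->] := ltP a (sg * x 0 i); last first.
      by rewrite !mulr0.
    by rewrite r0 th0 e0 !mxE mul0r mul0r sub0r mulNr mulNr mulrA.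
  rewrite RintegralZl//.
  have -> : \int[leb]_x (wderiv [:: j] (e t) x * partial j phi x) = 0.
    have h1 := weE _ tdphi.
    have h2 : \int[leb]_x (e t x * partials [:: j] (partial j phi) x) = 0.
      rewrite (@Rintegral_ae_eq _ _ _ _ _ (fun=> 0)) /Rintegral ?integral0//.
        by apply/measurable_EFinP; exact: measurable_int i3.
      apply: aeS vs => x hx; have [/hx[_ _ _ ->]|xa] := ltP a (sg * x 0 i).
        by rewrite mul0r.
      by rewrite -[partial j phi]/(partials [:: j] phi) partials_cat phi0// mulr0.
    move: h1; rewrite h2 expr1 mulN1r => /esym/eqP.
    by rewrite oppr_eq0 => /eqP.
  by rewrite mulr0.
move: vE; rewrite big1 ?add0r; last by move=> j _; exact: flux.
move=> hphi.
have ih := integrable_test [::] lh tphi.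
have rigid : {ae leb, forall x : 'rV[R]_n, a < sg * x 0 i ->
    exists2 c : R, 0 < c & c * (\sum_i \sum_j strain (u t) x i j ^+ 2) <=
      dissipation mu lambda (rho t) (theta t) (u t) x - p t x * wdiv (u t) x}.
  apply: aeS vs => x hx xa; have [r0 th0 p0 _] := hx xa.
  have [c c0 hc] := dissipation_form_ge (strain (u t) x) mu_gt0 lambda_gt0.
  exists c => //; apply: (le_trans hc); rewrite /dissipation r0 th0 p0 mul0r subr0.
  rewrite lerD2l (_ : 2^-1 * \tr (strain (u t) x) = wdiv (u t) x)//.
  by rewrite /strain mxtraceD mxtrace_tr -/(wdiv (u t) x); lra.
have Q0 (x : 'rV[R]_n) : 0 <= \sum_i \sum_j strain (u t) x i j ^+ 2.
  by apply: sumr_ge0 => l _; apply: sumr_ge0 => j _; exact: sqr_ge0.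
have hphi0 : \forall x \ae leb, 0 <= (dissipation mu lambda (rho t) (theta t) (u t) x
      - p t x * wdiv (u t) x) * phi x.
  apply: aeS rigid => x hx; have [/hx[c c0 hc]|/phi0' ->] := ltP a (sg * x 0 i); last first.
    by rewrite mulr0.
  have /andP[p0 _] := phi01 x; rewrite mulr_ge0//; apply: le_trans hc.
  by rewrite mulr_ge0// ltW.
have := Rintegral_eq0_ae ih hphi0 hphi.
apply: aeS2 rigid => x hx hx0 xr xm.
have xa : a < sg * x 0 i.
  have /andP[h1 _] := xr; apply: lt_le_trans h1.
  by rewrite ltrDl divr_gt0.
have [c c0 hc] := hx xa; move: hx0; rewrite /= phi1// mulr1 => hx0.
move: hc; rewrite hx0 pmulr_rle0// => hQ.
have {}hQ : \sum_i \sum_j strain (u t) x i j ^+ 2 = 0 by apply/eqP; rewrite eq_le hQ Q0.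
apply/matrixP => i' j'; rewrite [RHS]mxE.
have := hQ => /eqP; rewrite psumr_eq0; last by move=> l _; apply: sumr_ge0 => j _; exact: sqr_ge0.
move=> /allP/(_ i' (mem_index_enum _))/=; rewrite psumr_eq0; last by move=> l _; exact: sqr_ge0.
by move=> /allP/(_ j' (mem_index_enum _))/=; rewrite sqrf_eq0 => /eqP.
Qed.

End vacuum_rigidity.

(** * Square integrable functions constant along a half-line direction *)

Section half_space_vanishing.
Context {R : realType}.

(** Stretching by [N] about [a0] and dividing by [N] preserves the integral, so the difference has a
    compactly supported primitive. With [a0] an endpoint of the support, the stretched copy grows
    towards one side only: [a0] will be the endpoint facing the boundary of the half-space. *)
Lemma stretch_primitive (phi : R -> R) (s t N a0 : R) : smooth1 phi -> s <= t -> 1 <= N ->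
  (forall y, y <= s \/ t <= y -> phi y = 0) -> exists Psi : R -> R,
  [/\ smooth1 Psi,
    (forall y, derive1 Psi y = phi y - N^-1 * phi (N^-1 * y + (a0 - N^-1 * a0))),
    (a0 = s -> forall y, y <= s \/ s + N * (t - s) <= y -> Psi y = 0) &
    (a0 = t -> forall y, y <= t - N * (t - s) \/ t <= y -> Psi y = 0)].
Proof.
move=> sphi st N1 phi0.
have N0 : 0 < N by lra.
have sps : smooth1 (fun z => phi (1 * z + s)) by exact: smooth1_affine.
have [|F [dF F0]] := prim_exists (smooth1_continuous sps).
  by move=> z z0; apply: phi0; left; lra.
have sF : smooth1 F by exact: smooth1_prim dF sps.
pose Phi y := F (1 * y + - s).
have sPhi : smooth1 Phi by exact: smooth1_affine.
have dPhi y : derive1 Phi y = phi y.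
  rewrite /Phi derive1_affine// (is_derive_derive1 dF) !mul1r subrK//.
have Phi0 y : y <= s -> Phi y = 0 by move=> ys; rewrite /Phi F0//; lra.
have Phic y : t <= y -> Phi y = Phi t.
  move=> ty; apply: esym; apply: (@is_derive0_eq _ Phi t y _ (smooth1_derivable sPhi) ty).
  move=> z; rewrite in_itv/= => /andP[tz _].
  have := smooth1_is_derive sPhi z; rewrite dPhi phi0//; right; exact: ltW.
exists (fun y => Phi y - Phi (N^-1 * y + (a0 - N^-1 * a0))).
have E y : N^-1 * y + (a0 - N^-1 * a0) = a0 + (y - a0) / N by rewrite mulrBl; lra.
have M z : 0 <= z -> z / N <= z.
  by move=> z0; rewrite ler_pdivrMr// ler_peMr.
have ts0 : 0 <= t - s by rewrite subr_ge0.
have Nts : t - s <= N * (t - s) by rewrite ler_peMl.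
split.
- by apply: smooth1B => //; exact: smooth1_affine.
- move=> y; have D1 := smooth1_is_derive sPhi y.
  have D2 := is_derive_affine (smooth1_is_derive sPhi (N^-1 * y + (a0 - N^-1 * a0))).
  have D := @is_deriveB _ _ _ _ _ _ _ _ _ D1 D2.
  rewrite derive1E.
  have -> : (fun y => Phi y - Phi (N^-1 * y + (a0 - N^-1 * a0))) =
    Phi - (fun y => Phi (N^-1 * y + (a0 - N^-1 * a0))) by [].
  by have [_ ->] := D; rewrite !dPhi.
- move=> a0s y hy; rewrite E a0s; case: hy => hy.
    rewrite !Phi0 ?subrr// -lerBrDl subrr mulr_le0_ge0 ?invr_ge0 ?(ltW N0)// subr_le0//.
  have h : t - s <= (y - s) / N by rewrite ler_pdivlMr// mulrC; lra.
  by rewrite [X in _ - X]Phic ?Phic ?subrr//; lra.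
- move=> a0t y hy; rewrite E a0t; case: hy => hy.
    have h : (y - t) / N <= s - t by rewrite ler_pdivrMr// mulrC; lra.
    by rewrite !Phi0 ?subrr//; lra.
  have h : 0 <= (y - t) / N by rewrite divr_ge0 ?(ltW N0)// subr_ge0.
  by rewrite [X in _ - X]Phic ?Phic ?subrr//; lra.
Qed.

Context {n : nat}.
Notation "'leb'" := (@lebesgue_rV R n).

(* Subtracting from [tensor b] a copy stretched by [N = M ^ 2] in the direction
   [i], divided by [N], leaves the [i]-th derivative of a test function supported
   in the half-space, against which [f] integrates to [0]; the [L^2] norm of the
   stretched term is of order [1 / M]. *)
Lemma half_space_tensor_integral (i : 'I_n) (sg a G : R) (f g g0 : 'rV[R]_n -> R)
    (b : 'I_n -> R -> R) (lo hi : 'I_n -> R) :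
  weak_derivative [::] f g0 -> ('N[leb]_2%:E[EFin \o g0] <= G%:E)%E ->
  weak_derivative [:: i] f g -> {ae leb, forall x : 'rV[R]_n, a < sg * x 0 i -> g x = 0} ->
  (forall l, smooth1 (b l)) -> (forall l, lo l <= hi l) ->
  (forall l y, y <= lo l \/ hi l <= y -> b l y = 0) ->
  (sg = 1 /\ a <= lo i) \/ (sg = -1 /\ hi i <= - a) ->
  \int[leb]_x (f x * tensor b x) = 0.
Proof.
move=> fg0 g0G fg gvac sb lohi b0 hsg.
have bsupp l y : b l y != 0 -> lo l <= y <= hi l.
  move=> by0; apply/andP; split; rewrite leNgt; apply: contraNN by0 => h.
    by rewrite b0//; left; exact: ltW.
  by rewrite b0//; right; exact: ltW.
have /choice[Cb hCb] := fun l => smooth1_bounded (sb l) (bsupp l).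
have Cb0 l : 0 <= Cb l by exact: le_trans (normr_ge0 _) (hCb l 0).
pose S := \prod_l Cb l; have S0 : 0 <= S by exact: prodr_ge0.
pose V := \prod_l (hi l - lo l).
have V0 : 0 <= V by apply: prodr_ge0 => l _; rewrite subr_ge0.
have G0 : 0 <= G by rewrite -lee_fin (le_trans _ g0G)// Lnorm_ge0.
have [lf lg0 fg0E] := fg0; have [_ lg fgE] := fg.
have tb : test_function (tensor b) by exact: tensor_test_function bsupp.
have key (M : nat) : (0 < M)%N ->
    `|\int[leb]_x (f x * tensor b x)| <= G * S * Num.sqrt V / M%:R.
  move=> M0; pose N : R := M%:R ^+ 2.
  have MR0 : 0 < M%:R :> R by rewrite ltr0n.
  have N1 : 1 <= N by rewrite exprn_ege1// ler1n.
  have N0 : 0 < N by lra.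
  pose a0 := if sg == 1 then lo i else hi i.
  have [Psi [sPsi dPsi Psi1 Psi2]] := stretch_primitive a0 (sb i) (lohi i) N1 (b0 i).
  pose lo' l := if l == i then (if sg == 1 then lo i else hi i - N * (hi i - lo i)) else lo l.
  pose hi' l := if l == i then (if sg == 1 then lo i + N * (hi i - lo i) else hi i) else hi l.
  have lohi' l : lo' l <= hi' l.
    rewrite /lo' /hi'; case: ifP => // _; have d0 : 0 <= N * (hi i - lo i).
      by rewrite mulr_ge0 ?(ltW N0)// subr_ge0.
    by case: ifP => _; lra.
  have PsiO y : y <= lo' i \/ hi' i <= y -> Psi y = 0.
    rewrite /lo' /hi' eqxx; case: ifPn => sg1 hy.
      by apply: Psi1 => //; rewrite /a0 sg1.
    by apply: Psi2 => //; rewrite /a0 (negbTE sg1).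
  pose b1 l := if l == i then Psi else b l.
  pose b2 l := if l == i then (fun y => b i (N^-1 * y + (a0 - N^-1 * a0))) else b l.
  have sb1 l : smooth1 (b1 l) by rewrite /b1; case: ifP.
  have sb2 l : smooth1 (b2 l) by rewrite /b2; case: ifP => // _; exact: smooth1_affine.
  have b1supp l y : b1 l y != 0 -> lo' l <= y <= hi' l.
    rewrite /b1 => h; apply/andP; split; rewrite leNgt; apply: contraNN h => h;
      move: h; rewrite /lo' /hi'; case: eqP => [li|_] h.
    - by rewrite PsiO//; left; rewrite /lo' eqxx ltW.
    - by rewrite b0//; left; exact: ltW.
    - by rewrite PsiO//; right; rewrite /hi' eqxx ltW.
    - by rewrite b0//; right; exact: ltW.
  have t1 : test_function (tensor b1) by exact: tensor_test_function b1supp.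
  have E y : N^-1 * y + (a0 - N^-1 * a0) = a0 + (y - a0) / N by rewrite mulrBl; lra.
  have b2O l y : y <= lo' l \/ hi' l <= y -> b2 l y = 0.
    rewrite /b2 /lo' /hi'; case: eqP => [li|_]; last exact: b0.
    rewrite E /a0; case: ifPn => sg1 hy; apply: b0; case: hy => hy.
    - by left; rewrite -lerBrDl subrr mulr_le0_ge0 ?invr_ge0 ?(ltW N0)// subr_le0.
    - right; rewrite -lerBlDl ler_pdivlMr// mulrC; lra.
    - left; rewrite -lerBrDl ler_pdivrMr// mulrC; lra.
    - by right; rewrite lerDl divr_ge0 ?(ltW N0)// subr_ge0.
  have b2supp l y : b2 l y != 0 -> lo' l <= y <= hi' l.
    move=> by0; apply/andP; split; rewrite leNgt; apply: contraNN by0 => h.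
      by rewrite b2O//; left; exact: ltW.
    by rewrite b2O//; right; exact: ltW.
  have t2 : test_function (tensor b2) by exact: tensor_test_function b2supp.
  have dE x : partial i (tensor b1) x = tensor b x - N^-1 * tensor b2 x.
    rewrite partial_tensor// !(tensorD1 _ i) /tensor_diff /b1 /b2 eqxx dPsi.
    rewrite (eq_bigr (fun l => b l (x 0 l))) => [|l /negbTE ->//].
    rewrite [X in _ - _ * (_ * X)](eq_bigr (fun l => b l (x 0 l))) => [|l /negbTE ->//].
    by ring.
  have zero : \int[leb]_x (f x * partials [:: i] (tensor b1) x) = 0.
    rewrite fgE// expr1 mulN1r (@Rintegral_ae_eq _ _ _ _ _ (fun=> 0)) /Rintegral ?integral0 ?oppr0//.
      by apply/measurable_EFinP; exact: measurable_int (integrable_test [::] lg t1).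
    apply: aeS gvac => x gx; have [/gx ->|xa] := ltP a (sg * x 0 i); first by rewrite mul0r.
    rewrite (tensorD1 _ i) /b1 eqxx PsiO ?mul0r ?mulr0//; move: xa.
    rewrite /lo' /hi' eqxx; case: hsg => -[-> h]; rewrite ?eqxx.
      by rewrite mul1r => xa; left; exact: le_trans h.
    have -> : (-1 == 1 :> R) = false by apply/negbTE; rewrite lt_eqF//; lra.
    by rewrite mulN1r lerNl => xa; right; exact: le_trans xa.
  have i1 := integrable_test [::] lf tb; have i2 := integrable_test [::] lf t2.
  have eqI : \int[leb]_x (f x * tensor b x) = N^-1 * \int[leb]_x (f x * tensor b2 x).
    have := zero; rewrite (@eq_Rintegral _ _ _ _ _
      (fun x => f x * tensor b x - N^-1 * (f x * tensor b2 x))); last first.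
      by move=> x _; rewrite /= dE mulrBr; congr (_ - _); rewrite mulrCA.
    rewrite RintegralB//; last exact: (integrableZl measurableT N^-1 i2).
    by rewrite RintegralZl// => /eqP; rewrite subr_eq0 => /eqP.
  have mg0 : measurable_fun setT g0 by case: lg0.
  have mb2 : measurable_fun setT (tensor b2).
    by apply: measurable_tensor => l; exact: measurable_smooth1.
  have bS x : `|tensor b2 x| <= S.
    rewrite /tensor normr_prod; apply: ler_prod => l _; rewrite normr_ge0/= /b2.
    by case: eqP => [->|_]; exact: hCb.
  have bO x : ~ box lo' hi' x -> tensor b2 x = 0.
    move=> /existsNP[l]; rewrite /= in_itv/= => /negP; rewrite negb_and -leNgt -ltNge => h.
    rewrite (tensorD1 _ l) b2O ?mul0r//.
    by case/orP: h => h; [left|right; exact: ltW].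
  have := Cauchy_Schwarz_box lohi' mg0 mb2 g0G bS bO.
  have -> : \prod_l (hi' l - lo' l) = M%:R ^+ 2 * V.
    rewrite /V (bigD1 i)//= [in RHS](bigD1 i)//= mulrA; congr (_ * _).
      by rewrite /hi' /lo' eqxx -/N; case: ifP => _; lra.
    by apply: eq_bigr => l /negbTE li; rewrite /hi' /lo' li.
  rewrite sqrtrM ?sqr_ge0// sqrtr_sqr (gtr0_norm MR0) => CS.
  have := fg0E _ t2; rewrite /= expr0 mul1r => fE.
  rewrite eqI fE normrM gtr0_norm ?invr_gt0//.
  rewrite mulrC ler_pdivrMr//; apply: (le_trans CS).
  by rewrite /N le_eqVlt; apply/orP; left; apply/eqP; field; rewrite gt_eqF.
apply/eqP; rewrite -normr_eq0 eq_le normr_ge0 andbT.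
set I := `|_| in key *; pose B := G * S * Num.sqrt V.
rewrite leNgt; apply/negP => I0.
have B0 : 0 <= B / I by rewrite divr_ge0 ?(ltW I0)// mulr_ge0 ?sqrtr_ge0// mulr_ge0.
have := key (Num.bound (B / I)).+1 isT.
rewrite ler_pdivlMr ?ltr0n// mulrC -ler_pdivlMr//; apply/negP; rewrite -ltNge.
by apply: lt_trans (archi_boundP B0) _; rewrite ltr_nat.
Qed.

(** The integrals of [f] against ramps inside the half-space vanish, so both [f] and [- f] are
    bounded above by 0 on each box exhausting it. *)
Lemma half_space_vanishing (i : 'I_n) (sg a G : R) (f g g0 : 'rV[R]_n -> R) :
  sg = 1 \/ sg = -1 ->
  weak_derivative [::] f g0 -> ('N[leb]_2%:E[EFin \o g0] <= G%:E)%E ->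
  weak_derivative [:: i] f g -> {ae leb, forall x : 'rV[R]_n, a < sg * x 0 i -> g x = 0} ->
  {ae leb, forall x : 'rV[R]_n, a < sg * x 0 i -> f x = 0}.
Proof.
move=> hsg fg0 g0G fg gvac; have [lf _ _] := fg0.
have [H [sH H0 H1 H01]] := @smooth_step_exists R.
have mH := measurable_smooth1 sH.
have HC z : `|H z| <= 1 by have /andP[h0 h1] := H01 z; rewrite ger0_norm.
apply: half_space_exhaustion => m.
have sgN : (-1 == 1 :> R) = false by apply/negbTE; rewrite lt_eqF//; lra.
have m0 : 0 <= m%:R :> R by [].
pose d : R := m.+1%:R^-1; have d0 : 0 < d by rewrite invr_gt0.
(* A ramp over []a', b']] spills to the right of [b'] by its transition width but not to the left of
   [a']. Hence the margin [d] for a half-space lying to the left of its boundary, [sg = -1], and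
   none for [sg = 1]; scales [j >= m] have width at most [d]. *)
pose lo l := if l == i then (if sg == 1 then a else - a - m%:R - 1) else - m%:R - 1.
pose hi l := if l == i then (if sg == 1 then a + m%:R else - a - d) else m%:R.
have zero (a' b' : 'I_n -> R) : (forall l, [&& lo l <= a' l, a' l <= b' l & b' l <= hi l]) ->
    \forall j \near \oo, \int[leb]_x (f x * ramp_box H j a' b' x) = 0.
  move=> h; exists m => // j /= mj.
  have p4 : 0 < 4 ^+ j :> R by rewrite exprn_gt0.
  have jd : 4^-1 ^+ j <= d.
    rewrite exprVn lef_pV2 ?posrE// -natrX ler_nat.
    by apply: (leq_ltn_trans mj); exact: ltn_expl.
  have j0 : 0 < 4^-1 ^+ j :> R by rewrite exprn_gt0// invr_gt0.
  have ab l : a' l <= b' l by have /and3P[] := h l.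
  apply: (@half_space_tensor_integral i sg a G f g g0 _ a' (fun l => b' l + 4^-1 ^+ j)) => //.
  - by move=> l; exact: smooth1_ramp.
  - by move=> l; rewrite (le_trans (ab l))// lerDl ltW.
  - move=> l y hy; rewrite /ramp -!mulrBr; have al := ab l; case: hy => hy.
      by rewrite !H0 ?subrr// mulr_ge0_le0 ?subr_le0 ?(ltW p4)//; exact: le_trans hy al.
    have h1 : 1 <= 4 ^+ j * (y - b' l).
      by rewrite -ler_pdivrMl// mulr1 -exprVn lerBrDl.
    by rewrite !H1 ?subrr// (le_trans h1)// ler_pM2l// lerD2l lerN2.
  - have := h i; rewrite /lo /hi eqxx; case: hsg => sg1; rewrite sg1 ?eqxx ?sgN => /and3P[h1 h2 h3].
      by left.
    by right; split => //; lra.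
have lNf := loc_integrableZ (-1) lf.
have up := ae_le_of_ramp_box mH HC H0 H1 (c := lo) (d := hi) (M := 0) lf.
have lw := ae_le_of_ramp_box mH HC H0 H1 (c := lo) (d := hi) (M := 0) lNf.
have {}up : \forall x \ae leb, box lo hi x -> f x <= 0.
  apply: up => a' b' h; rewrite mul0r; apply: filterS (zero a' b' h) => j ->; exact: lexx.
have {}lw : \forall x \ae leb, box lo hi x -> -1 * f x <= 0.
  apply: lw => a' b' h; rewrite mul0r; have ab l : a' l <= b' l by have /and3P[] := h l.
  apply: filterS (zero a' b' h) => j I0.
  under eq_Rintegral do rewrite -mulrA.
  rewrite RintegralZl ?I0 ?mulr0//.
  apply: (@integrable_boxM _ _ _ _ a' (fun l => b' l + 1) ((1 + 1) ^+ n)) => //.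
  - exact: measurable_ramp_box.
  - by move=> x; exact: ramp_box_le.
  - by move=> x; exact: ramp_box_out.
apply: aeS2 up lw => x hu hl /andP[h1 h2] h3.
have xb : box lo hi x.
  rewrite -/d in h1; clearbody d.
  move=> l; rewrite /= in_itv/= /lo /hi; have := h3 l; rewrite ler_norml => /andP[k1 k2].
  case: eqP => [->|_]; last by apply/andP; split; lra.
  by case: hsg => sg1; rewrite sg1 ?eqxx ?sgN ?mul1r ?mulN1r in h1 h2 *; apply/andP; split; lra.
by apply/eqP; rewrite eq_le hu//= -oppr_le0 -mulN1r; exact: hl.
Qed.

End half_space_vanishing.

(** Induction on a real interval: the property extends to the supremum of the times up to which it
    holds, and then past this supremum unless it is [T]. *)
Lemma real_induction {R : realType} (T : R) (P : R -> Prop) : 0 <= T -> P 0 ->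
  (forall t, 0 <= t < T -> (forall s, 0 <= s <= t -> P s) ->
    exists2 d, 0 < d & forall s, t < s <= t + d -> s <= T -> P s) ->
  (forall t, 0 < t <= T -> (forall s, 0 <= s < t -> P s) -> P t) ->
  forall t, 0 <= t <= T -> P t.
Proof.
move=> T0 P0 Pstep Plim.
pose E := [set t | 0 <= t <= T /\ forall s, 0 <= s <= t -> P s].
have E0 : E 0.
  by split=> [|s]; [rewrite lexx|rewrite -eq_le => /eqP <-].
have Eub : has_ubound E by exists T => t [/andP[]].
have sE : has_sup E by split; [exists 0|].
pose m := sup E.
have m0 : 0 <= m by exact: ub_le_sup.
have mT : m <= T by apply: ge_sup; [exists 0|move=> t [/andP[]]].
have Plt s : 0 <= s < m -> P s.
  move=> /andP[s0 sm]; have ms : 0 < m - s by rewrite subr_gt0.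
  have [t [tT Pt]] := sup_adherent ms sE; rewrite -/m subKr => st.
  by apply: Pt; rewrite s0 ltW.
have Ple s : 0 <= s <= m -> P s.
  move=> /andP[s0]; rewrite le_eqVlt => /predU1P[sm|sm]; last by apply: Plt; rewrite s0.
  move: s0; rewrite le_eqVlt => /predU1P[<-//|s0]; apply: Plim; first by rewrite s0 sm.
  by move=> r; rewrite sm; exact: Plt.
suff mTE : m = T by move=> t; rewrite -mTE; exact: Ple.
apply/eqP; rewrite eq_le mT leNgt; apply/negP => mltT.
have [|d d0 Pd] := Pstep m _ Ple; first by rewrite m0.
pose m' := Num.min (m + d) T.
have mm' : m < m' by rewrite lt_min ltrDl d0.
suff /(ub_le_sup Eub) : E m' by rewrite leNgt mm'.
split=> [|s /andP[s0 sm']].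
  by rewrite (le_trans m0 (ltW mm'))/= ge_min lexx orbT.
have [sm|ms] := leP s m; first by apply: Ple; rewrite s0.
move: sm'; rewrite le_min => /andP[smd sT].
by apply: Pd => //; rewrite ms.
Qed.

(** * The vacuum front does not advance *)

Section vacuum_front.
Context {R : realType} {n : nat}.
Notation "'leb'" := (@lebesgue_rV R n).
Variables (mu lambda kappa : R -> R -> R) (Rgas A gamma T : R) (k : nat).
Variables (rho S theta p e : R -> 'rV[R]_n -> R) (u : R -> 'rV[R]_n -> 'rV[R]_n).
Hypotheses (Rgas_gt0 : 0 < Rgas) (A_gt0 : 0 < A) (gamma_gt1 : 1 < gamma).
Hypotheses (mu_gt0 : 0 < mu 0 0) (lambda_gt0 : 0 < n%:R * lambda 0 0 + 2 * mu 0 0).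
Hypothesis sol : navier_stokes_solution mu lambda kappa Rgas A gamma k T
  rho S u theta p e.
Hypothesis k_gt : (n < 2 * k)%N.

Let crho : Linf_continuous T rho := C1_sobolev_Linf k_gt (ns_rho_reg sol).

Lemma vacuum_velocity i sg a t : sg = 1 \/ sg = -1 -> 0 < t < T -> vacuum_beyond rho i sg a t ->
  {ae leb, forall x : 'rV[R]_n, a < sg * x 0 i -> u t x 0 i = 0}.
Proof.
move=> hsg tT vac.
have tT' : 0 <= t <= T by have /andP[h1 h2] := tT; rewrite !ltW.
have str := vacuum_strain Rgas_gt0 A_gt0 gamma_gt1 mu_gt0 lambda_gt0 sol hsg tT vac.
have [f' hf] := ns_u_reg sol i; have [su _ _ _] := hf t tT'.
have [g0 w0 g0L] := su [::] isT.
have k0 : (0 < k)%N by case: (k) k_gt.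
have [g1 w1 _] := su [:: i] k0.
have fin : ('N[leb]_2%:E[EFin \o g0] <= (fine (Lnorm leb 2%:E (EFin \o g0)))%:E)%E.
  rewrite fineK// ge0_fin_numE ?Lnorm_ge0//.
  by move: g0L; rewrite inE => /andP[_]; rewrite inE.
apply: (half_space_vanishing hsg w0 fin (wderivP (ex_intro _ g1 w1))).
apply: aeS str => x hx /hx /matrixP/(_ i i).
rewrite !mxE => /eqP; rewrite -mulr2n mulrn_eq0/= => /eqP.
exact.
Qed.

Lemma locally_uniformly_bounded t : 0 <= t <= T -> exists d M N : R, [/\ 0 < d, 0 <= M &
  forall s, 0 <= s <= T -> `|s - t| < d -> (\forall x \ae leb, rho s x <= N) /\
    (\forall x \ae leb, forall j, `|u s x 0 j| <= M)].
Proof.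
move=> tT.
have [[_ [N rN]] /(_ _ ltr01)[d0 d00 hd0]] := crho tT.
have h j : exists d M : R, [/\ 0 < d, 0 <= M & forall s, 0 <= s <= T -> `|s - t| < d ->
    \forall x \ae leb, `|u s x 0 j| <= M].
  have [M M0 uM] := C1_sobolev_bounded k_gt (ns_u_reg sol j) tT.
  have [d d1 hd] := C1_sobolev_continuous k_gt (ns_u_reg sol j) tT ltr01.
  exists d, (M + 1); split=> //; first exact: addr_ge0.
  move=> s sT std; apply: aeS2 uM (hd s sT std) => x h1 h2.
  rewrite -[u s x 0 j](subrK (u t x 0 j)) addrC; apply: (le_trans (ler_normD _ _)).
  exact: lerD.
have /choice[d /choice[M hdM]] := h.
exists (\big[Num.min/d0]_j d j), (\sum_j M j), (N + 1); split.
- by apply/bigmin_gtP; split=> // j _; have [] := hdM j.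
- by apply: sumr_ge0 => j _; have [] := hdM j.
move=> s sT /bigmin_gtP[std0 stdj]; split.
  apply: aeS2 rN (hd0 s sT std0) => x h1 h2.
  have := ler_norm (rho t x); have := ler_norm (rho s x - rho t x); lra.
apply: filter_forall => j; have [_ _ hj] := hdM j.
apply: aeS (hj s sT (stdj j isT)) => x h1; apply: (le_trans h1).
by rewrite (bigD1 j)//= lerDl; apply: sumr_ge0 => l _; have [] := hdM l.
Qed.

Lemma vacuum_beyondS i sg a b t : a <= b -> vacuum_beyond rho i sg a t -> vacuum_beyond rho i sg b t.
Proof. by move=> ab; apply: aeS => x h xb; apply: h; exact: le_lt_trans xb. Qed.

Lemma vacuum_front i sg a : sg = 1 \/ sg = -1 -> vacuum_beyond rho i sg a 0 ->
  forall t, 0 <= t <= T -> vacuum_beyond rho i sg a t.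
Proof.
move=> hsg vac0 t tT.
have T0 : 0 <= T by have /andP[h1 h2] := tT; exact: le_trans h2.
(* A front of slope [eta] with head start [eta] is strictly ahead of the true one, which leaves room
   for the induction in time; [eta] runs through the numbers [j.+1%:R^-1]. *)
suff slow eta : 0 < eta -> vacuum_beyond rho i sg (a + eta + eta * t) t.
  have h j : vacuum_beyond rho i sg (a + j.+1%:R^-1 + j.+1%:R^-1 * t) t.
    by apply: slow; rewrite invr_gt0.
  apply: aeS (ae_foralln h) => x hx xa.
  have t1 : 0 < 1 + t by have /andP[h1 h2] := tT; lra.
  have d0 : 0 < sg * x 0 i - a by rewrite subr_gt0.
  have K0 : 0 <= (1 + t) / (sg * x 0 i - a) by rewrite ltW// divr_gt0.
  apply: (hx (Num.bound ((1 + t) / (sg * x 0 i - a)))).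
  have := archi_boundP K0; set m := Num.bound _ => mK.
  have : (1 + t) / m.+1%:R < sg * x 0 i - a.
    rewrite ltr_pdivrMr// mulrC -ltr_pdivrMr//; apply: (lt_trans mK).
    by rewrite ltr_nat.
  by rewrite mulrDl mul1r [t / _]mulrC ltrBrDl addrA.
move=> eta0; move: t tT; apply: real_induction => //.
- by apply: vacuum_beyondS vac0; rewrite mulr0 addr0 lerDl ltW.
- have [C C0 prop] := vacuum_beyond_propagation crho (ns_rho_ge0 sol) (ns_mass sol).
  move=> t /andP[t0 tT] Pt; have {}Pt := Pt t; rewrite t0 lexx in Pt; have {}Pt := Pt isT.
  have tT' : 0 <= t <= T by rewrite t0 ltW.
  have [d1 [M [N [d10 M0 hb]]]] := locally_uniformly_bounded tT'.
  have win s r : t <= r <= s -> s <= T -> 0 <= r <= T.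
    by move=> /andP[tr rs] sT; rewrite (le_trans t0 tr) (le_trans rs sT).
  have dist s r d : t <= r <= s -> s <= t + d / 2 -> 0 < d -> `|r - t| < d.
    by move=> /andP[tr rs] sd dp; rewrite ger0_norm ?subr_ge0//; lra.
  move: t0; rewrite le_eqVlt => /predU1P[t0|t0].
    (* From time 0 only the crude velocity bound [M] is at hand: the time span is so short that
       [C * M * s < eta], and the head start absorbs the advance. *)
    pose d := Num.min (d1 / 2) (eta / (C * M + 1)).
    have CM0 : 0 < C * M + 1 by rewrite ltr_wpDl// mulr_ge0.
    exists d; first by rewrite lt_min !divr_gt0.
    move=> s /andP[ts sd] sT; subst t.
    move: sd; rewrite add0r le_min => /andP[sd1 sd2].
    have s0 : 0 <= s <= s by rewrite lexx ltW.
    apply: (@vacuum_beyondS _ _ (a + eta)).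
      by rewrite lerDl mulr_ge0// ltW.
    apply: (prop i sg a eta M M N 0 s) => //.
    - exact: ltW.
    - rewrite subr0; apply: (@lt_le_trans _ _ ((C * M + 1) * s)).
        by rewrite ltr_pM2r// ltrDl.
      by rewrite mulrC -ler_pdivlMr.
    - move=> r rs; have [] := hb r (win s r rs sT) => //.
      by apply: (dist s) => //; rewrite add0r.
    - move=> r rs; have [] := hb r (win s r rs sT) => //.
      by apply: (dist s) => //; rewrite add0r.
    - move=> r rs; have [|_] := hb r (win s r rs sT).
        by apply: (dist s) => //; rewrite add0r.
      by apply: aeS => x h _; exact: h.
  have tTs : 0 < t < T by rewrite t0.
  have uz := vacuum_velocity hsg tTs Pt.
  (* The normal velocity, zero at time [t], stays below [eps] shortly afterwards, and
     [C * eps < eta] means that the front moves more slowly than the comparison front. *)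
  pose eps := eta / (C + 1).
  have C1 : 0 < C + 1 by rewrite ltr_wpDl.
  have eps0 : 0 < eps by rewrite divr_gt0.
  have Ceps : C * eps < eta.
    by rewrite /eps mulrA ltr_pdivrMr// mulrC ltr_pM2l// ltrDl.
  have [d2 d20 hu] := C1_sobolev_continuous k_gt (ns_u_reg sol i) tT' eps0.
  exists (Num.min (d1 / 2) (d2 / 2)); first by rewrite lt_min !divr_gt0.
  move=> s /andP[ts sd] sT.
  have sd1 : s <= t + d1 / 2 by apply: (le_trans sd); rewrite lerD2l ge_min lexx.
  have sd2 : s <= t + d2 / 2 by apply: (le_trans sd); rewrite lerD2l ge_min lexx orbT.
  have -> : a + eta + eta * s = a + eta + eta * t + eta * (s - t) by ring.
  apply: (prop i sg (a + eta + eta * t) (eta * (s - t)) eps M N t s) => //.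
  - exact: ltW.
  - exact: ltW.
  - exact: ltW.
  - by rewrite ltr_pM2r// subr_gt0.
  - by move=> r rs; have [] := hb r (win s r rs sT) (dist s r d1 rs sd1 d10).
  - by move=> r rs; have [] := hb r (win s r rs sT) (dist s r d1 rs sd1 d10).
  - move=> r rs; apply: aeS2 uz (hu r (win s r rs sT) (dist s r d2 rs sd2 d20)) => x h1 h2 /h1 ux.
    by move: h2; rewrite ux subr0.
  - by rewrite lexx ltW.
- move=> t /andP[t0 tT] Pt.
  have tT' : 0 <= t <= T by rewrite ltW.
  have [_ ct] := crho tT'.
  (* Vacuum passes to the limit by continuity in L^oo: at a slightly earlier time the comparison
     front lies further back, so the whole region considered is already vacuum. *)
  have h (j : nat) : {ae leb, forall x : 'rV[R]_n, a + eta + eta * t < sg * x 0 i ->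
      `|rho t x| <= j.+1%:R^-1}.
    have j0 : 0 < j.+1%:R^-1 :> R by rewrite invr_gt0.
    have [d d0 hd] := ct _ j0.
    pose s := Num.max 0 (t - d / 2).
    have s0 : 0 <= s by rewrite le_max lexx.
    have st : s < t by rewrite gt_max t0/=; lra.
    have sd : t - d / 2 <= s by rewrite le_max lexx orbT.
    have sT : 0 <= s <= T by rewrite s0 (le_trans (ltW st)).
    have std : `|s - t| < d by rewrite ltr0_norm ?subr_lt0//; lra.
    have := Pt s; rewrite s0 st => /(_ isT) vs.
    apply: aeS2 vs (hd s sT std) => x h1 h2 xa.
    move: h2; rewrite h1 ?sub0r ?normrN//; apply: le_lt_trans xa.
    by rewrite lerD2l ler_pM2l// ltW.
  apply: aeS (ae_foralln h) => x hx xa; apply/eqP; rewrite -normr_eq0 eq_le normr_ge0 andbT.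
  rewrite leNgt; apply/negP => r0.
  have B0 : 0 <= `|rho t x|^-1 by rewrite invr_ge0.
  have := hx (Num.bound `|rho t x|^-1) xa; apply/negP; rewrite -ltNge.
  rewrite invf_plt ?posrE//; apply: lt_trans (archi_boundP B0) _; by rewrite ltr_nat.
Qed.

End vacuum_front.

(** * Moments *)

Section moments.
Context {R : realType} {n : nat}.
Notation "'leb'" := (@lebesgue_rV R n).

(** Compactly supported substitutes for the constant 1 and for the coordinate [x 0 i]. The plateau
    reaches [L = |r| + 1], strictly beyond [r], so that the first derivatives are the expected ones
    on the whole closed cube. *)
Lemma moment_cutoffs (r : R) (i : 'I_n) : exists (a b : 'I_n -> R) (C : R) (phi psi : 'rV[R]_n -> R),
  [/\ forall l, a l <= b l,
    test_function phi /\ test_function psi,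
    forall x, `|phi x| <= C /\ `|psi x| <= C,
    forall x, ~ box a b x -> phi x = 0 /\ psi x = 0 &
    forall x : 'rV[R]_n, (forall l, `|x 0 l| <= r) ->
      [/\ phi x = 1, psi x = x 0 i, forall j, partial j phi x = 0 &
        forall j, partial j psi x = (i == j)%:R] ].
Proof.
pose L := `|r| + 1; have L0 : 0 < L by rewrite ltr_wpDl.
have rL : r < L by rewrite (le_lt_trans (ler_norm r))// ltrDl.
have [C _ bumps] := @bump_exists R.
have [b [sb b01 bO b1 _]] := bumps 1 (- L - 1) 1 (L + 1) 1 (or_introl erefl) ltr01 ltr01.
have {}bO y : y <= - L - 1 \/ L + 1 <= y -> b y = 0 by move=> h; apply: bO; rewrite mul1r.
have {}b1 y : - L <= y <= L -> b y = 1 by move=> h; apply: b1; rewrite mul1r !subrK addrK.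
pose c y := y * b y.
have sc : smooth1 c by apply: smooth1M => //; exact: smooth1_id.
have bsupp y : b y != 0 -> - L - 1 <= y <= L + 1.
  move=> by0; apply/andP; split; rewrite leNgt; apply: contraNN by0 => h.
    by rewrite bO//; left; exact: ltW.
  by rewrite bO//; right; exact: ltW.
have csupp y : c y != 0 -> - L - 1 <= y <= L + 1.
  by rewrite mulf_eq0 negb_or => /andP[_ /bsupp].
pose fb (l : 'I_n) := b; pose fc (l : 'I_n) := if l == i then c else b.
have sfc l : smooth1 (fc l) by rewrite /fc; case: ifP.
have psiE x : tensor fc x = x 0 i * tensor fb x.
  rewrite !(tensorD1 _ i) /fc eqxx mulrA; congr (_ * _).
  by apply: eq_bigr => l /negbTE ->.
have db y : - L < y < L -> derive1 b y = 0.
  move=> yL; rewrite derive1E.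
  suff D : is_derive y (1 : R) b 0 by have [_ ->] := D.
  apply: (@near_eq_is_derive _ _ _ (cst (1 : R))).
  near=> z; rewrite /cst b1//; apply/andP; split; rewrite ltW//; near: z.
    by apply: lt_nbhsr; case/andP: yL.
  by apply: lt_nbhsl; case/andP: yL.
have dc y : - L < y < L -> derive1 c y = 1.
  move=> yL; rewrite derive1E.
  have D1 := smooth1_is_derive (@smooth1_id R) y; have D2 := smooth1_is_derive sb y.
  have D := @is_deriveM _ _ (fun y => y) b y 1 _ _ D1 D2.
  have -> : c = (fun y => y) * b by [].
  have [_ ->] := D; rewrite db// scaler0 add0r b1; last first.
    by case/andP: yL => /ltW -> /ltW ->.
  by rewrite derive1E derive_id [LHS]mulr1.
have T01 x : 0 <= tensor fb x <= 1.
  rewrite /tensor prodr_ge0/=; last by move=> l _; have /andP[] := b01 (x 0 l).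
  by apply: prodr_ile1 => l _; exact: b01.
have O x : ~ box (fun=> - L - 1) (fun=> L + 1) x -> tensor fb x = 0.
  move=> /existsNP[l]; rewrite /= in_itv/= => /negP; rewrite negb_and -leNgt -ltNge => h.
  rewrite (tensorD1 _ l) /fb bO ?mul0r//.
  by case/orP: h => h; [left|right; exact: ltW].
exists (fun=> - L - 1), (fun=> L + 1), (L + 1), (tensor fb), (tensor fc); split.
- by move=> _; lra.
- split; first by apply: (@tensor_test_function _ _ _ (fun=> - L - 1) (fun=> L + 1)) => //.
  apply: (@tensor_test_function _ _ _ (fun=> - L - 1) (fun=> L + 1)) => // l y.
  by rewrite /fc; case: ifP => _; [exact: csupp|exact: bsupp].
- move=> x; have /andP[h0 h1] := T01 x.
  split; first by rewrite ger0_norm//; lra.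
  have [xB|/O xB] := pselect (box (fun=> - L - 1) (fun=> L + 1) x); last first.
    by rewrite psiE xB mulr0 normr0; lra.
  have := xB i; rewrite /= in_itv/= => /andP[k1 k2].
  rewrite psiE normrM -[leRHS]mulr1; apply: ler_pM => //; last by rewrite ger0_norm.
  by rewrite ler_norml; apply/andP; split; lra.
- by move=> x /O xB; rewrite psiE xB mulr0.
move=> x xr.
have xL l : - L < x 0 l < L by rewrite -ltr_norml (le_lt_trans (xr l)).
have xb l : b (x 0 l) = 1 by apply: b1; have /andP[/ltW -> /ltW ->] := xL l.
have fb1 : tensor fb x = 1 by rewrite /tensor big1.
split => //.
- by rewrite psiE fb1 mulr1.
- by move=> j; rewrite partial_tensor// (tensorD1 _ j) /tensor_diff eqxx db ?mul0r.
- move=> j; rewrite partial_tensor// (tensorD1 _ j) /tensor_diff eqxx /fc.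
  case: (eqVneq i j) => [->|ij].
    by rewrite dc// mul1r big1// => l /negbTE ->.
  by rewrite db ?mul0r.
Unshelve. all: by end_near. Qed.

End moments.

(** * Conservation laws and the bound on the first moment *)

Section conclusion.
Context {R : realType} {n : nat}.
Notation "'leb'" := (@lebesgue_rV R n).
Variables (mu lambda kappa : R -> R -> R) (Rgas A gamma T r0 : R) (k : nat).
Variables (rho S theta p e : R -> 'rV[R]_n -> R) (u : R -> 'rV[R]_n -> 'rV[R]_n).
Hypotheses (Rgas_gt0 : 0 < Rgas) (A_gt0 : 0 < A) (gamma_gt1 : 1 < gamma).
Hypotheses (mu_gt0 : 0 < mu 0 0) (lambda_gt0 : 0 < n%:R * lambda 0 0 + 2 * mu 0 0).
Hypothesis sol : navier_stokes_solution mu lambda kappa Rgas A gamma k T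
  rho S u theta p e.
Hypotheses (k_gt : (n < 2 * k)%N) (T_gt0 : 0 < T).
Hypothesis supp0 : {ae leb, forall x : 'rV[R]_n, ~ euclidean_ball r0 x -> rho 0 x = 0}.

Let cube : set 'rV[R]_n := [set x | forall l, `|x 0 l| <= r0].

Let crho : Linf_continuous T rho := C1_sobolev_Linf k_gt (ns_rho_reg sol).

Let cu i : Linf_continuous T (fun t x => u t x 0 i) := C1_sobolev_Linf k_gt (ns_u_reg sol i).

Lemma ae_outside_cube (P : 'rV[R]_n -> Prop) :
  (forall i sg, sg = 1 \/ sg = -1 -> {ae leb, forall x : 'rV[R]_n, r0 < sg * x 0 i -> P x}) ->
  {ae leb, forall x : 'rV[R]_n, ~ cube x -> P x}.
Proof.
move=> h.
have : {ae leb, forall x : 'rV[R]_n, forall i, (r0 < x 0 i -> P x) /\ (r0 < - x 0 i -> P x)}.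
  apply: filter_forall => i.
  apply: aeS2 (h i 1 (or_introl erefl)) (h i (-1) (or_intror erefl)) => x.
  by rewrite mul1r mulN1r.
apply: aeS => x hx /existsNP[i] /negP; rewrite -ltNge ltr_normr.
by have [h1 h2] := hx i => /orP[/h1|/h2].
Qed.

Lemma vacuum_half_space i sg t : sg = 1 \/ sg = -1 -> 0 <= t <= T ->
  vacuum_beyond rho i sg r0 t.
Proof.
move=> hsg; apply: (vacuum_front Rgas_gt0 A_gt0 gamma_gt1 mu_gt0 lambda_gt0 sol k_gt hsg).
apply: aeS supp0 => x h xr; apply: h; apply/negP; rewrite -leNgt.
apply: le_trans (ltW xr) _; have : `|x 0 i| <= euclidean_norm x.
  rewrite /euclidean_norm -sqrtr_sqr ler_wsqrtr// (bigD1 i)//= lerDl.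
  by apply: sumr_ge0 => j _; exact: sqr_ge0.
by apply: le_trans; case: hsg => ->; rewrite ?mul1r ?mulN1r ?ler_norm// -normrN ler_norm.
Qed.

Lemma vacuum_outside_cube t : 0 <= t <= T ->
  {ae leb, forall x : 'rV[R]_n, ~ cube x -> rho t x = 0}.
Proof. by move=> tT; apply: ae_outside_cube => i sg hsg; exact: vacuum_half_space. Qed.

(** The viscous coefficients need not vanish in vacuum; the stress does because the strain vanishes
    there and the divergence is half the trace of the strain. *)
Lemma stress_outside_cube t : 0 < t < T -> {ae leb, forall x : 'rV[R]_n, ~ cube x ->
  [/\ rho t x = 0, p t x = 0 & viscous_stress mu lambda (rho t) (theta t) (u t) x = 0]}.
Proof.
move=> tT; have tT' : 0 <= t <= T by have /andP[h1 h2] := tT; rewrite !ltW.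
apply: ae_outside_cube => i sg hsg; have vac := vacuum_half_space i hsg tT'.
have str := vacuum_strain Rgas_gt0 A_gt0 gamma_gt1 mu_gt0 lambda_gt0 sol hsg tT vac.
apply: aeS2 (vacuum_state sol tT' vac) str => x h1 h2 xr.
have [-> _ -> _] := h1 xr; have s0 := h2 xr; split=> //.
rewrite /viscous_stress s0 scaler0 add0r.
have -> : wdiv (u t) x = 2^-1 * \tr (strain (u t) x).
  by rewrite /strain mxtraceD mxtrace_tr -/(wdiv (u t) x); lra.
by rewrite s0 mxtrace0 !mulr0 raddf0.
Qed.

(** The balance laws are tested with the substitutes for 1 and [x 0 i]: these have the right values
    and derivatives on the cube, and all fluxes vanish outside it. So mass and momentum are constant
    in time and the first moment grows at the rate of the momentum. *)
Lemma moment_bounds (i : 'I_n) : exists phi psi : 'rV[R]_n -> R,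
  [/\ measurable_fun setT phi, measurable_fun setT psi,
    (forall x, cube x -> phi x = 1 /\ psi x = x 0 i) &
    `|\int[leb]_x (rho 0 x * psi x) + \int[leb]_x (rho 0 x * u 0 x 0 i * phi x) * T| <=
      r0 * \int[leb]_x (rho 0 x * phi x)].
Proof.
have [a [b [C [phi [psi [ab [tphi tpsi] bd out inn]]]]]] := moment_cutoffs r0 i.
have mtest (f : 'rV[R]_n -> R) : test_function f -> measurable_fun setT f.
  by move=> [sf _]; apply: continuous_measurable_rV; have [] := sf [::].
have mphi := mtest _ tphi; have mpsi := mtest _ tpsi.
exists phi, psi; split=> //; first by move=> x /inn[].
pose M t := \int[leb]_x (rho t x * phi x).
pose P t := \int[leb]_x (rho t x * u t x 0 i * phi x).
pose Q t := \int[leb]_x (rho t x * psi x).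
rewrite -/(M 0) -/(P 0) -/(Q 0).
have cM : {within `[0, T], continuous M}.
  apply: (Linf_integral_continuous crho mphi _ _ ab (S := C)) => x; first by have [] := bd x.
  by move=> /out[].
have cQ : {within `[0, T], continuous Q}.
  apply: (Linf_integral_continuous crho mpsi _ _ ab (S := C)) => x; first by have [] := bd x.
  by move=> /out[].
have cP : {within `[0, T], continuous P}.
  apply: (Linf_integral_continuous (Linf_continuousM crho (cu i)) mphi _ _ ab (S := C)) => x.
    by have [] := bd x.
  by move=> /out[].
have zero (f g : 'rV[R]_n -> R) : measurable_fun setT f -> measurable_fun setT g ->
    {ae leb, forall x, f x * g x = 0} -> \int[leb]_x (f x * g x) = 0.
  move=> mf mg h; rewrite (@Rintegral_ae_eq _ _ _ _ _ (fun=> 0)) /Rintegral ?integral0//.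
  exact: measurable_funM.
have mpartial (f : 'rV[R]_n -> R) j : test_function f -> measurable_fun setT (partial j f).
  by move=> tf; apply: mtest; exact: test_function_partial.
have dM t : 0 < t < T -> is_derive t (1 : R) M 0.
  move=> tT; have [_ lF _ /(_ _ tphi)] := ns_mass sol tT.
  suff -> : \sum_j \int[leb]_x ((rho t x *: u t x) 0 j * partial j phi x) +
    \int[leb]_x (0 * phi x) = 0 by [].
  rewrite zero//; last by apply: aeW => x; rewrite mul0r.
  rewrite addr0 big1// => j _; have [mF _] := lF j; apply: zero => //; first exact: mpartial.
  apply: aeS (stress_outside_cube tT) => x hx.
  have [/inn[_ _ -> _]|/hx[r _ _]] := pselect (cube x); first by rewrite mulr0.
  by rewrite r scale0r mxE mul0r.
have dP t : 0 < t < T -> is_derive t (1 : R) P 0.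
  move=> tT; have [_ lF _ /(_ _ tphi)] := ns_momentum sol i tT.
  set G := (_ + _); suff -> : G = 0 by [].
  rewrite /G zero//; last by apply: aeW => x; rewrite mul0r.
  rewrite addr0 big1// => j _; have [mF _] := lF j; apply: zero => //; first exact: mpartial.
  apply: aeS (stress_outside_cube tT) => x hx.
  have [/inn[_ _ -> _]|/hx[r p0 v0]] := pselect (cube x); first by rewrite mulr0.
  by rewrite r p0 v0 mul0r !scale0r !add0r row0 oppr0 mxE mul0r.
have dQ t : 0 < t < T -> is_derive t (1 : R) Q (P t).
  move=> tT; have [_ lF _ /(_ _ tpsi)] := ns_mass sol tT.
  set G := (_ + _); suff -> : G = P t by [].
  rewrite /G zero//; last by apply: aeW => x; rewrite mul0r.
  rewrite addr0 (bigD1 i)//= big1 ?addr0.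
    have [mF _] := lF i; have [lq _ _ _] := ns_momentum sol i tT; have [mq _] := lq.
    apply: Rintegral_ae_eq; [|exact: measurable_funM|].
      by apply: measurable_funM => //; exact: mpartial.
    apply: aeS (stress_outside_cube tT) => x hx; rewrite mxE.
    have [/inn[-> _ _ ->]|/hx[r _ _]] := pselect (cube x); first by rewrite eqxx.
    by rewrite r !mul0r.
  move=> j ji; have [mF _] := lF j; apply: zero => //; first exact: mpartial.
  apply: aeS (stress_outside_cube tT) => x hx.
  have [/inn[_ _ _ ->]|/hx[r _ _]] := pselect (cube x).
    by rewrite eq_sym (negbTE ji) mulr0.
  by rewrite r scale0r mxE mul0r.
have sub t : t <= T -> `[0, t] `<=` `[0, T].
  by move=> tT s; rewrite /= !in_itv/= => /andP[-> h]; exact: le_trans tT.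
(* The balance laws give derivatives at interior times only; continuity up to the endpoints brings
   in the initial and final values through the mean value theorem. *)
have const (f : R -> R) t : {within `[0, T], continuous f} ->
    (forall s, 0 < s < T -> is_derive s (1 : R) f 0) -> 0 < t <= T -> f t = f 0.
  move=> cf df /andP[t0 tT].
  have [|c _] := @MVT R f (fun=> 0) 0 t t0 _ (continuous_subspaceW (sub t tT) cf).
    by move=> s; rewrite in_itv/= => /andP[s0 st]; apply: df; rewrite s0 (lt_le_trans st).
  by rewrite mul0r => /eqP; rewrite subr_eq0 => /eqP.
have MT : M T = M 0 by apply: const => //; rewrite T_gt0 lexx.
have QT : Q T = Q 0 + P 0 * T.
  have dQ' s : s \in `]0, T[%R -> is_derive s (1 : R) Q (P s) by rewrite in_itv; exact: dQ.
  have [c] := MVT T_gt0 dQ' cQ; rewrite in_itv/= subr0 => /andP[c0 cT]; rewrite (const P c)//.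
    by move=> <-; rewrite addrC subrK.
  by rewrite c0 ltW.
rewrite -QT -MT.
have TT : 0 <= T <= T by rewrite lexx ltW.
have lT : loc_integrable (rho T).
  by have [f' hf] := ns_rho_reg sol; have [/sobolev_loc_integrable] := hf T TT.
have i1 := integrable_test [::] lT tphi; have i2 := integrable_test [::] lT tpsi.
apply: (le_trans (le_normr_Rintegral _ i2)) => //.
rewrite /M -RintegralZl//; apply: le_ae_Rintegral; first exact: integrable_norm.
  exact: (integrableZl measurableT r0 i1).
(* At time [T] the gas still lies in the cube, where the coordinate is at most [r0] in absolute
   value: the first moment is at most [r0] times the mass. *)
apply: aeS2 (vacuum_outside_cube TT) (ns_rho_ge0 sol TT) => x hx x0.
have [xc|/hx ->] := pselect (cube x); last by rewrite !mul0r normr0 mulr0.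
have [phi1 psi1 _ _] := inn _ xc; rewrite /= phi1 psi1 mulr1 normrM ger0_norm// mulrC.
by rewrite ler_wpM2r.
Qed.

End conclusion.

Unset Implicit Arguments.
Set Strict Implicit.
Set Printing Implicit Defensive.

Local Open Scope ring_scope.

Theorem theorem1p3 (R : realType) (n k : nat) (T r0 : R)
    (Rgas A gamma : R) (mu lambda kappa : R -> R -> R) (lambda0 : R)
    (rho0 S0 : 'rV[R]_n -> R) (u0 : 'rV[R]_n -> 'rV[R]_n)
    (rho S theta p e : R -> 'rV[R]_n -> R) (u : R -> 'rV[R]_n -> 'rV[R]_n)
    (n_ge1 : (1 <= n)%N) (k_gt : (n %/ 2 + 2 < k)%N) (T_gt0 : 0 < T)
    (Rgas_gt0 : 0 < Rgas) (A_gt0 : 0 < A) (gamma_gt1 : 1 < gamma)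
    (mu_gt0 : 0 < mu 0 0)
    (lambda0E : n%:R * lambda 0 0 + 2 * mu 0 0 = lambda0)
    (lambda0_gt0 : 0 < lambda0)
    (kappa_ge0 : forall s1 s2 : R, 0 <= s1 -> 0 <= s2 -> 0 <= kappa s1 s2)
    (rho0_Hk : sobolev k rho0) (S0_Hk : sobolev k S0)
    (u0_Hk : forall i, sobolev k (fun x => u0 x 0 i))
    (sol : navier_stokes_solution mu lambda kappa Rgas A gamma k T
             rho S u theta p e)
    (rho_init : \forall x \ae lebesgue_rV n, rho 0 x = rho0 x)
    (S_init : \forall x \ae lebesgue_rV n, S 0 x = S0 x)
    (u_init : \forall x \ae lebesgue_rV n, u 0 x = u0 x)
    (rho0_supp : \forall x \ae lebesgue_rV n,
       ~ euclidean_ball r0 x -> rho0 x = 0)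
    (m0_gt0 : 0 < mass rho0) :
  forall i : 'I_n,
    mass rho0 * r0 >= first_moment rho0 i + momentum rho0 u0 i * T /\
    first_moment rho0 i + momentum rho0 u0 i * T >= - (mass rho0 * r0).
Proof.
move=> i.
have k2 : (n < 2 * k)%N.
  rewrite (divn_eq n 2) mulnC; apply: (@leq_trans (2 * (n %/ 2) + 2)).
    by rewrite -addnS leq_add2l ltn_mod.
  by rewrite -mulnSr leq_mul2l/= (leq_trans _ (ltnW k_gt))// addn2.
rewrite -{}lambda0E in lambda0_gt0.
have supp0 : {ae lebesgue_rV n, forall x : 'rV[R]_n, ~ euclidean_ball r0 x -> rho 0 x = 0}.
  by apply: aeS2 rho_init rho0_supp => x -> h /h.
have [phi [psi [mphi mpsi cutoff]]] := moment_bounds Rgas_gt0 A_gt0 gamma_gt1 mu_gt0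
  lambda0_gt0 sol k2 T_gt0 supp0 i.
have T0 : 0 <= (0 : R) <= T by apply/andP; split=> //; exact: ltW.
have vac := vacuum_outside_cube Rgas_gt0 A_gt0 gamma_gt1 mu_gt0 lambda0_gt0 sol k2 supp0 T0.
have mr0 : measurable_fun setT rho0 by have [] := sobolev_loc_integrable rho0_Hk.
have mu0 : measurable_fun setT (fun x => u0 x 0 i).
  by have [] := sobolev_loc_integrable (u0_Hk i).
have mr : measurable_fun setT (rho 0).
  by have [[]] := C1_sobolev_Linf k2 (ns_rho_reg sol) T0.
have mu' : measurable_fun setT (fun x => u 0 x 0 i).
  by have [[]] := C1_sobolev_Linf k2 (ns_u_reg sol i) T0.
have init := aeS2 (fun x (a : _ = _) (b : _ -> _) => conj a b) rho_init vac.
have -> : \int[lebesgue_rV n]_x (rho 0 x * phi x) = mass rho0.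
  apply: Rintegral_ae_eq => //; first exact: measurable_funM.
  apply: aeS init => x [re vx]; rewrite -re.
  have [/cutoff[-> _]|/vx ->] := pselect (forall l, `|x 0 l| <= r0); first by rewrite mulr1.
  by rewrite mul0r.
have -> : \int[lebesgue_rV n]_x (rho 0 x * psi x) = first_moment rho0 i.
  apply: Rintegral_ae_eq; [exact: measurable_funM| |].
    by apply: measurable_funM => //; exact: measurable_coord.
  apply: aeS init => x [re vx]; rewrite -re.
  have [/cutoff[_ ->]//|/vx ->] := pselect (forall l, `|x 0 l| <= r0).
  by rewrite !mul0r.
have -> : \int[lebesgue_rV n]_x (rho 0 x * u 0 x 0 i * phi x) = momentum rho0 u0 i.
  apply: Rintegral_ae_eq; [|exact: measurable_funM|].
    by apply: measurable_funM => //; exact: measurable_funM.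
  apply: aeS2 init u_init => x [re vx] ue; rewrite -re -ue.
  have [/cutoff[-> _]|/vx ->] := pselect (forall l, `|x 0 l| <= r0); first by rewrite mulr1.
  by rewrite !mul0r.
by rewrite ler_norml mulrC => /andP[h1 h2].
Qed.
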